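(* Let $A$ be a finite set and let $M$ be a maximal sub-RTA of $B(A)$. Then $M^{[i]} \neq B_i(A)$ for exactly one $i$, and (for this $i$) $M$ belongs to one of the following classes: 1. $i=1$ and $M^{[1]}$ is, up to conjugacy in $\operatorname{Sym}(A)$, one of the groups in the list (L) (given in the context) with $n=|A|$. 2. $i=2$, $|A|=3$, and $M^{[2]} = AGL_2(3)$ (up to conjugacy). 3. $i=2$, $|A|\geq 5$ is odd, and $M^{[2]} = S_A \,\mathrm{wr}\, S_2$. 4. $i=2$, $|A| \equiv 2 \pmod 4$, and $M^{[2]} = S_A \,\mathrm{wr}\, S_2$. 5. $i=2$, $|A| \equiv 0 \pmod 4$, and $M^{[2]} = \operatorname{Alt}(A^2)$. 6. $i=2$, $|A| \equiv 0 \pmod 4$, and $M^{[2]} = T^{3}.(\operatorname{Out}(T)\times S_3)$ (up to conjugacy), where $T$ is a finite nonabelian simple group with $|A|=|T|$. 7. $i=2$, $|A| \equiv 0 \pmod 4$, and $M^{[2]}$ is an almost simple group (up to conjugacy). 8. $i\geq 3$, $|A|$ is even, and $M^{[i]} = \operatorname{Alt}(A^i)$.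
   Context: For a finite set $X$, $\operatorname{Sym}(X)=S_X$ is the group of permutations of $X$ and $\operatorname{Alt}(X)$ the subgroup of even permutations; $S_n, A_n$ denote these for $X=\{1,\dots,n\}$. Reversible gates and RTAs: for a finite set $A$ and $n\geq 1$, $B_n(A)=\operatorname{Sym}(A^n)$ and $B(A)=\bigcup_{n} B_n(A)$. For $\alpha\in S_n$ the wire permutation $\pi_\alpha\in B_n(A)$ is $\pi_\alpha(x_1,\dots,x_n)=(x_{\alpha^{-1}(1)},\dots,x_{\alpha^{-1}(n)})$; $\Pi$ is the set of all wire permutations of all arities; $i_n\in B_n(A)$ is the identity. For $f\in B_n(A)$, $g\in B_m(A)$, the parallel composition $f\oplus g\in B_{n+m}(A)$ applies $f$ to the first $n$ coordinates and $g$ to the last $m$ coordinates. The serial composition $f\bullet g$ is composition in $\operatorname{Sym}(A^n)$ when $f,g$ have the same arity $n$; if the arities differ, the one of smaller arity is first padded on the right by an identity (e.g. $f\bullet g=(f\oplus i_{m-n})\bullet g$ if $n<m$). A reversible Toffoli algebra (RTA) on $A$ is a subset $C\subseteq B(A)$ containing $\Pi$ and closed under $\oplus$ and $\bullet$. Write $C^{[n]}=C\cap B_n(A)$. A maximal sub-RTA of $B(A)$ is an RTA $M\subsetneq B(A)$ such that no RTA $N$ satisfies $M\subsetneq N\subsetneq B(A)$. Product-action wreath product: $S_A\,\mathrm{wr}\,S_n$ acts on $A^n$, its elements being $(g_1,\dots,g_n,\alpha)$ with $g_j\in S_A$, $\alpha\in S_n$, acting by $(a_1,\dots,a_n)\mapsto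 (a_{\alpha^{-1}(1)}^{g_1},\dots,a_{\alpha^{-1}(n)}^{g_n})$. $AGL_k(q)$ is the group of invertible affine maps of $GF(q)^k$ to itself; when $|A|=q$, $A$ is identified with $GF(q)$. List (L) of subgroups $G$ of $S_n$: (1) (alternating) $G=A_n$; (2) (intransitive) $G=S_k\times S_m$ where $k+m=n$, $k\neq m$; (3) (imprimitive) $G=S_m\,\mathrm{wr}\,S_k$ where $n=mk$, $m,k>1$, acting on $n$ points as the stabilizer of an equivalence relation with $k$ classes of size $m$; (4) (affine) $G=AGL_k(p)$ where $n=p^k$, $p$ prime; (5) (diagonal) $G=T^k.(\operatorname{Out}(T)\times S_k)$ where $T$ is a nonabelian simple group, $k>1$, $n=|T|^{k-1}$, in its diagonal action on $n$ points; (6) (wreath) $G=S_m\,\mathrm{wr}\,S_k$ with $n=m^k$, $m\geq 5$, $k>1$, in product action; (7) (almost simple) $T\triangleleft G\leq \operatorname{Aut}(T)$, $T\neq A_n$ a nonabelian simple group, $G$ acting primitively on the $n$ points. In class 6 of the claim, the group is of diagonal type (5) with $k=3$, acting on $|A|^2=|T|^2$ points. In class 7, ''almost simple'' means type (7) with $n=|A|^2$, acting primitively on $A^2$. ''Up to conjugacy'' means up to conjugacy in $\operatorname{Sym}(A^i)$. *)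

(* Defs.v *)
From HB Require Import structures.
From mathcomp Require Import all_boot all_order all_algebra all_fingroup all_solvable.

Set Implicit Arguments.
Unset Strict Implicit.
Unset Printing Implicit Defensive.

Import GRing.Theory.
Local Open Scope group_scope.

(** * Reversible gates *)

Notation word A n := {ffun 'I_n -> A}.

Notation gate A n := {perm {ffun 'I_n -> A}}.

Section Gates.

Variable A : finType.

Definition wire_fun n (alpha : 'S_n) (x : word A n) : word A n :=
  [ffun i => x (alpha^-1 i)].

Lemma wire_fun_inj n (alpha : 'S_n) : injective (wire_fun alpha).
Proof.
move=> x y /ffunP exy; apply/ffunP => i.
by have := exy (alpha i); rewrite !ffunE permK.
Qed.

Definition wire n (alpha : 'S_n) : gate A n := perm (@wire_fun_inj n alpha).

Definition lword n m (x : word A (n + m)) : word A n :=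
  [ffun i => x (lshift m i)].

Definition rword n m (x : word A (n + m)) : word A m :=
  [ffun j => x (rshift n j)].

Definition catword n m (x : word A n) (y : word A m) : word A (n + m) :=
  [ffun i => match split i with inl j => x j | inr j => y j end].

Lemma lwordK n m (x : word A n) (y : word A m) : lword (catword x y) = x.
Proof. by apply/ffunP => i; rewrite !ffunE (unsplitK (inl i)). Qed.

Lemma rwordK n m (x : word A n) (y : word A m) : rword (catword x y) = y.
Proof. by apply/ffunP => i; rewrite !ffunE (unsplitK (inr i)). Qed.

Lemma catwordK n m (x : word A (n + m)) : catword (lword x) (rword x) = x.
Proof.
apply/ffunP => i; rewrite ffunE -[in RHS](splitK i).
by case: (split i) => j; rewrite ffunE.
Qed.

Definition par_fun n m (f : gate A n) (g : gate A m) (x : word A (n + m)) :=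
  catword (f (lword x)) (g (rword x)).

Lemma par_fun_inj n m (f : gate A n) (g : gate A m) : injective (par_fun f g).
Proof.
move=> x y exy; rewrite -(catwordK x) -(catwordK y).
have /perm_inj -> : f (lword x) = f (lword y).
  by have := congr1 (@lword n m) exy; rewrite !lwordK.
have /perm_inj -> // : g (rword x) = g (rword y).
by have := congr1 (@rword n m) exy; rewrite !rwordK.
Qed.

Definition par n m (f : gate A n) (g : gate A m) : gate A (n + m) :=
  perm (par_fun_inj (f:=f) (g:=g)).

(** * Reversible Toffoli algebras *)

(** A set of gates is given arity by arity: [C n] is the set of its members of
    arity [n]. Arities are positive, so level 0 of a set of gates is empty;
    in particular it plays no role when sets of gates are compared. *)
Definition gateset := forall n, {set gate A n}.

Definition allgates : gateset := fun n => [set f | 0 < n].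

Definition gateset_sub (C D : gateset) : Prop := forall n, C n \subset D n.

Definition gateset_proper (C D : gateset) : Prop :=
  gateset_sub C D /\ ~ gateset_sub D C.

(** Serial composition is the product of permutations when the arities agree.
    When they are [n] and [n + k] with [0 < k], the gate of arity [n] is first
    extended by the identity gate [1] of arity [k]; it can be either the first
    or the second factor, whence the two padded clauses. *)
Record is_RTA (C : gateset) : Prop := IsRTA {
  RTA_sub : gateset_sub C allgates;
  RTA_wire : forall n (alpha : 'S_n), 0 < n -> wire alpha \in C n;
  RTA_par : forall n m (f : gate A n) (g : gate A m),
    f \in C n -> g \in C m -> par f g \in C (n + m)%N;
  RTA_serial : forall n (f g : gate A n),
    f \in C n -> g \in C n -> f * g \in C n;
  RTA_serial_padl : forall n k (f : gate A n) (g : gate A (n + k)),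
    0 < k -> f \in C n -> g \in C (n + k)%N ->
    par f (1 : gate A k) * g \in C (n + k)%N;
  RTA_serial_padr : forall n k (f : gate A n) (g : gate A (n + k)),
    0 < k -> f \in C n -> g \in C (n + k)%N ->
    g * par f (1 : gate A k) \in C (n + k)%N
}.

Definition maximal_RTA (M : gateset) : Prop :=
  [/\ is_RTA M, gateset_proper M allgates &
      ~ exists N : gateset,
          [/\ is_RTA N, gateset_proper M N & gateset_proper N allgates]].

End Gates.

(** * Permutation groups *)

(** Conjugacy of permutation groups after an identification of the two sets
    of points: some bijection of the points carries [G] onto [H]. *)
Definition perm_isomorphic (X Y : finType)
    (G : {set {perm X}}) (H : {set {perm Y}}) : Prop :=
  exists2 u : X -> Y, bijective u &
    forall (g : {perm X}) (h : {perm Y}),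
      (forall x, h (u x) = u (g x)) -> (g \in G) = (h \in H).

Definition product_wreath (A : finType) (n : nat) : {set gate A n} :=
  [set f : gate A n | [exists g : {ffun 'I_n -> {perm A}}, exists alpha : 'S_n,
    forall x : word A n, forall i, f x i == g i (x (alpha^-1 i))]].

Definition AGL (F : finFieldType) (k : nat) : {set {perm 'rV[F]_k}} :=
  [set f : {perm 'rV[F]_k} | [exists L : 'M[F]_k, exists v : 'rV[F]_k,
    (L \in unitmx) && [forall x, f x == (x *m L + v)%R]]].

(** The diagonal group with socle [T^k]. It is the group of all
    [(a_1, .., a_k) pi] in [Aut(T) wr S_k] with the [a_i] in one and the same
    coset of [Inn(T)], acting on the cosets of the stabilizer formed by the
    elements [(a, .., a) pi]. As [T^k] is transitive with point stabilizer its
    diagonal subgroup [D], the points are identified with the cosets [D x] of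
    [D] in [T^k]. The elements of the group are then the maps
    [D x |-> D y], [y_i = phi (x_(pi^-1 i)) t_i], where [phi] is an
    automorphism of [T], [t] is in [T^k] and [pi] is in [S_k]. *)
Section Diagonal.

Variables (T : finGroupType) (k : nat).

Definition diag_coset (x : word T k) : {set word T k} :=
  [set [ffun i => d * x i] | d : T].

Definition diag_point := {C : {set word T k} | C \in [set diag_coset x | x : word T k]}.

Definition diag_map (phi : {perm T}) (t : word T k) (pi : 'S_k) (x : word T k) :
    word T k :=
  [ffun i => phi (x (pi^-1 i)) * t i].

Definition diagonal_group : {set {perm diag_point}} :=
  [set f : {perm diag_point} |
    [exists phi in Aut [set: T], exists t : word T k, exists pi : 'S_k,
      forall C : diag_point, val (f C) == diag_map phi t pi @: val C]].

End Diagonal.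

Definition nonabelian_simple (T : finGroupType) : Prop :=
  simple [set: T] /\ ~~ abelian [set: T].

Definition Inn (T : finGroupType) : {set {perm T}} :=
  conj_aut [group of [set: T]] @* [set: T].

Section ListL.

Variables (X : finType) (G : {set {perm X}}).

Definition alternating_type : Prop := G = 'Alt_X.

Definition intransitive_type : Prop :=
  exists Y : {set X},
    [/\ 0 < #|Y|, 0 < #|~: Y|, #|Y| != #|~: Y| &
        perm.Sym Y \x perm.Sym (~: Y) = G].

Definition imprimitive_type : Prop :=
  exists (m k : nat) (P : {set {set X}}),
    [/\ 1 < m, 1 < k & #|X| = (m * k)%N] /\
    [/\ partition P [set: X], #|P| = k, (forall Y, Y \in P -> #|Y| = m) &
        G = [set g : {perm X} | [forall Y in P, g @: Y \in P]]].

Definition affine_type : Prop :=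
  exists p k : nat,
    [/\ prime p, 0 < k, #|X| = (p ^ k)%N & perm_isomorphic G (AGL 'F_p k)].

Definition diagonal_type : Prop :=
  exists (T : finGroupType) (k : nat),
    [/\ nonabelian_simple T, 1 < k, #|X| = (#|T| ^ k.-1)%N &
        perm_isomorphic G (diagonal_group T k)].

Definition wreath_type : Prop :=
  exists m k : nat,
    [/\ 5 <= m, 1 < k, #|X| = (m ^ k)%N &
        perm_isomorphic G (product_wreath 'I_m k)].

(** [T <| G <= Aut(T)], with [T] identified with [Inn(T)]. *)
Definition almost_simple_type : Prop :=
  exists (T : finGroupType) (H : {group {perm T}}),
    [/\ nonabelian_simple T, ~~ ([set: T] \isog 'Alt_X),
        Inn T \subset H /\ H \subset Aut [set: T],
        G \isog H & [primitive G, on [set: X] | 'P]].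

Definition list_L : Prop :=
  alternating_type \/ intransitive_type \/ imprimitive_type \/ affine_type \/
  diagonal_type \/ wreath_type \/ almost_simple_type.

End ListL.

(* Main.v *)
Require Import Defs.
From mathcomp Require Import all_boot all_order all_algebra all_fingroup all_solvable.
From mathcomp Require Import all_character.
From mathcomp Require Import zify.
From Stdlib Require Classical_Prop.

(** Let [M] be a maximal RTA and [i] the least arity at which a gate is missing.
    Composition never decreases the arity, so adding to [M] all gates of arity
    above [i] gives an RTA; hence all levels of [M] but the [i]-th are full. In
    the same way the [i]-th level can be replaced by any larger subgroup of the
    symmetric group, so it is a maximal subgroup of [Sym (A^i)]
    ([one_proper_level], [level_max]). It contains what the lower levels generate,
    and it remains to find the maximal subgroups that do.

    Arity 1. There is no further condition, and the list (L) is the O'Nan-Scott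
    theorem for maximal subgroups ([max_perm_list_L]). A primitive maximal group [G]
    has a minimal normal subgroup [N]. If [N] is abelian, [G] is affine. If [N] is a
    product of several simple groups, its point stabilizer either is the
    intersection of its products with the cofactors of [N], or it projects onto every
    factor; depending on the kernels of the projections there is a Cartesian
    decomposition preserved by [G], which gives the wreath type, or the stabilizer
    is a full diagonal. If [N] is simple, [G] is almost simple or [N] is regular,
    and then [G] is diagonal. As [G] is maximal, an embedding into one of the groups
    of the list is enough.

    Arities above 1. Two permutations whose supports meet in a single point have a
    3-cycle as commutator, and a primitive group with a 3-cycle contains the
    alternating group ([overlap1_has_c3], [primitive_has_c3]). So the groups without
    3-cycles have to be determined.

    Arity 2. The group contains the wreath product [S_A wr S_2], that is, the
    permutations of the rows and of the columns of the grid [A^2], and their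
    exchange. Let it have no 3-cycle. If [#|A|] is at least 5, consider an element of
    minimal degree and its commutators with the transpositions of two rows: they are
    trivial or have small degree, and counting moved points in rows and columns
    shows that the minimal degree is that of the transposition of two rows, and that
    an element of minimal degree preserves all rows or all columns
    ([min_degree_preserves]). This applies to the conjugates of the transpositions of
    rows, so all elements of the group map lines to lines ([grid_lines]) and the
    group is the wreath product. The latter consists of even permutations exactly
    when 4 divides [#|A|], which separates the classes ([level2]). For [#|A|] equal to
    4 the O'Nan-Scott theorem applies, and the affine group is even. For [#|A|] equal
    to 3 the lines of the affine plane are the fixed point sets of involutions, a
    computation shows that the group permutes them, and so it is affine.

    Arity at least 3. A transposition of words lifted to the coordinates other than
    the first, and another one lifted to those other than the second, can be chosen
    with one common moved word, so there are 3-cycles ([level3_c3]); for two letters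
    and arity 3 the group either has 3-cycles or preserves the planes of the affine
    space and is even ([level3_eight]). The level is thus the alternating group, and
    [#|A|] is even because lifted transpositions are even ([level3_even]). *)

Set Implicit Arguments.
Unset Strict Implicit.
Unset Printing Implicit Defensive.

Import GRing.Theory.
Local Open Scope group_scope.

(** * Three-cycles and the alternating group *)

Section ThreeCycles.

Variable X : finType.
Implicit Types (g v w : {perm X}) (x y z : X) (G : {group {perm X}}).

Definition c3 x y z : {perm X} := tperm x y * tperm x z.

Lemma c3J x y z g : c3 x y z ^ g = c3 (g x) (g y) (g z).
Proof. by rewrite conjMg !tpermJ. Qed.

Lemma c3E x y z : x != y -> x != z -> y != z ->
  [/\ c3 x y z x = y, c3 x y z y = z, c3 x y z z = x &
      forall t, t != x -> t != y -> t != z -> c3 x y z t = t].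
Proof.
move=> xy xz yz; rewrite /c3; split=> [||| t tx ty tz]; rewrite !permM.
- by rewrite tpermL tpermD // eq_sym.
- by rewrite tpermR tpermL.
- by rewrite [tperm x y z]tpermD // tpermR.
by rewrite !tpermD // eq_sym.
Qed.

Lemma c3_eq x y z g : x != y -> x != z -> y != z ->
  g x = y -> g y = z -> g z = x ->
  (forall t, t != x -> t != y -> t != z -> g t = t) -> g = c3 x y z.
Proof.
move=> xy xz yz gx gy gz gt; apply/permP => t.
have [ex ey ez et] := c3E xy xz yz.
have [->|tx] := eqVneq t x; first by rewrite gx ex.
have [->|ty] := eqVneq t y; first by rewrite gy ey.
have [->|tz] := eqVneq t z; first by rewrite gz ez.
by rewrite gt // et.
Qed.

Lemma c3_rot x y z : x != y -> x != z -> y != z -> c3 x y z = c3 y z x.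
Proof.
move=> xy xz yz; have [ex ey ez et] := c3E xy xz yz.
by apply: c3_eq => //; rewrite 1?eq_sym // => t ty tz tx; rewrite et.
Qed.

Lemma c3V x y z : x != y -> x != z -> y != z -> (c3 x y z)^-1 = c3 y x z.
Proof.
move=> xy xz yz; have [ex ey ez et] := c3E xy xz yz.
have inv t u : c3 x y z t = u -> (c3 x y z)^-1 u = t by move=> <-; rewrite permK.
apply: c3_eq; rewrite 1?(eq_sym y x) //; [exact: inv | exact: inv | exact: inv |].
by move=> t ty tx tz; apply/inv/et.
Qed.

Definition supp v : {set X} := [set x | v x != x].

Lemma suppP v x : reflect (v x <> x) (x \in supp v).
Proof. by rewrite inE; apply: (iffP idP) => /eqP. Qed.

Lemma supp0P v x : reflect (v x = x) (x \notin supp v).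
Proof. by rewrite inE negbK; apply: (iffP idP) => /eqP. Qed.

Lemma supp_eq1 v : (supp v == set0) = (v == 1).
Proof.
apply/eqP/eqP => [s0|->].
  by apply/permP => x; rewrite perm1; apply/supp0P; rewrite s0 inE.
by apply/setP=> x; rewrite !inE perm1 eqxx.
Qed.

Lemma supp_perm v x : (v x \in supp v) = (x \in supp v).
Proof. by rewrite !inE (inj_eq perm_inj). Qed.

Lemma suppJ v g : supp (v ^ g) = g @: supp v.
Proof.
apply/setP => y; rewrite -[y](permKV g) (mem_imset _ _ perm_inj) !inE permJ.
by rewrite (inj_eq perm_inj).
Qed.

Lemma card_suppJ v g : #|supp (v ^ g)| = #|supp v|.
Proof. by rewrite suppJ card_imset //; apply: perm_inj. Qed.

(** Outside the overlap of the supports, [v] and [w] do not see each other: if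
    the overlap is the single point [x], then the commutator only moves [x] and
    its two images. *)
Lemma overlap1_c3 v w x :
  supp v :&: supp w = [set x] ->
  [/\ x != w x, x != v x & w x != v x] /\ v^-1 * w^-1 * v * w = c3 x (w x) (v x).
Proof.
move=> X1; have Xx : (x \in supp v) && (x \in supp w).
  by rewrite -in_setI X1 set11.
have{Xx} [xv xw] := andP Xx.
have vw t : t \in supp v -> t != x -> w t = t.
  by move=> tv tx; apply/supp0P; apply: contra tx => tw; rewrite -in_set1 -X1 inE tv.
have wv t : t \in supp w -> t != x -> v t = t.
  by move=> tw tx; apply/supp0P; apply: contra tx => tv; rewrite -in_set1 -X1 inE tv.
have nwx : w x != x by rewrite inE in xw.
have nvx : v x != x by rewrite inE in xv.
have wvx : w (v x) = v x by apply: vw; rewrite // supp_perm.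
have vwx : v (w x) = w x by apply: wv; rewrite // supp_perm.
have wVx : w^-1 x \in supp w by rewrite -supp_perm permKV.
have vVx : v^-1 x \in supp v by rewrite -supp_perm permKV.
have nwVx : w^-1 x != x by rewrite -(inj_eq (@perm_inj _ w)) permKV eq_sym.
have nvVx : v^-1 x != x by rewrite -(inj_eq (@perm_inj _ v)) permKV eq_sym.
have d3 : w x != v x.
  apply: contra nvx => /eqP e; rewrite -(inj_eq (@perm_inj _ v)) -e vwx e.
  by rewrite -e.
split; first by rewrite ![x == _]eq_sym.
have wVt t : w t = t -> w^-1 t = t by move=> {1}<-; rewrite permK.
have vVt t : v t = t -> v^-1 t = t by move=> {1}<-; rewrite permK.
have [xw' xv'] : x != w x /\ x != v x by rewrite ![x == _]eq_sym.
apply: c3_eq => //; rewrite ?permM.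
- by rewrite (wVt (v^-1 x)) ?permKV // vw.
- by rewrite (vVt (w x)) // permK.
- by rewrite permK wv // permKV.
move=> t tx twx tvx; rewrite !permM.
have [tv|/supp0P tv] := boolP (t \in supp v).
  have ntv : v^-1 t != x by rewrite -(inj_eq (@perm_inj _ v)) permKV.
  rewrite (wVt (v^-1 t)) ?permKV ?vw //.
  by rewrite -supp_perm permKV.
rewrite (vVt t) //.
have [tw|/supp0P tw] := boolP (t \in supp w); last by rewrite (wVt t) // tv.
have tw' : w^-1 t \in supp w by rewrite -supp_perm permKV.
by rewrite wv ?permKV // -(inj_eq (@perm_inj _ w)) permKV.
Qed.

Definition has3 (G : {set {perm X}}) x y z :=
  [&& x != y, x != z, y != z & c3 x y z \in G].

Definition has_c3 (G : {set {perm X}}) := [exists x, exists y, exists z, has3 G x y z].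

Lemma has_c3P (G : {set {perm X}}) :
  reflect (exists x y z, has3 G x y z) (has_c3 G).
Proof.
apply: (iffP existsP) => [[x /existsP[y /existsP[z h]]]|[x [y [z h]]]].
  by exists x, y, z.
by exists x; apply/existsP; exists y; apply/existsP; exists z.
Qed.

Lemma overlap1_has_c3 G v w x :
  v \in G -> w \in G -> supp v :&: supp w = [set x] -> has_c3 G.
Proof.
move=> Gv Gw /overlap1_c3[[d1 d2 d3] e].
by apply/has_c3P; exists x, (w x), (v x); rewrite /has3 d1 d2 d3 -e !groupM ?groupV.
Qed.

Lemma has3_rot G x y z : has3 G x y z -> has3 G y z x.
Proof.
case/and4P=> xy xz yz h; rewrite /has3 yz ![_ == x]eq_sym xy xz.
by rewrite -(c3_rot xy xz yz).
Qed.

Lemma has3_swap G x y z : has3 G x y z -> has3 G y x z.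
Proof.
case/and4P=> xy xz yz h; rewrite /has3 yz ![_ == x]eq_sym xy xz.
by rewrite -(c3V xy xz yz) groupV.
Qed.

Lemma has3J G g x y z : g \in G -> has3 G x y z -> has3 G (g x) (g y) (g z).
Proof.
move=> Gg /and4P[xy xz yz h]; rewrite /has3 !(inj_eq perm_inj) xy xz yz /=.
by rewrite -c3J groupJ.
Qed.

(** An equivalence relation compatible with [G]: for a primitive [G] with a 3-cycle
    it is total, and then [G] contains all 3-cycles. *)
Definition in3 (G : {set {perm X}}) x y := (x == y) || [exists z, has3 G x y z].

Lemma in3_refl G x : in3 G x x. Proof. by rewrite /in3 eqxx. Qed.

Lemma in3_sym G x y : in3 G x y -> in3 G y x.
Proof.
case/orP=> [/eqP->|/existsP[z h]]; rewrite /in3 ?eqxx //.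
by apply/orP; right; apply/existsP; exists z; apply: has3_swap.
Qed.

Lemma in3J G g x y : g \in G -> in3 G x y -> in3 G (g x) (g y).
Proof.
move=> Gg /orP[/eqP->|/existsP[z h]]; rewrite /in3 ?eqxx //.
by apply/orP; right; apply/existsP; exists (g z); apply: has3J.
Qed.

Lemma in3_has3 G x y z : has3 G x y z -> in3 G x y.
Proof. by move=> h; apply/orP; right; apply/existsP; exists z. Qed.

(** Conjugating a 3-cycle through [x] and [y] by one through [y] and [w] carries
    [y] to [w] and, unless it moves [x], keeps [x]. *)
Lemma in3_trans G x y (w : X) : in3 G x y -> in3 G y w -> in3 G x w.
Proof.
case/orP=> [/eqP->//|/existsP[z h]]; case/orP=> [/eqP<-|/existsP[u k]].
  exact: in3_has3 h.
have [->|xw] := eqVneq x w; first exact: in3_refl.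
case: (eqVneq x u) k => [<-|xu] k; first by apply/in3_sym/(in3_has3 (has3_rot k)).
have [yw yu wu Gk] := and4P k; have [xy xz yz _] := and4P h.
have [e1 _ _ et] := c3E yw yu wu.
by have /in3_has3 := has3J Gk h; rewrite e1 et.
Qed.

(** Start from a 3-cycle on [x], [y] and a point [a], and conjugate it by a
    3-cycle mapping [a] to [z]. If the latter moves [x] or [y], its inverse does. *)
Lemma in3_total_has3 G : (forall x y, in3 G x y) ->
  forall x y z, x != y -> x != z -> y != z -> has3 G x y z.
Proof.
move=> tot x y z xy xz yz.
have := tot x y; rewrite /in3 (negPf xy) => /existsP[a h].
have [<-//|az] := eqVneq a z.
have := tot a z; rewrite /in3 (negPf az) => /existsP[b k].
have [_ xa ya Gh] := and4P h; have [_ ab zb Gk] := and4P k.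
have [e1 e2 e3 et] := c3E az ab zb.
have inv t u : c3 a z b t = u -> (c3 a z b)^-1 u = t by move=> <-; rewrite permK.
have [bx|bx] := eqVneq b x.
  have := has3J (groupVr Gk) h; rewrite -bx (inv _ _ e2) (inv _ _ e3).
  rewrite (inv y y) ?et ?bx 1?[y == x]eq_sym //.
  by move/has3_swap/has3_rot/has3_rot.
have [by_|by_] := eqVneq b y.
  have := has3J (groupVr Gk) h; rewrite -by_ (inv _ _ e2) (inv _ _ e3).
  rewrite (inv x x) ?et ?by_ //.
  by move/has3_swap/has3_rot.
by have := has3J Gk h; rewrite e1 !et // eq_sym.
Qed.

(** Two transpositions with a common point cancel or make a 3-cycle; two disjoint
    ones are linked by a third one, inserted twice. *)
Lemma tperm2_c3 G : (forall x y z, x != y -> x != z -> y != z -> has3 G x y z) ->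
  forall a b c d, a != b -> c != d -> tperm a b * tperm c d \in G.
Proof.
move=> all3 a b c d.
have t2 x y z : x != y -> x != z -> tperm x y * tperm x z \in G.
  move=> xy xz; have [->|yz] := eqVneq y z; first by rewrite tperm2 group1.
  by case/and4P: (all3 x y z xy xz yz).
move=> ab cd; case: (eqVneq a c) cd => [<-|ac] cd; first exact: t2.
have -> : tperm a b * tperm c d = (tperm a b * tperm a c) * (tperm c a * tperm c d).
  by rewrite -mulgA (mulgA (tperm a c)) (tpermC c a) tperm2 mul1g.
by rewrite groupM // t2 // eq_sym.
Qed.

Lemma Alt_sub G : (forall x y, in3 G x y) -> 'Alt_X \subset G.
Proof.
move=> tot; have t2 := tperm2_c3 (in3_total_has3 tot).
apply/subsetP => s; rewrite Alt_even; have [ts -> dts] := prod_tpermP s.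
rewrite odd_perm_prod //; move: {2}(size ts) (leqnn (size ts)) dts => n.
elim: n ts => [|n IHn] [|[a b] [|[c d] ts]] //=; rewrite ?big_nil ?group1 //.
rewrite !big_cons /= mulgA /dpair /= negbK => le_n /and3P[ab cd dts] ev.
by rewrite groupM ?t2 // IHn // -ltnS ltnW.
Qed.

End ThreeCycles.

(** * Primitive groups *)

Section Primitive.

Variable X : finType.
Implicit Types (G : {group {perm X}}).

(** The classes of an invariant equivalence relation form an imprimitivity system,
    unless they are points or there is a single one. *)
Lemma primitive_rel G (e : rel X) :
  [primitive G, on [set: X] | 'P] -> equivalence_rel e ->
  (forall g x y, g \in G -> e x y -> e (g x) (g y)) ->
  (forall x y, e x y -> x = y) \/ (forall x y, e x y).
Proof.
move=> /andP[trG]; rewrite negb_exists => /forallP noQ eqe inve.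
pose Q := equivalence_partition e [set: X].
have eqe' : {in [set: X] & &, equivalence_rel e} by move=> x y z _ _ _; apply: eqe.
have pQ : partition Q [set: X] := equivalence_partitionP eqe'.
have esym x y : e x y = e y x.
  by apply/idP/idP => h; have [r t] := eqe x y x; have [r' t'] := eqe y x y;
     [rewrite -(t h) r | rewrite -(t' h) r'].
have etr x y z : e x y -> e y z -> e x z by move=> xy; have [_ ->] := eqe x y z.
have erefl x : e x x by have [] := eqe x x x.
have einvV g x y : g \in G -> e (g x) (g y) = e x y.
  move=> Gg; apply/idP/idP => [h|]; last exact: inve.
  by rewrite -[x](permK g) -[y](permK g) inve ?groupV.
have QE x : [set y | e x y] \in Q.
  by apply/imsetP; exists x => //; apply/setP => y; rewrite !inE.
have actQ : [acts G, on Q | 'P^*].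
  apply/actsP => g Gg B; apply/idP/idP => /imsetP[x _ defB].
    have -> : B = [set y | e (g^-1 x) y].
      rewrite -[B](actK 'P^* g) defB; apply/setP => y; rewrite !inE.
      apply/imsetP/idP => [[z]|h].
        rewrite !inE => xz ->; rewrite /= /aperm -[y in e _ y]/(g^-1 z).
        by rewrite einvV ?groupV.
      exists (g y); last by rewrite /= /aperm permK.
      by rewrite !inE -(einvV g^-1) ?groupV // permK.
    exact: QE.
  have -> : ('P^*)%act B g = [set y | e (g x) y].
    rewrite defB; apply/setP => y; rewrite !inE.
    apply/imsetP/idP => [[z]|h].
      by rewrite !inE => xz ->; rewrite /= /aperm einvV.
    exists (g^-1 y); last by rewrite /= /aperm permKV.
    by rewrite !inE -(einvV g) // permKV.
  exact: QE.
have := noQ Q; rewrite /imprimitivity_system pQ actQ /= => card.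
have [n_eq|/forallPn[x /forallPn[y]]] := boolP [forall x, forall y, e x y].
  by right=> x y; apply: (forallP (forallP n_eq x)).
move=> nexy; left; have c1 : 1 < #|Q|.
  rewrite (cardsD1 [set z | e x z]) QE (cardsD1 [set z | e y z]) !inE QE andbT.
  suff -> : [set z | e y z] != [set z | e x z] by [].
  by apply: contra nexy => /eqP/setP/(_ y); rewrite !inE erefl => <-.
have {}card : #|[set: X]| <= #|Q| by move: card; rewrite c1 /= -leqNgt.
have inj : {in [set: X] &, injective (fun x => [set z | e x z])}.
  have defQ : Q = [set [set z | e x z] | x in [set: X]].
    by apply: eq_imset => z; apply/setP=> t; rewrite !inE.
  by apply/imset_injP; rewrite eqn_leq leq_imset_card -defQ.
move=> u v uv; apply: inj; rewrite ?inE //; apply/setP=> z; rewrite !inE.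
by have [_ ->] := eqe u v z.
Qed.

Lemma primitive_has_c3 G :
  [primitive G, on [set: X] | 'P] -> has_c3 G -> 'Alt_X \subset G.
Proof.
move=> prG /has_c3P[x [y [z h]]]; apply: Alt_sub.
have eqv : equivalence_rel (in3 G).
  move=> a b c; split=> [|ab]; first exact: in3_refl.
  by apply/idP/idP; apply: in3_trans => //; apply: in3_sym.
case: (primitive_rel prG eqv) => [g a b|/(_ _ _ (in3_has3 h)) exy|//].
  exact: in3J.
by case/and4P: h; rewrite exy eqxx.
Qed.

(** Conversely, lying in one block of an imprimitivity system is an invariant
    equivalence relation. *)
Lemma rel_primitive G :
  [transitive G, on [set: X] | 'P] ->
  (forall e : rel X, equivalence_rel e ->
     (forall g x y, g \in G -> e x y -> e (g x) (g y)) ->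
     forall x y, x != y -> e x y -> forall x' y', e x' y') ->
  [primitive G, on [set: X] | 'P].
Proof.
move=> trG H; rewrite /primitive trG /=; apply/existsPn => Q.
apply/negP => /and3P[pQ actQ /andP[c1 cX]].
have [/eqP covQ trivQ ntQ] := and3P pQ.
pose e x y := pblock Q x == pblock Q y.
have eqv : equivalence_rel e by move=> x y z; split; rewrite /e // => /eqP ->.
have inQ x : x \in cover Q by rewrite covQ inE.
have inv g x y : g \in G -> e x y -> e (g x) (g y).
  move=> Gg /eqP exy.
  have gB : g @: pblock Q x \in Q.
    by have := actsP actQ g Gg (pblock Q x); rewrite pblock_mem //= => ->.
  have gbl z : z \in pblock Q x -> pblock Q (g z) = g @: pblock Q x.
    by move=> Bz; apply: def_pblock trivQ gB _; apply: imset_f.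
  by apply/eqP; rewrite !gbl ?mem_pblock // exy mem_pblock.
have all_e : forall x y, x != y -> e x y -> #|Q| <= 1.
  move=> x y xy exy; have tot := H e eqv inv x y xy exy.
  rewrite -(cards1 (pblock Q x)) subset_leq_card //; apply/subsetP => B QB.
  have /set0Pn[z Bz] : B != set0 by apply: contraNneq ntQ => <-.
  by rewrite inE -(def_pblock trivQ QB Bz) eq_sym; apply: tot.
have inj : injective (pblock Q).
  move=> x y /eqP exy; apply/eqP/negPn/negP => xy.
  by have := all_e x y xy exy; rewrite leqNgt c1.
move: cX; rewrite ltnNge; case/negP.
rewrite -(card_imset _ inj) subset_leq_card //.
by apply/subsetP => _ /imsetP[x _ ->]; rewrite pblock_mem.
Qed.

End Primitive.

(** * Maximal subgroups of a symmetric group: the imprimitive ones *)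

Definition max_perm_group (X : finType) (G : {group {perm X}}) : Prop :=
  G :!=: [set: {perm X}] /\
  forall H : {group {perm X}}, G \subset H -> H :!=: [set: {perm X}] -> G :=: H.

Section Imprimitive.

Variables (X : finType) (G : {group {perm X}}).
Hypothesis Gmax : max_perm_group G.

Lemma max_perm_gt1 : 1 < #|X|.
Proof.
rewrite ltnNge; apply/negP => X1; case: Gmax => /eqP[]; apply/setP => g.
rewrite inE; suff -> : g = 1 by rewrite group1.
apply/permP => x; move/card_le1P: X1 => /(_ x isT) X1.
by have := X1 (g x); rewrite !inE => /esym/eqP ->; rewrite perm1.
Qed.

Lemma max_perm_neqT (H : {group {perm X}}) g : G \subset H -> g \notin H -> G :=: H.
Proof.
case: Gmax => _ maxG sGH nHg; apply: maxG => //.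
by apply: contra nHg => /eqP ->; rewrite inE.
Qed.

Lemma max_perm_Alt : G \subset 'Alt_X -> G :=: 'Alt_X.
Proof.
have /card_gt1P[x [y [_ _ xy]]] : 1 < #|[set: X]| by rewrite cardsT max_perm_gt1.
move=> sGA; apply: (max_perm_neqT (g := tperm x y) sGA).
by rewrite Alt_even odd_tperm xy.
Qed.

(** A permutation stabilizing [Y] is the product of its restrictions to [Y] and to
    the complement of [Y]. *)
Lemma Sym_dprod (Y : {set X}) : perm.Sym Y \x perm.Sym (~: Y) = 'N(Y | 'P).
Proof.
have nP (Z : {set X}) (g : {perm X}) : perm_on Z g -> g \in 'N(Z | 'P).
  by move=> h; apply/astabsP => x /=; apply: perm_closed.
rewrite dprodE.
- apply/eqP; rewrite eqEsubset; apply/andP; split.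
    apply: mul_subG; apply/subsetP => g; rewrite inE => /nP //=.
    by rewrite astabsC.
  apply/subsetP => g gY; apply/mulsgP.
  have gY' : g \in 'N(~: Y | 'P) by rewrite astabsC.
  exists (restr_perm Y g) (restr_perm (~: Y) g); rewrite ?inE ?restr_perm_on //.
  apply/permP => x; rewrite permM; have [xY|xY] := boolP (x \in Y).
    rewrite (restr_permE gY xY) (out_perm (restr_perm_on (~: Y) g)) // inE negbK.
    by have /astabsP/(_ x) /= -> := gY.
  by rewrite (out_perm (restr_perm_on Y g) xY) (restr_permE gY') // inE.
- apply/centsP => g; rewrite inE => gY h; rewrite inE => hY; apply/permP => x.
  rewrite !permM; have [xY|xY] := boolP (x \in Y).
    rewrite (out_perm gY) ?(out_perm gY (x := g x)) ?inE ?negbK //.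
    by rewrite (out_perm gY) // inE negbK (perm_closed _ hY).
  by rewrite (out_perm hY xY) (out_perm hY) // -in_setC (perm_closed _ gY) inE.
apply/eqP; rewrite eqEsubset sub1G andbT; apply/subsetP => g.
rewrite !inE => /andP[gY gY']; apply/eqP/permP => x; rewrite perm1.
by have [xY|xY] := boolP (x \in Y); [rewrite (out_perm gY') ?inE ?negbK | apply: out_perm xY].
Qed.

Lemma perm_exchange (Y : {set X}) : #|Y| = #|~: Y| -> exists g : {perm X}, g @: Y = ~: Y.
Proof.
move=> cY; have swap_lt (Z : {set X}) t : #|Z| = #|~: Z| -> t \in Z ->
    index t (enum Z) < size (enum (~: Z)).
  by move=> cZ tZ; rewrite -cardE -cZ cardE index_mem mem_enum.
have cY' : #|~: Y| = #|~: ~: Y| by rewrite setCK.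
pose f t := if t \in Y then nth t (enum (~: Y)) (index t (enum Y))
            else nth t (enum Y) (index t (enum (~: Y))).
have fY t : t \in Y -> f t \in ~: Y.
  by move=> tY; rewrite /f tY -mem_enum mem_nth // swap_lt.
have fY' t : t \in ~: Y -> f t \in Y.
  move=> tY; have := swap_lt _ _ cY' tY; rewrite setCK => lt_t.
  by move: tY; rewrite inE /f => /negPf ->; rewrite -mem_enum mem_nth.
have fK : involutive f.
  move=> t; have [tY|tY] := boolP (t \in Y).
    have := fY _ tY; rewrite inE {2}/f => /negPf ->; rewrite /f tY.
    rewrite index_uniq ?enum_uniq ?swap_lt // (set_nth_default t) ?nth_index ?mem_enum //.
    by rewrite index_mem mem_enum.
  have tY' : t \in ~: Y by rewrite inE.
  have := swap_lt _ _ cY' tY'; rewrite setCK => lt_t.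
  rewrite {1}/f fY' // /f (negPf tY) index_uniq ?enum_uniq //.
  rewrite (set_nth_default t) ?nth_index ?mem_enum //.
  by rewrite index_mem mem_enum.
exists (perm (inv_inj fK)); apply/setP => t; apply/imsetP/idP => [[u uY ->]|tY].
  by rewrite permE fY.
by exists (f t); [apply: fY' | rewrite permE fK].
Qed.

Lemma astabs_setE (P : {set {set X}}) :
  'N(P | 'P^*) = [set g : {perm X} | [forall Y in P, g @: Y \in P]].
Proof.
have imE (g : {perm X}) (Y : {set X}) : ('P^*)%act Y g = g @: Y by apply: eq_imset.
apply/setP => g; rewrite !inE; apply/subsetP/forall_inP => [h Y PY|h Y PY].
  by have := h Y PY; rewrite inE imE.
by rewrite inE imE h.
Qed.

(** [G] is the stabilizer of an orbit [Y]. If [Y] is as large as its complement,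
    some permutation exchanges them, so the stabilizer of the pair is larger; it
    is proper unless [Y] is a point, and then the degree is 2. *)
Lemma max_perm_intransitive :
  ~~ [transitive G, on [set: X] | 'P] -> intransitive_type G \/ alternating_type G.
Proof.
move=> ntrG; have [x _] : exists x, x \in [set: X].
  by apply/set0Pn; rewrite -card_gt0 cardsT ltnW // max_perm_gt1.
pose Y := orbit 'P G x; have Yx : x \in Y by apply: orbit_refl.
have /set0Pn[z] : ~: Y != set0.
  apply: contraNneq ntrG => e; apply/imsetP; exists x => //.
  by rewrite -[orbit _ _ _]setCK -/Y e setC0.
rewrite inE => zY; have sGN : G \subset 'N(Y | 'P) by apply: acts_orbit; apply: subsetT.
have tN : tperm x z \notin 'N(Y | 'P).
  by apply/negP => /astabsP/(_ x); rewrite /= /aperm tpermL Yx (negPf zY).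
have defG := max_perm_neqT (H := 'N(Y | 'P)%G) sGN tN; rewrite /= in defG.
have [cY|cY] := eqVneq #|Y| #|~: Y|; last first.
  left; exists Y; split; rewrite ?Sym_dprod //.
    by apply/card_gt0P; exists x.
  by apply/card_gt0P; exists z; rewrite inE.
right; have [Y1|] := leqP #|Y| 1.
  apply: max_perm_Alt; apply/subsetP => g; rewrite defG => gN.
  have fixY (Z : {set X}) t : #|Z| <= 1 -> g \in 'N(Z | 'P) -> t \in Z -> g t = t.
    move=> /card_le1_eqP Z1 /astabsP gZ tZ; apply: Z1 => //.
    by have := gZ t; rewrite tZ.
  suff -> : g = 1 by rewrite group1.
  apply/permP => t; rewrite perm1; have [tY|tY] := boolP (t \in Y).
    exact: fixY tY.
  by apply: (fixY (~: Y)); rewrite -?cY ?astabsC // inE.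
case/card_gt1P => a [b [Ya Yb ab]].
pose P := [set Y; ~: Y]; have sNP : 'N(Y | 'P) \subset 'N(P | 'P^*).
  apply/subsetP => g gY; rewrite astabs_setE inE; apply/forall_inP => Z.
  have gZ Z' : g \in 'N(Z' | 'P) -> g @: Z' = Z'.
    move=> gZ'; apply/eqP; rewrite eqEcard card_imset ?leqnn ?andbT; last exact: perm_inj.
    by apply/subsetP => _ /imsetP[t tZ ->]; have /astabsP/(_ t) := gZ'; rewrite /= tZ.
  by rewrite !inE => /orP[] /eqP ->; rewrite gZ ?astabsC // eqxx ?orbT.
have tP : tperm b z \notin 'N(P | 'P^*).
  rewrite astabs_setE inE; apply/negP => /forall_inP/(_ Y).
  rewrite !inE eqxx => /(_ isT) /orP[] /eqP/setP E.
    have := E z; rewrite (negPf zY) -{1}(tpermL b z).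
    by rewrite (mem_imset _ _ perm_inj) Yb.
  have := E a; rewrite inE Ya -{1}(tpermD (x:=b) (y:=z) (z:=a)).
  + by rewrite (mem_imset _ _ perm_inj) Ya.
  + by rewrite eq_sym.
  by apply: contraNneq zY => ->.
have defG' := max_perm_neqT (H := 'N(P | 'P^*)%G) (subset_trans sGN sNP) tP.
rewrite /= in defG'.
have [g gY] := perm_exchange cY.
have gP : g \in 'N(P | 'P^*).
  rewrite astabs_setE inE; apply/forall_inP => Z; rewrite !inE => /orP[] /eqP ->.
    by rewrite gY eqxx orbT.
  have : [set g t | t in ~: Y] = ~: [set g t | t in Y].
    apply/setP => t; rewrite -[t](permKV g) inE !(mem_imset _ _ perm_inj).
    by rewrite inE.
  by move=> ->; rewrite gY setCK eqxx.
move: gP; rewrite -defG' defG => /astabsP/(_ x).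
have : g x \in ~: Y by rewrite -gY imset_f.
by rewrite inE /= /aperm Yx => /negPf ->.
Qed.

(** [G] is the stabilizer of an imprimitivity system: the transposition of two
    points in different blocks does not preserve it, as blocks have other points. *)
Lemma max_perm_imprimitive :
  [transitive G, on [set: X] | 'P] -> ~~ [primitive G, on [set: X] | 'P] ->
  imprimitive_type G.
Proof.
move=> trG; rewrite /primitive trG negbK => /existsP[P /and3P[pP actP /andP[P1 PX]]].
have [/eqP covP trivP ntP] := and3P pP.
have imE (g : {perm X}) (Y : {set X}) : ('P^*)%act Y g = g @: Y by apply: eq_imset.
have [x _] : exists x, x \in [set: X].
  by apply/set0Pn; rewrite -card_gt0 cardsT ltnW // max_perm_gt1.
pose B := pblock P x; have PB : B \in P by rewrite pblock_mem // covP.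
have cB Y : Y \in P -> #|Y| = #|B|.
  move=> PY; have /set0Pn[y Yy] : Y != set0 by apply: contraNneq ntP => <-.
  have [g Gg /= gx] := atransP2 trG (in_setT x) (in_setT y).
  have gBP : g @: B \in P by rewrite -imE (actsP actP).
  have : g @: B = Y.
    have ygB : y \in g @: B by rewrite gx; apply: imset_f; rewrite mem_pblock covP.
    by rewrite -(def_pblock trivP gBP ygB) (def_pblock trivP PY Yy).
  by move=> <-; rewrite card_imset //; apply: perm_inj.
have cX : #|X| = (#|B| * #|P|)%N.
  by rewrite -cardsT mulnC; apply: card_uniform_partition.
have B1 : 1 < #|B|.
  move: PX; rewrite cardsT cX; case: #|B| => [|[|]] //; rewrite ?mul0n ?ltn0 //.
  by rewrite mul1n ltnn.
exists #|B|, #|P|, P; split=> //; split=> //; rewrite -astabs_setE.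
have [a [b [Ba Bb ab]]] := card_gt1P B1.
have [z zB] : exists z, z \notin B.
  apply/existsP; rewrite -negb_forall; apply/negP => /forallP BT.
  move: B1 P1; have : #|B| = #|X| by rewrite -cardsT; congr #|pred_of_set _|; apply/setP=> t; rewrite inE BT.
  rewrite cX -{1}[#|B|]muln1 => /eqP; case: #|B| => // n.
  by rewrite eqn_pmul2l // => /eqP <-.
apply: (max_perm_neqT (g := tperm b z) (H := 'N(P | 'P^*)%G) actP).
rewrite /= astabs_setE inE; apply/negP => /forall_inP/(_ B PB) PtB.
have : z \in tperm b z @: B by rewrite -{1}(tpermL b z) imset_f.
suff -> : tperm b z @: B = B by rewrite (negPf zB).
have atB : a \in tperm b z @: B.
  rewrite -{1}(tpermD (x:=b) (y:=z) (z:=a)) ?imset_f // 1?eq_sym //.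
  by apply: contraNneq zB => <-.
by rewrite -(def_pblock trivP PtB atB) (def_pblock trivP PB Ba).
Qed.

End Imprimitive.

(** * Transport of permutations *)

Section Transport.

Variables (X Y : finType) (u : X -> Y) (v : Y -> X).
Hypotheses (uK : cancel u v) (vK : cancel v u).

Lemma transport_inj (g : {perm X}) : injective (fun y => u (g (v y))).
Proof. by move=> y z /(can_inj uK)/perm_inj/(can_inj vK). Qed.

Definition transport (g : {perm X}) : {perm Y} := perm (@transport_inj g).

Lemma transportE g x : transport g (u x) = u (g x).
Proof. by rewrite permE uK. Qed.

Lemma transport_uniq (g : {perm X}) (h : {perm Y}) : (forall x, h (u x) = u (g x)) -> h = transport g.
Proof. by move=> H; apply/permP => y; rewrite -[y]vK H transportE. Qed.

Lemma transportM : {morph transport : g h / g * h}.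
Proof. by move=> g h; symmetry; apply: transport_uniq => x; rewrite !permM !transportE. Qed.

Lemma transport_injective : injective transport.
Proof. by move=> g h e; apply/permP => x; apply: (can_inj uK); rewrite -!transportE e. Qed.

Lemma transport_tperm x y : transport (tperm x y) = tperm (u x) (u y).
Proof. by symmetry; apply: transport_uniq => z; rewrite inj_tperm //; apply: can_inj uK. Qed.

Lemma odd_transport g : odd_perm (transport g) = odd_perm g.
Proof.
have [ts -> dts] := prod_tpermP g.
have transport1 : transport 1 = 1.
  by symmetry; apply: transport_uniq => x; rewrite !perm1.
rewrite (big_morph _ transportM transport1) odd_perm_prod //.
rewrite (eq_bigr (fun t => tperm (u t.1) (u t.2))) => [|t _]; last exact: transport_tperm.
rewrite -(big_map (fun t => (u t.1, u t.2)) xpredT (fun t => tperm t.1 t.2)).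
rewrite odd_perm_prod ?size_map // all_map; apply: sub_all dts => -[x y].
by rewrite /dpair /= (can_eq uK).
Qed.

End Transport.

(** As [G] is maximal, it suffices to map it into [H]: the preimage of [H] is a
    proper group containing [G]. *)
Lemma max_perm_isomorphic (X Y : finType) (G : {group {perm X}}) (H : {set {perm Y}})
    (u : X -> Y) h0 :
  max_perm_group G -> bijective u -> group_set H -> h0 \notin H ->
  (forall g, g \in G -> exists2 h, h \in H & forall x, h (u x) = u (g x)) ->
  perm_isomorphic G H.
Proof.
move=> Gmax bij_u gH nHh0 sGH; have [v uK vK] := bij_u.
pose K := [set g | transport uK vK g \in H].
have gK : group_set K.
  apply/group_setP; split=> [|g h]; rewrite !inE.
    rewrite -(transport_uniq uK vK (h := 1)) ?(group1 (Group gH)) // => x.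
    by rewrite !perm1.
  by rewrite transportM => Hg Hh; apply: (groupM (G := Group gH)).
have sGK : G \subset Group gK.
  apply/subsetP => g /sGH[h Hh e]; rewrite inE /=.
  by rewrite -(transport_uniq uK vK e).
have defG : G :=: Group gK.
  apply: (max_perm_neqT (g := transport vK uK h0) Gmax sGK); rewrite inE.
  rewrite -(transport_uniq uK vK (h := h0)) // => x.
  by rewrite -{2}[x]uK transportE vK.
exists u => // g h e; rewrite defG inE.
by rewrite -(transport_uniq uK vK e).
Qed.

(** * Cartesian decompositions *)

Lemma product_wreath_group (A : finType) n : group_set (product_wreath A n).
Proof.
apply/group_setP; split=> [|f f']; rewrite !inE.
  apply/existsP; exists [ffun => 1]; apply/existsP; exists 1.
  by apply/forallP => x; apply/forallP => i; rewrite ffunE invg1 !perm1.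
case/existsP => g /existsP[a /forallP fE]; case/existsP => g' /existsP[a' /forallP fE'].
apply/existsP; exists [ffun i => g (a'^-1 i) * g' i]; apply/existsP; exists (a * a').
apply/forallP => x; apply/forallP => i; rewrite ffunE invMg !permM.
by rewrite (eqP (forallP (fE' _) i)) (eqP (forallP (fE _) _)).
Qed.

(** Hamming distance is preserved by the product action, but not by the
    transposition of two words at distances 1 and 2 from a third one. *)
Lemma product_wreath_proper (A : finType) n : 1 < #|A| -> 1 < n ->
  exists f : gate A n, f \notin product_wreath A n.
Proof.
case: n => [|[|n]] // A1 _; have [a [b [_ _ ab]]] := card_gt1P A1.
pose x : word A n.+2 := [ffun => a].
pose y : word A n.+2 := [ffun i => if i == ord0 then b else a].
pose z : word A n.+2 := [ffun i => if (i == ord0) || (i == ord_max) then b else a].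
exists (tperm y z); apply/negP; rewrite inE.
case/existsP => g /existsP[al /forallP fE].
have fx : tperm y z x = x.
  rewrite tpermD //; apply/eqP => /ffunP/(_ ord0); rewrite !ffunE eqxx /=;
    by move/eqP; rewrite eq_sym (negPf ab).
have key i : z i = b -> al^-1 i = ord0.
  move=> zi; have /eqP ex := forallP (fE x) i; have /eqP ey := forallP (fE y) i.
  have [//|ni0] := eqVneq (al^-1 i) ord0.
  have xy : x (al^-1 i) = y (al^-1 i) by rewrite !ffunE (negPf ni0).
  by case/eqP: ab; rewrite -zi -(tpermL y z) ey -xy -ex fx ffunE.
have := key ord0; rewrite ffunE eqxx /= => /(_ erefl) k0.
have := key ord_max; rewrite ffunE eqxx orbT => /(_ erefl).
by rewrite -k0 => /perm_inj.
Qed.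

Section Cartesian.

Variables (X Y : finType) (G : {group {perm X}}) (k m : nat) (f : 'I_k -> X -> Y).
Hypothesis f_inj : forall x y, (forall i, f i x = f i y) -> x = y.
Hypothesis f_onto : forall c : 'I_k -> X, exists x, forall i, f i x = f i (c i).
Hypothesis f_card : forall i, #|[set f i x | x : X]| = m.
Hypothesis f_equiv : forall g, g \in G -> exists al : 'S_k,
  forall i x y, f i x = f i y -> f (al i) (g x) = f (al i) (g y).

Let F i := [set f i x | x : X].

Lemma cart_lt i x : index (f i x) (enum (F i)) < m.
Proof. by rewrite -(f_card i) cardE index_mem mem_enum imset_f. Qed.

Definition cart_coord i x : 'I_m := Ordinal (cart_lt i x).

Lemma cart_coordP i x y : cart_coord i x = cart_coord i y <-> f i x = f i y.
Proof.
split=> [/(congr1 val) /= e|e]; last by apply: val_inj; rewrite /= e.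
have mF z : f i z \in enum (F i) by rewrite mem_enum imset_f.
by rewrite -(nth_index (f i x) (mF x)) e nth_index.
Qed.

Lemma cart_coord_onto i (a : 'I_m) : exists x, cart_coord i x = a.
Proof.
have lt_a : a < size (enum (F i)) by rewrite -cardE f_card.
have [y0 _] : exists y, y \in F i.
  by apply/card_gt0P; rewrite f_card (leq_ltn_trans _ (ltn_ord a)).
have := mem_nth y0 lt_a; rewrite mem_enum => /imsetP[x _ e].
by exists x; apply: val_inj; rewrite /= -e index_uniq ?enum_uniq.
Qed.

Definition cart_word x : word 'I_m k := [ffun i => cart_coord i x].

Lemma cart_word_bij : bijective cart_word.
Proof.
have inj : injective cart_word.
  move=> x y /ffunP e; apply: f_inj => i; apply/cart_coordP.
  by have := e i; rewrite !ffunE.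
have [|v vK] := @fin_all_exists _ _ (fun (w : word 'I_m k) x => cart_word x = w).
  move=> w; have [c cE] := fin_all_exists (fun i => cart_coord_onto i (w i)).
  have [x xE] := f_onto c; exists x; apply/ffunP => i.
  by rewrite ffunE -cE; apply/cart_coordP.
by exists v => // x; apply: inj.
Qed.

(** The [f i] are the coordinates of a Cartesian decomposition of [X]. As [g] maps
    the fibres of [f i] to those of [f (al i)], it induces a bijection between the
    values of these two coordinates. *)
Lemma cartesian_product_wreath g : g \in G ->
  exists2 h, h \in product_wreath 'I_m k & forall x, h (cart_word x) = cart_word (g x).
Proof.
move=> Gg; have [v uK vK] := cart_word_bij.
exists (transport uK vK g); last exact: transportE.
have [al alE] := f_equiv Gg.
have phi_ex i : exists phi : {perm 'I_m}, forall x,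
    phi (cart_coord (al^-1 i) x) = cart_coord i (g x).
  have [c cE] := fin_all_exists (cart_coord_onto (al^-1 i)).
  pose phi a := cart_coord i (g (c a)).
  have phiE x : phi (cart_coord (al^-1 i) x) = cart_coord i (g x).
    apply/cart_coordP; have := alE (al^-1 i); rewrite permKV; apply.
    by apply/cart_coordP; rewrite cE.
  have [|psi psiK] := @fin_all_exists _ _ (fun b a => phi a = b).
    move=> b; have [y yE] := cart_coord_onto i b.
    by exists (cart_coord (al^-1 i) (g^-1 y)); rewrite phiE permKV.
  have inj : injective phi by apply/can_inj/canF_sym/psiK.
  by exists (perm inj) => x; rewrite permE.
have [phi phiE] := fin_all_exists phi_ex.
rewrite inE; apply/existsP; exists [ffun i => phi i]; apply/existsP; exists al.
apply/forallP => w; apply/forallP => i; rewrite ffunE -[w]vK transportE.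
by rewrite !ffunE phiE.
Qed.

Lemma cartesian_wreath_type :
  max_perm_group G -> 4 < m -> 1 < k -> wreath_type G.
Proof.
move=> Gmax m5 k1; exists m, k; split=> //.
  by rewrite (bij_eq_card cart_word_bij) card_ffun !card_ord.
have [|h0 nh0] := @product_wreath_proper 'I_m k _ k1.
  by rewrite card_ord (leq_trans _ m5).
apply: (max_perm_isomorphic Gmax cart_word_bij _ nh0); last first.
  exact: cartesian_product_wreath.
exact: product_wreath_group.
Qed.

End Cartesian.

(** * Affine groups *)

Section Affine.

Variables (F : finFieldType) (k : nat).

Lemma AGL_mem (f : {perm 'rV[F]_k}) (L : 'M[F]_k) (v : 'rV[F]_k) :
  L \in unitmx -> (forall x, f x = (x *m L + v)%R) -> f \in AGL F k.
Proof.
move=> uL fE; rewrite inE; apply/existsP; exists L; apply/existsP; exists v.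
by rewrite uL; apply/forallP => x; rewrite fE.
Qed.

Lemma AGLP (f : {perm 'rV[F]_k}) : f \in AGL F k ->
  exists (L : 'M[F]_k) (v : 'rV[F]_k),
    L \in unitmx /\ forall x, f x = (x *m L + v)%R.
Proof.
rewrite inE => /existsP[L /existsP[v /andP[uL /forallP fE]]].
by exists L, v; split=> // x; apply/eqP.
Qed.

Lemma AGL_group : group_set (AGL F k).
Proof.
apply/group_setP; split=> [|f g].
  by apply: (AGL_mem (L := 1%:M) (v := 0%R)); rewrite ?unitmx1 // => x;
     rewrite perm1 mulmx1 addr0.
case/AGLP=> L [v [uL fE]] /AGLP[L' [v' [uL' gE]]].
apply: (AGL_mem (L := L *m L') (v := (v *m L' + v')%R)).
  by rewrite unitmx_mul uL.
by move=> x; rewrite permM fE gE mulmxDl mulmxA addrA.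
Qed.

(** An affine map [f] satisfies [f (a - b + c) = f a - f b + f c]; the
    transposition of [0] and [a] does not, once there are five points. *)
Lemma AGL_proper : 4 < #|'rV[F]_k| -> exists f, f \notin AGL F k.
Proof.
move=> n5; have pick (s : seq 'rV[F]_k) : size s <= 4 -> exists x, x \notin s.
  move=> s4; suff /card_gt0P[x] : 0 < #|predC (mem s)|.
    by rewrite inE /= => xs; exists x.
  rewrite -(ltn_add2l #|mem s|) cardC addn0 (leq_ltn_trans _ n5) //.
  exact: leq_trans (card_size s) s4.
have [a] := pick [:: 0%R] isT; rewrite !inE => a0.
have [b] := pick [:: 0%R; a] isT; rewrite !inE negb_or => /andP[b0 ba].
have [c] := pick [:: 0%R; a; b; (b - a)%R] isT.
rewrite !inE !negb_or => /and4P[c0 ca cb cba].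
pose d := (a - b + c)%R.
have dE : d = (a + (c - b))%R by rewrite /d -addrA [(- b + c)%R]addrC.
have d0 : d != 0%R by rewrite /d addrC -[(a - b)%R]opprB subr_eq0.
have da : d != a by rewrite dE -[X in _ == X]addr0 (inj_eq (addrI a)) subr_eq0.
exists (tperm 0%R a); apply/negP => /AGLP[L [v [_ fE]]].
have aL : (a *m L = - v)%R.
  by apply/eqP; rewrite -addr_eq0; have := fE a; rewrite tpermR => <-.
have tL t : t != 0%R -> t != a -> (t *m L = t - v)%R.
  by move=> t0 ta; have := fE t; rewrite tpermD 1?eq_sym // => {2}->; rewrite addrK.
have e0 : (c - v - (b - v) = c - b)%R by rewrite opprB addrA subrK.
have := tL d d0 da; rewrite {1}dE mulmxDl mulmxBl aL !tL // e0.
rewrite addrC => /addIr e; move: dE; rewrite -e -[LHS]add0r => /addIr a00.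
by rewrite -a00 eqxx in a0.
Qed.

End Affine.

(** * Primitive maximal subgroups *)

Section Small.

Variables (X : finType) (G : {group {perm X}}).
Hypothesis Gmax : max_perm_group G.

(** The alternating group has prime index in the symmetric group. *)
Lemma max_perm_Alt_sub : 'Alt_X \subset G -> G :=: 'Alt_X.
Proof.
move=> sAG; have [GT _] := Gmax.
have := Lagrange_index (subsetT G) sAG.
rewrite /= -/('Sym_X) (Alt_index (max_perm_gt1 Gmax)) => i2.
have [i1|] := leqP #|G : 'Alt_X| 1.
  by apply/eqP; rewrite eqEsubset sAG -indexg_eq1 eqn_leq i1 indexg_gt0.
case: #|G : 'Alt_X| i2 => [|[|n]] // i2 _.
have : #|'Sym_X : G| = 1%N.
  by case: #|'Sym_X : G| i2 => [|[|q]] //; rewrite mulSn; nia.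
move/eqP; rewrite indexg_eq1 => sTG; case/eqP: GT; apply/eqP.
by rewrite eqEsubset subsetT.
Qed.

(** Four points leave no room for two cycles of length 3. *)
Lemma order3_c3 (g : {perm X}) : #|X| <= 4 -> #[g] = 3 ->
  exists x y z, has3 [set g] x y z.
Proof.
move=> X4 o3; have [x gx] : exists x, g x != x.
  apply/existsP; rewrite -negb_forall; apply: contraTN isT => /forallP fx.
  suff g1 : g = 1 by rewrite g1 order1 in o3.
  by apply/permP => x; rewrite perm1; apply/eqP.
have g3 t : g (g (g t)) = t.
  by rewrite -{2}[t](perm1 t) -(expg_order g) o3 !expgS expg0 mulg1 !permM.
exists x, (g x), (g (g x)); rewrite /has3 !inE [x == _]eq_sym gx /=.
have gy : g x != g (g x) by rewrite (inj_eq perm_inj) eq_sym.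
have gz : x != g (g x).
  by rewrite -(inj_eq (@perm_inj _ g)) g3.
rewrite gy gz /=; apply/eqP/esym/c3_eq; rewrite // 1?eq_sym // => t tx ty tz.
apply/eqP; apply: contraLR X4 => gt; rewrite -ltnNge.
have n1 : g t != x by rewrite -(inj_eq (@perm_inj _ g)) -(inj_eq (@perm_inj _ g)) g3 .
have n2 : g t != g x by rewrite (inj_eq perm_inj).
have n3 : g t != g (g x) by rewrite (inj_eq perm_inj).
have u : uniq [:: x; g x; g (g x); t; g t].
  rewrite /= !inE !negb_or gz gy [x == g x]eq_sym gx ![_ == t]eq_sym tx ty tz.
  by rewrite ![_ == g t]eq_sym n1 n2 n3 gt.
by have := max_card (mem [:: x; g x; g (g x); t; g t]); rewrite (card_uniqP u).
Qed.

Hypothesis primG : [primitive G, on [set: X] | 'P].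

(** If 3 divides the order, then [G] contains a 3-cycle. Otherwise the degree is 4
    and [G] is a 2-group, where the stabilizer of a point, as a maximal subgroup,
    would have index 2. *)
Lemma max_primitive_le4 : #|X| <= 4 -> alternating_type G.
Proof.
move=> X4; have X1 := max_perm_gt1 Gmax; have [trG _] := andP primG.
have [GT _] := Gmax.
have Xdvd : #|X| %| #|G| by rewrite -cardsT (atrans_dvd trG).
have Gdvd : #|G| %| #|X|`! by rewrite -card_Sym cardSg // subsetT.
have by3 : 3 %| #|G| -> alternating_type G.
  case/Cauchy=> // g Gg /(order3_c3 X4)[x [y [z h]]].
  apply: max_perm_Alt_sub; apply: primitive_has_c3 primG _.
  apply/has_c3P; exists x, y, z; move: h; rewrite /has3 inE.
  by case/and4P=> -> -> -> /eqP ->.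
have cG : #|G| < #|X|`!.
  by rewrite -card_Sym proper_card // properEneq GT subsetT.
have : #|X| \in [:: 2; 3; 4].
  by move: X1 X4; case: #|X| => [|[|[|[|[|]]]]].
rewrite !inE => /or3P[] /eqP eX.
- move: cG (dvdn_leq (cardG_gt0 G) Xdvd); rewrite eX => cG.
  by rewrite leqNgt cG.
- by apply: by3; rewrite eX in Xdvd.
have [/by3 //|n3] := boolP (3 %| #|G|).
have pG : 2.-group G.
  have := cardG_gt0 G; rewrite /pgroup => G0.
  apply/pnatP => // p pr_p pG; have := dvdn_trans pG Gdvd; rewrite eX.
  rewrite -[4`!]/(2 ^ 3 * 3)%N Euclid_dvdM // Euclid_dvdX // andbT !dvdn_prime2 //.
  by case/orP=> [/eqP->|/eqP p3] //; rewrite -p3 pG in n3.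
have [x _] : exists x, x \in [set: X].
  by apply/set0Pn; rewrite -card_gt0 cardsT ltnW.
have := trans_prim_astab (in_setT x) trG; rewrite primG => /esym.
have i4 : #|G : 'C_G[x | 'P]| = 4.
  by rewrite -card_orbit (atransP trG) // cardsT.
case/predU1P => [e|/(p_maximal_index pG)]; last by rewrite i4.
by move: i4; rewrite e indexgg.
Qed.

End Small.

Section PrimitiveSetup.

Variables (X : finType) (G N : {group {perm X}}) (x0 : X).
Hypothesis primG : [primitive G, on [set: X] | 'P].
Hypotheses (ntN : N :!=: 1) (nNG : N <| G).

Lemma prim_normal_trans : [transitive N, on [set: X] | 'P].
Proof.
case: (prim_trans_norm primG nNG) => // sNC; case/negP: ntN.
rewrite -subG1; apply: subset_trans sNC (subset_trans (subsetIr _ _) _).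
apply/subsetP => g /astabP gfix; rewrite inE; apply/eqP/permP => x.
by rewrite perm1; apply: gfix.
Qed.

(** A point of a transitive normal subgroup lies over every point; it is
    determined up to left multiplication by the stabilizer of [x0]. *)
Lemma trans_section : exists nu : X -> {perm X}, forall y, nu y \in N /\ nu y x0 = y.
Proof.
apply: (fin_all_exists (P := fun y n => n \in N /\ n x0 = y)) => y.
have [n Nn /= e] := atransP2 prim_normal_trans (in_setT x0) (in_setT y).
by exists n.
Qed.

(** An element of [G] is an element [h] fixing [x0] followed by a [c] in [N];
    in terms of the elements of [N] that lie over the points, it acts by
    conjugation by [h] and right multiplication by [c]. *)
Lemma prim_factor g : g \in G -> exists h c,
  [/\ h \in G, c \in N, h x0 = x0, g = h * c &
      forall n : {perm X}, g (n x0) = (n ^ h * c) x0].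
Proof.
move=> Gg; have [nu nuE] := trans_section; have [Nc cE] := nuE (g x0).
have [sNG _] := andP nNG.
have cV : (nu (g x0))^-1 (g x0) = x0 by rewrite -{2}cE permK.
exists (g * (nu (g x0))^-1), (nu (g x0)); split=> //.
- by rewrite groupM ?groupV // (subsetP sNG).
- by rewrite permM.
- by rewrite mulgKV.
by move=> n; rewrite conjgE !mulgA mulgKV invMg invgK !permM cE permK.
Qed.

(** A permutation commuting with a transitive group is determined by the image of
    one point. *)
Lemma centralizer_semiregular (C : {set {perm X}}) c :
  C \subset 'C(N) -> c \in C -> c x0 = x0 -> c = 1.
Proof.
move=> cCN Cc cx; have [nu nuE] := trans_section.
apply/permP => y; have [Nn <-] := nuE y; rewrite perm1 -!permM.
have cnc : c * nu y = nu y * c by apply: (centsP cCN).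
by rewrite -cnc permM cx.
Qed.

End PrimitiveSetup.

Section AffineType.

Variables (X : finType) (G N : {group {perm X}}).
Hypothesis Gmax : max_perm_group G.
Hypothesis primG : [primitive G, on [set: X] | 'P].
Hypotheses (minN : minnormal N G) (sNG : N \subset G) (abN : abelian N).

(** [N] is elementary abelian and regular, so the points are the vectors of [N].
    An element of [G] is a conjugation, which is linear, followed by the
    translation by an element of [N]. *)
Lemma max_primitive_affine : alternating_type G \/ affine_type G.
Proof.
have [X4|X5] := leqP #|X| 4; first by left; apply: max_primitive_le4.
right; have /andP[ntN nNG'] := mingroupp minN.
have nNG : N <| G by rewrite /normal sNG.
have [x0 _] : exists x, x \in [set: X].
  by apply/set0Pn; rewrite -card_gt0 cardsT ltnW // (max_perm_gt1 Gmax).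
have [nu nuE] := trans_section x0 primG ntN nNG.
have [_ _ /is_abelemP[p pr_p abelN]] :=
  minnormal_solvable minN (subxx N) (abelian_sol abN).
pose ErV := abelem_rV abelN ntN; pose rVE := rVabelem abelN ntN.
pose rG := abelem_repr abelN ntN nNG'.
pose u y := ErV (nu y); pose v w := rVE w x0.
have regN n n' : n \in N -> n' \in N -> n x0 = n' x0 -> n = n'.
  move=> Nn Nn' e; apply/eqP; rewrite eq_mulgV1; apply/eqP.
  apply: (centralizer_semiregular (x0 := x0) primG ntN nNG abN).
    by rewrite groupM ?groupV.
  by rewrite permM e permK.
have uK : cancel u v.
  by move=> y; have [Nn nE] := nuE y; rewrite /v /u /rVE /ErV abelem_rV_K.
have vK : cancel v u.
  move=> w; rewrite /u -[RHS](rVabelemK abelN ntN); congr (ErV _).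
  by have [Nn nE] := nuE (v w); apply: regN nE; rewrite // mem_rVabelem.
have cX : #|X| = #|'rV['F_p]_(abelem_dim' N).+1| by apply: bij_eq_card (Bijective uK vK).
exists p, (abelem_dim' N).+1; split=> //.
  by rewrite cX card_mx card_Fp // mul1n.
have [f0 nf0] : exists f, f \notin AGL 'F_p (abelem_dim' N).+1.
  by apply: AGL_proper; rewrite -cX.
apply: (max_perm_isomorphic Gmax (Bijective uK vK) (AGL_group _ _) nf0) => g Gg.
have [h [c [Gh Nc hx _ gE]]] := prim_factor x0 primG ntN nNG Gg.
exists (transport uK vK g); last exact: transportE.
apply: (AGL_mem (L := rG h) (v := ErV c)); first exact: repr_mx_unit.
move=> w; rewrite -[w in LHS]vK transportE /v gE.
have NwE : rVE w \in N by apply: mem_rVabelem.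
have NwJ : rVE w ^ h \in N by rewrite memJ_norm // (subsetP nNG').
rewrite -[in RHS](rVabelemK abelN ntN w) /ErV -abelem_rV_J // -abelem_rV_M //.
congr (ErV _); have [Nn nE] := nuE ((rVE w ^ h * c) x0).
by apply: regN nE; rewrite // groupM.
Qed.

End AffineType.

(** * Perfect groups, simple groups and congruences *)

(** Since 30 is the least number with three distinct prime factors, the theorem of
    Burnside on the groups of order [p ^ a * q ^ b] covers all smaller orders. *)
Lemma size_primes_lt30 n : n < 30 -> size (primes n) <= 2.
Proof.
have H : all (fun n => size (primes n) <= 2) (iota 0 30) by vm_compute.
by move=> n30; apply: (allP H); rewrite mem_iota.
Qed.

Lemma nonabelian_simple_card (gT : finGroupType) (T : {group gT}) :
  simple T -> ~~ abelian T -> 29 < #|T|.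
Proof.
move=> simT; apply: contraR; rewrite -leqNgt => /size_primes_lt30/Burnside_p_a_q_b.
move=> solT; apply/cyclic_abelian/prime_cyclic.
exact: simple_sol_prime solT simT.
Qed.

(** The symmetric groups of degree at most 4 are soluble. *)
Lemma perfect_act_trivial (aT : finGroupType) (sT : finType) (N : {group aT})
    (S : {set sT}) (to : {action aT &-> sT}) :
  N^`(1) = N -> [acts N, on S | to] -> #|S| <= 4 -> N \subset 'C(S | to).
Proof.
move=> perfN actN S4; pose rho := actperm (<[actN]>).
have rhoE n s : n \in N -> s \in S -> rho n s = to s n.
  by move=> Nn Ss; rewrite /rho actpermE /= /actby Ss Nn.
have sIS : rho @* N \subset perm.Sym S.
  apply/subsetP => _ /morphimP[n _ Nn ->]; rewrite inE; apply/subsetP => s.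
  rewrite inE; apply: contraR => nSs.
  by rewrite /rho actpermE /= /actby (negPf nSs).
have cI : #|rho @* N| < 30.
  apply: (@leq_ltn_trans #|S|`!); first by rewrite -perm.card_Sym subset_leq_card.
  by case: #|S| S4 => [|[|[|[|[|]]]]].
have sol := Burnside_p_a_q_b (size_primes_lt30 cI).
have perf : (rho @* N)^`(1) = rho @* N by rewrite -morphim_der // perfN.
have triv : rho @* N = 1.
  by apply/eqP; apply: contraTT isT => /(sol_der1_proper sol (subxx _)); rewrite perf properxx.
apply/subsetP => n Nn; apply/astabP => s Ss; rewrite -rhoE //.
have : rho n \in rho @* N by apply: mem_morphim.
by rewrite triv => /set1P ->; rewrite perm1.
Qed.

(** The simplicity of the alternating groups leaves no room for small normal
    subgroups of a symmetric group. *)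
Lemma normal_Sym_Alt (X : finType) (H : {group {perm X}}) :
  4 < #|X| -> H <| [set: {perm X}] -> 2 < #|H| -> 'Alt_X \subset H.
Proof.
move=> X5 nH H3; have [ntA simA] := simpleP _ (simple_Alt5 X5).
case: (simA _ (normalGI (subsetT 'Alt_X) nH)) => [e|<-]; last exact: subsetIr.
have := mul_cardG H 'Alt_X; rewrite setIC e cards1 muln1 => cHA.
have : #|H * 'Alt_X| <= #|'Sym_X| by rewrite subset_leq_card // subsetT.
rewrite card_Sym -(card_Alt (T := X)) ?(leq_trans _ X5) // -cHA.
by rewrite leq_pmul2r ?cardG_gt0 // leqNgt H3.
Qed.

(** * Solving congruences modulo normal subgroups *)

(** An element [l i] of [L] equivalent to [n i] modulo [C i] solves the [i]-th
    congruence without disturbing the others; the solution is the product of these. *)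
Lemma crt (gT : finGroupType) (I : finType) (N : {group gT}) (C : I -> {group gT}) :
  (forall i, C i <| N) ->
  (forall i, exists L : {group gT},
     [/\ L \subset N, forall j, j != i -> L \subset C j & N \subset L * C i]) ->
  forall n : I -> gT, (forall i, n i \in N) ->
  exists2 n0, n0 \in N & forall i, n0 * (n i)^-1 \in C i.
Proof.
move=> nC compl n Nn.
have [l lE] : exists l : I -> gT, forall i,
    [/\ l i \in N, forall j, j != i -> l i \in C j & l i * (n i)^-1 \in C i].
  apply: (fin_all_exists (P := fun i l => [/\ l \in N, forall j, j != i -> l \in C j
                                         & l * (n i)^-1 \in C i])) => i.
  have [L [sLN sLC sN]] := compl i.
  have /mulsgP[l c Ll Cc e] := subsetP sN _ (Nn i).
  exists l; split; first exact: subsetP sLN _ Ll.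
    by move=> j ji; apply: subsetP (sLC j ji) _ Ll.
  have lN : l \in 'N(C i).
    by have /andP[_ /subsetP] := nC i; apply; apply: subsetP sLN _ Ll.
  have -> : l * (n i)^-1 = c^-1 ^ l^-1 by rewrite e invMg conjgE invgK.
  by rewrite memJ_norm groupV.
exists (\prod_(i : I) l i); first by apply: group_prod => i _; have [] := lE i.
move=> i; have [sCN nCN] := andP (nC i).
have lN j : l j \in 'N(C i) by have [/(subsetP nCN)] := lE j.
have nN : n i \in 'N(C i) by apply: subsetP nCN _ (Nn i).
have lE' j : j != i -> coset (C i) (l j) = 1.
  by move=> ji; rewrite coset_id //; have [_ -> ] := lE j; rewrite // eq_sym.
apply: coset_idr; first by rewrite groupM ?groupV ?group_prod.
rewrite morphM ?groupV ?group_prod // morph_prod //.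
rewrite (big_only1 i) // => [|j ji _]; last exact: lE'.
have [_ _ h] := lE i; rewrite -morphM ?groupV //.
exact: coset_id.
Qed.

(** * Diagonal groups *)

Section DiagonalGroup.

Variables (T : finGroupType) (k : nat).
Implicit Types (x y t : word T k) (phi : {perm T}) (pi : 'S_k).

Definition lmul (d : T) x : word T k := [ffun i => d * x i].

Lemma diag_cosetP x y : reflect (exists d, y = lmul d x) (y \in diag_coset x).
Proof. by apply: (iffP imsetP) => [[d _ ->]|[d ->]]; exists d. Qed.

Lemma diag_coset_refl x : x \in diag_coset x.
Proof. by apply/diag_cosetP; exists 1; apply/ffunP => i; rewrite ffunE mul1g. Qed.

Lemma lmulM d e x : lmul d (lmul e x) = lmul (d * e) x.
Proof. by apply/ffunP => i; rewrite !ffunE mulgA. Qed.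

Lemma diag_coset_lmul d x : diag_coset (lmul d x) = diag_coset x.
Proof.
apply/setP => y; apply/diag_cosetP/diag_cosetP => [[e ->]|[e ->]].
  by exists (e * d); rewrite lmulM.
by exists (e * d^-1); rewrite lmulM mulgKV.
Qed.

Lemma diag_coset_eqP x y : reflect (exists d, y = lmul d x) (diag_coset x == diag_coset y).
Proof.
apply: (iffP eqP) => [e|[d ->]]; last by rewrite diag_coset_lmul.
by apply/diag_cosetP; rewrite e diag_coset_refl.
Qed.

Lemma diag_coset_in x : diag_coset x \in [set diag_coset y | y : word T k].
Proof. exact: imset_f. Qed.

Definition dpt x : diag_point T k := exist _ (diag_coset x) (diag_coset_in x).

Lemma dpt_onto (C : diag_point T k) : exists x, C = dpt x.
Proof. by case: C => C CP; have /imsetP[x _ e] := CP; exists x; apply: val_inj. Qed.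

Lemma dpt_eq x y : (dpt x == dpt y) = (diag_coset x == diag_coset y).
Proof. by []. Qed.

Lemma card_diag_coset x : 0 < k -> #|diag_coset x| = #|T|.
Proof.
case: k x => // k' x _; rewrite card_imset // => d e /ffunP/(_ ord0).
by rewrite !ffunE => /mulIg.
Qed.

Lemma card_diag_point : 0 < k -> #|{: diag_point T k}| = (#|T| ^ k.-1)%N.
Proof.
move=> k0; have T0 : 0 < #|T| by apply/card_gt0P; exists 1.
apply/eqP; rewrite -(eqn_pmul2r T0) -expnSr prednK //.
rewrite -[in X in _ == X](card_ord k) -card_ffun -[X in _ == X]sum1_card.
rewrite (partition_big (fun x => dpt x) predT) //= -[#|{: diag_point T k}|]sum1_card big_distrl.
apply/eqP; apply: eq_bigr => C _; have [x ->] := dpt_onto C.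
rewrite [LHS]mul1n -(card_diag_coset x k0) -sum1_card; apply: eq_bigl => y.
rewrite dpt_eq eq_sym; apply/diag_cosetP/diag_coset_eqP => -[d ->]; by exists d.
Qed.

Lemma aut_mul phi (a b : T) : phi \in Aut [set: T] -> phi (a * b) = phi a * phi b.
Proof. by move=> /Aut_morphic/morphicP ->; rewrite ?inE. Qed.

Lemma diag_map_lmul phi t pi d x : phi \in Aut [set: T] ->
  diag_map phi t pi (lmul d x) = lmul (phi d) (diag_map phi t pi x).
Proof. by move=> Ap; apply/ffunP => i; rewrite !ffunE aut_mul // mulgA. Qed.

Lemma diag_map_coset phi t pi x : phi \in Aut [set: T] ->
  diag_map phi t pi @: diag_coset x = diag_coset (diag_map phi t pi x).
Proof.
move=> Ap; apply/setP => y; apply/imsetP/diag_cosetP => [[_ /diag_cosetP[d ->] ->]|[d ->]].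
  by exists (phi d); rewrite diag_map_lmul.
exists (lmul (phi^-1 d) x); first by apply/diag_cosetP; exists (phi^-1 d).
by rewrite diag_map_lmul // permKV.
Qed.

Lemma diagonal_groupP (f : {perm diag_point T k}) :
  reflect (exists phi t pi, phi \in Aut [set: T] /\
             forall x, f (dpt x) = dpt (diag_map phi t pi x))
          (f \in diagonal_group T k).
Proof.
rewrite inE; apply: (iffP exists_inP) => [[phi Ap /existsP[t /existsP[pi /forallP fE]]]|].
  exists phi, t, pi; split=> // x; apply: val_inj.
  by rewrite (eqP (fE _)) diag_map_coset.
case=> phi [t [pi [Ap fE]]]; exists phi => //; apply/existsP; exists t.
apply/existsP; exists pi; apply/forallP => C; have [x ->] := dpt_onto C.
by rewrite fE /= diag_map_coset.
Qed.

Lemma diag_map_comp phi t pi phi' t' pi' x : phi' \in Aut [set: T] ->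
  diag_map phi' t' pi' (diag_map phi t pi x) =
  diag_map (phi * phi') [ffun i => phi' (t (pi'^-1 i)) * t' i] (pi * pi') x.
Proof.
by move=> Ap; apply/ffunP => i; rewrite !ffunE aut_mul // invMg !permM mulgA.
Qed.

Lemma diag_map1 x : diag_map 1 [ffun => 1] 1 x = x.
Proof. by apply/ffunP => i; rewrite !ffunE invg1 !perm1 mulg1. Qed.

Lemma diagonal_group_set : group_set (diagonal_group T k).
Proof.
apply/group_setP; split=> [|f f'].
  apply/diagonal_groupP; exists 1, [ffun => 1], 1; split; first exact: group1.
  by move=> x; rewrite diag_map1 perm1.
case/diagonal_groupP=> phi [t [pi [Ap fE]]] /diagonal_groupP[phi' [t' [pi' [Ap' fE']]]].
apply/diagonal_groupP; exists (phi * phi'), [ffun i => phi' (t (pi'^-1 i)) * t' i], (pi * pi').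
by split=> [|x]; [apply: groupM | rewrite permM fE fE' diag_map_comp].
Qed.

Lemma fact_gt_square n : 4 < n -> (2 * n) * n < n`!.
Proof.
elim: n => // n IHn; rewrite leq_eqVlt => /predU1P[<- //|n5].
have := IHn n5; rewrite factS; nia.
Qed.

(** Otherwise the right translations, of which there are only [|T|^k], would
    form a normal subgroup of the symmetric group on [|T|^(k-1)] points. *)
Lemma diagonal_group_proper : nonabelian_simple T -> 1 < k ->
  exists f, f \notin diagonal_group T k.
Proof.
case=> simT nabT k1; have T30 := nonabelian_simple_card simT nabT.
rewrite cardsT in T30.
have k0 : 0 < k by apply: ltnW.
pose n := #|{: diag_point T k}|; have nE : n = (#|T| ^ k.-1)%N by apply: card_diag_point.
have leTn : #|T| <= n.
  by rewrite nE -{1}[#|T|]expn1 leq_exp2l ?(leq_trans _ T30) // -ltnS prednK.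
have n5 : 4 < n by apply: leq_trans leTn; apply: leq_trans T30.
apply/existsP; rewrite -negb_forall; apply/negP => /forallP allD.
have [rt rtE] : exists rt : word T k -> {perm diag_point T k},
    forall t x, rt t (dpt x) = dpt (diag_map 1 t 1 x).
  have [t|rt rtE] := @fin_all_exists _ _ (fun (t : word T k) (f : {perm diag_point T k}) =>
    forall x, f (dpt x) = dpt (diag_map 1 t 1 x)); last by exists rt.
  have [rp rpE] := fin_all_exists dpt_onto.
  pose F C := dpt (diag_map 1 t 1 (rp C)).
  have Finj : injective F.
    move=> C D /eqP; rewrite dpt_eq => /diag_coset_eqP[d e].
    rewrite [C]rpE [D]rpE; apply/eqP; rewrite dpt_eq; apply/diag_coset_eqP; exists d.
    apply/ffunP => i; have := congr1 (fun w : word T k => w i) e.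
    by rewrite !ffunE invg1 !perm1 mulgA => /mulIg.
  exists (perm Finj) => x; rewrite permE; apply/eqP; rewrite dpt_eq.
  apply/diag_coset_eqP; have : dpt (rp (dpt x)) == dpt x by rewrite -rpE.
  rewrite dpt_eq => /diag_coset_eqP[d e]; exists d; rewrite {1}e.
  by rewrite diag_map_lmul ?group1 // perm1.
have rt_uniq t (f : {perm diag_point T k}) :
    (forall x, f (dpt x) = dpt (diag_map 1 t 1 x)) -> f = rt t.
  by move=> fE; apply/permP => C; have [x ->] := dpt_onto C; rewrite fE rtE.
have rtM t t' : rt t * rt t' = rt [ffun i => t i * t' i].
  apply: rt_uniq => x; rewrite permM !rtE; congr dpt; apply/ffunP => i.
  by rewrite !ffunE invg1 !perm1 mulgA.
have gR : group_set [set rt t | t : word T k].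
  apply/group_setP; split=> [|_ _ /imsetP[t _ ->] /imsetP[t' _ ->]]; last first.
    by rewrite rtM imset_f.
  apply/imsetP; exists [ffun => 1] => //; apply: rt_uniq => x.
  by rewrite perm1 diag_map1.
pose R := Group gR.
have nR : R <| [set: {perm diag_point T k}].
  apply/normalP; split=> [|f _]; first exact: subsetT.
  apply/eqP; rewrite eqEcard cardJg leqnn andbT.
  apply/subsetP => _ /imsetP[_ /imsetP[s _ ->] ->].
  have /diagonal_groupP[phi [t [pi [Ap fE]]]] := allD f.
  pose s' : word T k := [ffun i => (t i)^-1 * phi (s (pi^-1 i)) * t i].
  suff -> : rt s ^ f = rt s' by apply: imset_f.
  rewrite conjgE; apply/(canLR (mulKg f))/permP => C; have [x ->] := dpt_onto C.
  rewrite !permM rtE !fE rtE; congr dpt; apply/ffunP => i.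
  by rewrite !ffunE invg1 !perm1 aut_mul // !mulgA mulgK.
have cR : #|R| <= #|T| ^ k.
  have <- : #|word T k| = (#|T| ^ k)%N by rewrite card_ffun card_ord.
  exact: leq_imset_card.
have nleR : n <= #|R|.
  have : [set: diag_point T k] \subset
      [set (f : {perm diag_point T k}) (dpt [ffun => 1]) | f in R].
    apply/subsetP => C _; have [x ->] := dpt_onto C; apply/imsetP.
    exists (rt x); first exact: imset_f.
    rewrite rtE; congr dpt; apply/ffunP => i.
    by rewrite !ffunE perm1 mul1g.
  move/subset_leq_card; rewrite cardsT => /leq_trans; apply.
  exact: leq_imset_card.
have sAR : 'Alt_(diag_point T k) \subset R.
  by apply: normal_Sym_Alt => //; apply: leq_trans nleR; apply: leq_trans n5.
have := subset_leq_card sAR; have := card_Alt (T := diag_point T k); rewrite -/n => cA.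
have := fact_gt_square n5; rewrite -cA ?(leq_trans _ n5) // => lt1 le2.
have : (#|T| ^ k = n * #|T|)%N by rewrite nE -expnSr prednK.
move=> e; rewrite e in cR.
have := leq_trans le2 (leq_trans cR (leq_mul (leqnn n) leTn)).
by rewrite leqNgt -(ltn_pmul2l (m := 2)) // mulnA lt1.
Qed.

(** [w y] is a representative of the point [y], defined up to left multiplication
    by the diagonal of [T^k]. *)
Lemma diagonal_typeI (X : finType) (G : {group {perm X}}) (w : X -> word T k) :
  max_perm_group G -> nonabelian_simple T -> 1 < k ->
  (forall y y' : X, diag_coset (w y) = diag_coset (w y') -> y = y') ->
  (forall t, exists y : X, diag_coset (w y) = diag_coset t) ->
  (forall g, g \in G -> exists phi t pi, phi \in Aut [set: T] /\
     forall y : X, diag_coset (w (g y)) = diag_coset (diag_map phi t pi (w y))) ->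
  diagonal_type G.
Proof.
move=> Gmax nsT k1 winj wonto wG; pose u (y : X) := dpt (w y).
have bij_u : bijective u.
  have [|v vK] := @fin_all_exists _ _ (fun (C : diag_point T k) (y : X) => u y = C).
    move=> C; have [t ->] := dpt_onto C; have [y e] := wonto t; exists y.
    by apply: val_inj.
  exists v => //; move=> y; apply: winj; exact: (congr1 val (vK (u y))).
have cX := bij_eq_card bij_u.
exists T, k; split=> //; first by rewrite cX card_diag_point // ltnW.
have [f0 nf0] := diagonal_group_proper nsT k1.
apply: (max_perm_isomorphic Gmax bij_u diagonal_group_set nf0) => g Gg.
have [v uK vK] := bij_u; exists (transport uK vK g); last first.
  by move=> x; apply: transportE.
have [phi [t [pi [Ap gE]]]] := wG g Gg.
apply/diagonal_groupP; exists phi, t, pi; split=> // x.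
have [y e] := wonto x; have eu : dpt x = u y by apply: val_inj.
rewrite eu transportE; apply: val_inj; rewrite /= gE.
have /eqP/diag_coset_eqP[d ->] := esym e.
by rewrite diag_map_lmul // diag_coset_lmul.
Qed.

End DiagonalGroup.

(** * Primitive groups with a nonabelian minimal normal subgroup *)

Section ConjSubgroup.

Variables (gT : finGroupType) (A : {group gT}).

Definition subg_conj_fun (h : gT) (x : subg_of A) : subg_of A :=
  if h \in 'N(A) then subg A (sgval x ^ h) else x.

Lemma subg_conj_fun_inj h : injective (subg_conj_fun h).
Proof.
rewrite /subg_conj_fun => x y; case: ifP => // nAh /(congr1 (@sgval _ _)).
have AJ (z : subg_of A) : sgval z ^ h \in A by rewrite memJ_norm ?subgP.
by rewrite !subgK // => /conjg_inj/val_inj.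
Qed.

(** The diagonal and almost simple types speak of a group type, not of a subgroup
    of another group: this is the automorphism induced on the group type of [A]. *)
Definition subg_conj h : {perm subg_of A} := perm (@subg_conj_fun_inj h).

Lemma subg_conjE h x : h \in 'N(A) -> sgval (subg_conj h x) = sgval x ^ h.
Proof.
move=> nAh; rewrite permE /subg_conj_fun nAh subgK //.
by rewrite memJ_norm // subgP.
Qed.

Lemma subg_conj_Aut h : h \in 'N(A) -> subg_conj h \in Aut [set: subg_of A].
Proof.
move=> nAh; rewrite inE; apply/andP; split; first by apply/subsetP => x _; rewrite inE.
apply/morphicP => x y _ _; apply: val_inj.
by rewrite -[val _]/(sgval _) /= !subg_conjE // -conjMg.
Qed.

Lemma subg_conjM g h : g \in 'N(A) -> h \in 'N(A) ->
  subg_conj (g * h) = subg_conj g * subg_conj h.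
Proof.
move=> nAg nAh; apply/permP => x; apply: val_inj; rewrite permM.
by rewrite -[LHS]/(sgval _) -[RHS]/(sgval _) !subg_conjE ?groupM // conjgM.
Qed.

Lemma subg_nonabelian_simple : simple A -> ~~ abelian A -> nonabelian_simple (subg_of A).
Proof.
move=> simA nabA; have iso := isog_subg A.
by split; rewrite -?(isog_simple iso) -?(isog_abelian iso).
Qed.

End ConjSubgroup.

Section Nonabelian.

Variables (X : finType) (G N : {group {perm X}}) (x0 : X).
Hypothesis Gmax : max_perm_group G.
Hypothesis primG : [primitive G, on [set: X] | 'P].
Hypotheses (minN : minnormal N G) (sNG : N \subset G) (nabN : ~~ abelian N).

Lemma minnormal_nt : N :!=: 1.
Proof. by have /andP[] := mingroupp minN. Qed.

Lemma minnormal_normal : N <| G.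
Proof. by have /andP[_] := mingroupp minN; rewrite /normal sNG. Qed.

(** The derived subgroup is characteristic, hence normal in [G]. *)
Lemma minnormal_perfect : N^`(1) = N.
Proof.
have [_ minN'] := mingroupP minN; have [_ nNG] := andP minnormal_normal.
apply: (minN' (N^`(1))%G) => /=; last exact: der_sub.
rewrite (char_norm_trans (der_char 1 N) nNG) andbT.
by apply: contra nabN => /eqP/derG1P.
Qed.

Lemma orbitJ (C : {set {perm X}}) g y :
  orbit 'P (C :^ g) (g y) = g @: orbit 'P C y.
Proof.
apply/setP => z; rewrite -[z](permKV g) (mem_imset _ _ perm_inj).
have := orbit_conjsg 'P C g y (g^-1 z). rewrite /= /aperm. exact.
Qed.

Section CartesianFamily.

Variables (k : nat) (C : 'I_k -> {group {perm X}}).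
Hypothesis k_gt1 : 1 < k.
Hypothesis normC : forall i, C i <| N.
Hypothesis permC : forall g, g \in G -> exists al : 'S_k, forall i, C i :^ g = C (al i).
Hypothesis transC : forall i j, exists2 g, g \in G & C i :^ g = C j.
Hypothesis crtC : forall n : 'I_k -> {perm X}, (forall i, n i \in N) ->
  exists2 n0, n0 \in N & forall i, n0 * (n i)^-1 \in C i.
Hypothesis stabC : forall n : {perm X}, n \in N ->
  (forall i, exists d : {perm X}, [/\ d \in N, d x0 = x0 & d^-1 * n \in C i]) ->
  n x0 = x0.

Let f i y := orbit 'P (C i) y.

Lemma cart_orbitJ g i j y : C i :^ g = C j -> f j (g y) = g @: f i y.
Proof. by move=> e; rewrite /f -e orbitJ. Qed.

Lemma cart_orbit_eq i (n n' : {perm X}) : n \in N -> n' \in N ->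
  n' * n^-1 \in C i -> f i (n x0) = f i (n' x0).
Proof.
move=> Nn Nn' Cc; apply/orbit_eqP; rewrite orbit_sym; apply/orbitP.
have nC : n \in 'N(C i) by have /andP[_ /subsetP] := normC i; apply.
exists ((n' * n^-1) ^ n); first by rewrite memJ_norm.
by rewrite conjgE mulgKV /= /aperm -permM !mulgA mulgV mul1g.
Qed.

(** The coordinates of a point are its orbits under the groups [C i]. They determine
    the point by [stabC], they are independent by [crtC], and [G] permutes them.
    Each takes at least five values, since [N] is perfect and a perfect group acts
    trivially on at most four points. *)
Lemma cart_family_wreath : wreath_type G.
Proof.
have nt := minnormal_nt; have nNG := minnormal_normal.
have [nu nuE] := trans_section x0 primG nt nNG.
have nuV y : (nu y)^-1 y = x0 by have [_ e] := nuE y; rewrite -{2}e permK.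
have f_inj x y : (forall i, f i x = f i y) -> x = y.
  move=> e; have [Nx xE] := nuE x; have [Ny yE] := nuE y.
  suff : (nu x * (nu y)^-1) x0 = x0.
    by rewrite permM xE => /(congr1 (nu y)); rewrite permKV yE.
  apply: stabC => [|i]; first by rewrite groupM ?groupV.
  have /orbitP[c Cc cE] : y \in orbit 'P (C i) x.
    by apply/orbit_eqP; apply: esym (e i).
  have [sCN nCN] := andP (normC i).
  exists (nu x * c * (nu y)^-1); split.
  - by rewrite !groupM ?groupV // (subsetP sCN).
  - by rewrite !permM xE [c x]cE nuV.
  have -> : (nu x * c * (nu y)^-1)^-1 * (nu x * (nu y)^-1) = c^-1 ^ (nu y)^-1.
    by rewrite conjgE !invMg !invgK -!mulgA mulKg.
  by rewrite memJ_norm ?groupV // (subsetP nCN).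
have f_onto (c : 'I_k -> X) : exists x, forall i, f i x = f i (c i).
  have [n0 Nn0 n0E] := crtC (fun i => (nuE (c i)).1).
  exists (n0 x0) => i; have [Nc cE] := nuE (c i); rewrite -[in RHS]cE.
  by apply/esym/cart_orbit_eq.
have f_equiv g : g \in G -> exists al : 'S_k,
    forall i x y, f i x = f i y -> f (al i) (g x) = f (al i) (g y).
  case/permC=> al alE; exists al => i x y e.
  by rewrite !(cart_orbitJ _ (alE i)) e.
have i0 : 'I_k := Ordinal (ltnW k_gt1).
pose m := #|[set f i0 x | x : X]|.
have f_card i : #|[set f i x | x : X]| = m.
  have [g Gg gE] := transC i0 i.
  have -> : [set f i x | x : X] = imset (fun Z : {set X} => g @: Z) (mem [set f i0 x | x : X]).
    apply/setP => Z; apply/imsetP/imsetP => [[x _ ->]|[_ /imsetP[x _ ->] ->]].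
      exists (f i0 (g^-1 x)); first exact: imset_f.
      by rewrite -(cart_orbitJ _ gE) permKV.
    by exists (g x) => //; rewrite (cart_orbitJ _ gE).
  by rewrite card_imset //; apply: imset_inj; apply: perm_inj.
apply: (cartesian_wreath_type f_inj f_onto f_card f_equiv) => //.
rewrite ltnNge; apply/negP => m4.
have f_const i x y : f i x = f i y.
  have actN : [acts N, on [set f i x | x : X] | 'P^*].
    apply/subsetP => n Nn; rewrite !inE; apply/subsetP => _ /imsetP[z _ ->].
    rewrite inE; apply/imsetP; exists (n z) => //.
    have nC : C i :^ n = C i by have /andP[_ /subsetP/(_ n Nn)/normP] := normC i.
    by rewrite (cart_orbitJ _ nC); apply: eq_imset.
  have /subsetP triv : N \subset 'C([set f i x | x : X] | 'P^*).
    by apply: perfect_act_trivial; rewrite ?minnormal_perfect // f_card.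
  have fx0 n : n \in N -> f i (n x0) = f i x0.
    move=> Nn; have nC : C i :^ n = C i by have /andP[_ /subsetP/(_ n Nn)/normP] := normC i.
    rewrite (cart_orbitJ _ nC); have /astabP/(_ (f i x0)) e := triv n Nn.
    by rewrite -[RHS]e; [apply: eq_imset | apply: imset_f].
  by have [Nx <-] := nuE x; have [Ny <-] := nuE y; rewrite !fx0.
have := max_perm_gt1 Gmax; rewrite ltnNge; case/negP.
by apply/card_le1_eqP => x y _ _; apply: f_inj => i; apply: f_const.
Qed.

End CartesianFamily.

(** ** The simple factors *)

Section Factors.

Variable T : {group {perm X}}.
Hypotheses (minT : minnormal T N) (sTN : T \subset N).

Let simples : {set {group {perm X}}} := orbit 'JG G T.
Let k := #|simples|.
(** The conjugates in [G] of a minimal normal subgroup [T] of [N]; they are simple,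
    and [N] is their direct product. *)
Definition factor (i : 'I_k) : {group {perm X}} := enum_val i.
(** The product of the other factors, described without reference to them. *)
Definition cofactor i : {group {perm X}} := 'C_N(factor i)%G.

Lemma factor_conj i : exists2 g, g \in G & factor i :=: T :^ g.
Proof.
have /imsetP[g Gg e] : factor i \in simples by apply: enum_valP.
by exists g => //; rewrite e.
Qed.

Lemma factor_onto g : g \in G -> exists i, T :^ g = factor i.
Proof.
move=> Gg; have inS : (T :^ g)%G \in simples by apply/imsetP; exists g.
by exists (enum_rank_in inS (T :^ g)%G); rewrite /factor enum_rankK_in.
Qed.

Lemma factor_inj i j : factor i :=: factor j -> i = j.
Proof. by move=> e; apply: enum_val_inj; apply: val_inj. Qed.

Lemma NJ g : g \in G -> N :^ g = N.
Proof. by have [_ /subsetP nNG] := andP minnormal_normal => /nNG/normP. Qed.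

Lemma factor_min i : minnormal (factor i) N /\ factor i \subset N.
Proof.
have [g Gg ->] := factor_conj i; have NJg := NJ Gg.
split; last by rewrite -NJg conjSg.
have [/andP[nT nTN] minT'] := mingroupP minT.
apply/mingroupP; split=> [|H /andP[nH nHN] sHT].
  by rewrite normJ -{1}NJg conjSg nTN andbT -(conjs1g g) (inj_eq (@conjsg_inj _ g)).
apply: (canRL (conjsgKV g)); apply: (minT' (H :^ g^-1)%G) => /=.
  rewrite normJ -[gval N](conjsgK g) NJg conjSg nHN andbT.
  by rewrite -(conjs1g g^-1) (inj_eq (@conjsg_inj _ _)).
by rewrite sub_conjgV.
Qed.

Lemma factor_normal i : factor i <| N.
Proof.
have [minS sSN] := factor_min i; have /andP[_ nSN] := mingroupp minS.
by rewrite /normal sSN.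
Qed.

Lemma factor_nt i : factor i :!=: 1.
Proof. by have [minS _] := factor_min i; have /andP[] := mingroupp minS. Qed.

Lemma normal_factor_cap (A : {group {perm X}}) i :
  N \subset 'N(A) -> factor i \subset A \/ A :&: factor i = 1.
Proof.
move=> nAN; have [minS sSN] := factor_min i.
have [/andP[_ nSN] minS'] := mingroupP minS.
have [e|nt] := eqVneq (A :&: factor i) 1; [by right | left].
have <- : A :&: factor i = factor i; last exact: subsetIl.
by apply: (minS' (A :&: factor i)%G); rewrite ?subsetIr //= nt normsI.
Qed.

Lemma factor_commute i j : i != j -> factor i \subset 'C(factor j).
Proof.
move=> ij; have /andP[sSN nSN] := factor_normal i.
have /andP[sSN' nSN'] := factor_normal j.
case: (normal_factor_cap j nSN) => [sji|tr]; last first.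
  apply/commG1P/trivgP; rewrite -tr subsetI commg_subl commg_subr.
  by rewrite (subset_trans sSN') // (subset_trans sSN).
case: (normal_factor_cap i nSN') => [sij|tr]; last first.
  by have := factor_nt j; rewrite -subG1 -tr setIC subsetI sji subxx.
by case/eqP: ij; apply: factor_inj; apply/eqP; rewrite eqEsubset sij sji.
Qed.

Lemma cofactor_normal i : cofactor i <| N.
Proof.
have /andP[_ nSN] := factor_normal i; rewrite /normal subsetIl /=.
by rewrite normsI ?normG // (subset_trans nSN) ?cent_norm.
Qed.

Lemma sub_cofactor i j : i != j -> factor i \subset cofactor j.
Proof. by move=> ij; rewrite subsetI factor_commute // andbT; have [] := factor_min i. Qed.

(** The conjugates of [T] generate a normal subgroup of [G]. *)
Lemma gen_factors : <<\bigcup_i factor i>> = N.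
Proof.
have [/andP[_ nNG] minN'] := mingroupP minN.
have sSN : <<\bigcup_i factor i>> \subset N.
  by rewrite gen_subG; apply/bigcupsP => i _; have [] := factor_min i.
apply: (minN' <<\bigcup_i factor i>>%G) => //=; apply/andP; split.
  have [i eT] := factor_onto (group1 G); apply: contra (factor_nt i).
  by rewrite -!subG1; apply: subset_trans; rewrite sub_gen ?(bigcup_sup i).
apply/norms_gen/subsetP => g Gg; rewrite inE; apply/subsetP => y.
rewrite mem_conjg => /bigcupP[i _ yS]; have [h Gh e] := factor_conj i.
have [j ej] := factor_onto (groupM Gh Gg); apply/bigcupP; exists j => //.
by rewrite -ej conjsgM -e mem_conjg.
Qed.

Lemma factor_mul i : factor i * cofactor i = N.
Proof.
have /andP[sSN nSN] := factor_normal i; have /andP[sCN nCN] := cofactor_normal i.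
apply/eqP; rewrite eqEsubset mul_subG //= -norm_joinEl ?(subset_trans sSN) //.
rewrite -{1}gen_factors gen_subG; apply/bigcupsP => j _.
have [->|ji] := eqVneq j i; first exact: joing_subl.
exact: subset_trans (sub_cofactor ji) (joing_subr _ _).
Qed.

Lemma center_trivial n : n \in N -> n \in 'C(N) -> n = 1.
Proof.
move=> Nn cn; have [/andP[_ nNG] minN'] := mingroupP minN.
suff Z1 : 'Z(N) = 1.
  by have : n \in 'Z(N) by [rewrite inE Nn]; rewrite Z1 => /set1P.
apply/eqP; apply: contraR nabN => ntZ; rewrite /abelian.
have <- : 'Z(N) = N; last exact: subset_trans (subsetIr _ _) (centS (subsetIl _ _)).
apply: minN'; last exact: center_sub; rewrite ntZ.
exact: char_norm_trans (center_char N) nNG.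
Qed.

Lemma cofactor_cap n : (forall i, n \in cofactor i) -> n \in N -> n = 1.
Proof.
move=> h Nn; apply: center_trivial => //; rewrite -gen_factors cent_gen.
apply/centP => y /bigcupP[i _ yS]; have /setIP[_ /centP] := h i; exact.
Qed.

Lemma cofactor_proper i : ~~ (N \subset cofactor i).
Proof.
apply: contra (factor_nt i) => /subsetP sNC; rewrite -subG1; apply/subsetP => y yS.
have [_ /subsetP sSN] := factor_min i; apply/set1P; apply: center_trivial; first exact: sSN.
by apply/centP => n /sNC /setIP[_ /centP/(_ y yS)].
Qed.

Lemma cofactorJ g : g \in G -> exists al : 'S_k, forall i, cofactor i :^ g = cofactor (al i).
Proof.
move=> Gg; have alP i : exists j, factor i :^ g = factor j.
  by have [h Gh ->] := factor_conj i; rewrite -conjsgM; apply: factor_onto; apply: groupM.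
have [al alE] := fin_all_exists alP.
have al_inj : injective al.
  by move=> i j e; apply: factor_inj; apply: (@conjsg_inj _ g); rewrite !alE e.
exists (perm al_inj) => i; rewrite permE /= conjIg NJ //.
by rewrite -centJ alE.
Qed.

Lemma cofactor_trans i j : exists2 g, g \in G & cofactor i :^ g = cofactor j.
Proof.
have [g Gg ei] := factor_conj i; have [h Gh ej] := factor_conj j.
exists (g^-1 * h); first by rewrite groupM ?groupV.
rewrite /= conjIg NJ ?groupM ?groupV // -centJ.
by rewrite ei ej conjsgM conjsgK.
Qed.

Lemma cofactor_crt (n : 'I_k -> {perm X}) : (forall i, n i \in N) ->
  exists2 n0, n0 \in N & forall i, n0 * (n i)^-1 \in cofactor i.
Proof.
apply: crt; first exact: cofactor_normal.
move=> i; exists (factor i); have [_ sSN] := factor_min i; split=> //.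
  by move=> j ji; apply: sub_cofactor; rewrite eq_sym.
by rewrite factor_mul.
Qed.

(** ** The stabilizer of a point *)

Let D : {group {perm X}} := 'C_N[x0 | 'P]%G.

Lemma stabN_mem d : (d \in D) = (d \in N) && (d x0 == x0).
Proof. by rewrite inE; congr andb; apply/astab1P/eqP. Qed.

Lemma stabN_sub : D \subset N. Proof. exact: subsetIl. Qed.

Lemma stabN_conj h : h \in G -> h x0 = x0 -> D :^ h = D.
Proof.
move=> Gh hx; apply/setP => y; rewrite mem_conjg !stabN_mem -mem_conjg NJ //.
have hV : h^-1 x0 = x0 by rewrite -{1}hx permK.
have -> : (y ^ h^-1) x0 = h^-1 (y x0) by rewrite -{1}hV permJ.
by rewrite -{2}hV (inj_eq perm_inj).
Qed.

Lemma stabN_norm i : D \subset 'N(cofactor i).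
Proof. by have /andP[_] := cofactor_normal i; apply: subset_trans stabN_sub. Qed.

(** [Q] consists of the elements of [N] that agree with some element of [D] modulo
    each cofactor. As the stabilizer of [x0] in [G] is a maximal subgroup
    normalizing [Q], either it contains [Q], and then the cofactors give a Cartesian
    decomposition, or together with [Q] it generates [G]. *)
Lemma wreath_or_subdirect : 1 < k ->
  wreath_type G \/ forall i, D * cofactor i = N.
Proof.
move=> k1; have [trG _] := andP primG.
pose Q := [group of \bigcap_i (D <*> cofactor i)].
have QP y : reflect (forall i, y \in D * cofactor i) (y \in Q).
  apply: (iffP bigcapP) => [h i|h i _]; first by rewrite -norm_joinEl ?h ?stabN_norm.
  by rewrite /= norm_joinEl ?stabN_norm ?h.
pose Gx := 'C_G[x0 | 'P]%G.
have GxP h : (h \in Gx) = (h \in G) && (h x0 == x0).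
  by rewrite inE; congr andb; apply/astab1P/eqP.
have i0 : 'I_k := Ordinal (ltnW k1).
have sCN i : cofactor i \subset N by exact: subsetIl.
have sQN : Q \subset N.
  apply/subsetP => y /QP/(_ i0) /mulsgP[d c Dd Cc ->].
  exact: groupM (subsetP stabN_sub _ Dd) (subsetP (sCN i0) _ Cc).
have nQ : Gx \subset 'N(Q).
  apply/subsetP => h; rewrite GxP => /andP[Gh /eqP hx]; rewrite inE.
  apply/subsetP => _ /imsetP[y /QP yQ ->]; apply/QP => i.
  have [al alE] := cofactorJ Gh; rewrite -[i](permKV al) -alE.
  by rewrite -[gval D](stabN_conj Gh hx) -conjsMg memJ_conjg yQ.
have := trans_prim_astab (in_setT x0) trG; rewrite primG => /esym/maximal_eqP[_ maxGx].
case: (maxGx (Gx <*> Q)%G).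
- exact: joing_subl.
- by rewrite join_subG subsetIl (subset_trans sQN).
- move=> e; left; have sQG : Q \subset Gx by rewrite -e joing_subr.
  apply: (cart_family_wreath k1 cofactor_normal cofactorJ cofactor_trans cofactor_crt).
  move=> n Nn h; have : n \in Gx.
    apply: (subsetP sQG); apply/QP => i; have [d [Nd dx dn]] := h i.
    apply/mulsgP; exists d (d^-1 * n); rewrite ?mulKVg //.
    by rewrite stabN_mem Nd dx eqxx.
  by rewrite GxP => /andP[_ /eqP].
move=> e; right=> i; apply/eqP; rewrite eqEsubset mul_subG ?stabN_sub ?sCN //=.
apply/subsetP => n Nn; have : n \in Gx <*> Q by rewrite [_ <*> _]e (subsetP sNG).
rewrite norm_joinEl // => /mulsgP[h q Gh Qq en].
have Nh : h \in D.
  rewrite stabN_mem; move: Gh; rewrite GxP => /andP[_ ->]; rewrite andbT.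
  by rewrite -[h](mulgK q) -en groupM ?groupV // (subsetP sQN).
have /QP/(_ i)/mulsgP[d c Dd Cc eq] := Qq; apply/mulsgP; exists (h * d) c => //.
  exact: groupM.
by rewrite en eq mulgA.
Qed.

Section Subdirect.

Hypothesis sub_dir : forall i, D * cofactor i = N.

Let K i : {group {perm X}} := (D :&: cofactor i)%G.

(** [D] covers the simple quotient of [N] by the cofactor, so the image of [A] there
    is a normal subgroup. *)
Lemma subdirect_dichotomy (A : {group {perm X}}) i : A \subset D -> D \subset 'N(A) ->
  A \subset cofactor i \/ D \subset A * K i.
Proof.
move=> sAD nAD; have sAN := subset_trans sAD stabN_sub.
have nCA : A \subset 'N(cofactor i) := subset_trans sAD (stabN_norm i).
pose B := (A <*> cofactor i)%G.
have nB : N \subset 'N(B).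
  rewrite -(sub_dir i) mul_subG //; first by rewrite normsY ?stabN_norm.
  exact: subset_trans (joing_subr _ _) (normG _).
case: (normal_factor_cap i nB) => [sSB|tr].
  right; have sNB : N \subset A * cofactor i.
    by rewrite -norm_joinEl // -(factor_mul i) mul_subG // joing_subr.
  have -> : A * K i = (A * cofactor i) :&: D by rewrite -group_modl // [in RHS]setIC.
  by rewrite subsetI subxx andbT (subset_trans stabN_sub).
left; rewrite subsetI sAN /=; apply: subset_trans (joing_subl _ (cofactor i)) _.
have /andP[sSN nSN] := factor_normal i.
apply/commG1P/trivgP; rewrite /= -tr subsetI commg_subl commg_subr (subset_trans sSN) //.
by rewrite (subset_trans _ nSN) // join_subG sAN subsetIl.
Qed.

Lemma stabN_der i : ~~ (D^`(1) \subset cofactor i).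
Proof.
apply: contra (cofactor_proper i) => sDC; have /andP[sCN nCN] := cofactor_normal i.
rewrite -{1}(minnormal_perfect) der1_min // -(sub_dir i) quotientMidr.
by apply: sub_der1_abelian sDC.
Qed.

Lemma stabN_cofactor i : ~~ (D \subset cofactor i).
Proof. by apply: contra (stabN_der i); apply: subset_trans (der_sub _ _). Qed.

(** The quotient of [D] by its intersection with the cofactor is nonabelian simple,
    so two normal subgroups that cover it do not commute modulo the cofactor. *)
Lemma kernel_prime (A B : {group {perm X}}) i :
  A \subset D -> D \subset 'N(A) -> B \subset D -> D \subset 'N(B) ->
  [~: A, B] \subset cofactor i -> A \subset cofactor i \/ B \subset cofactor i.
Proof.
move=> sAD nAD sBD nBD sAB.
case: (subdirect_dichotomy i sAD nAD) => [|sDA]; [by left | right].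
case: (subdirect_dichotomy i sBD nBD) => [//|sDB].
have quo (E : {group {perm X}}) : E \subset D -> D \subset E * K i ->
    D / cofactor i \subset E / cofactor i.
  move=> sED sDE; apply: subset_trans (quotientS _ sDE) _.
  rewrite quotientMl ?(subset_trans sED) ?stabN_norm //.
  by rewrite mul_subG // quotientS1 ?sub1G ?subsetIr.
case/negP: (stabN_der i); rewrite -quotient_sub1; last first.
  exact: subset_trans (der_sub _ _) (stabN_norm i).
rewrite quotientR ?stabN_norm //.
apply: subset_trans (commgSS (quo A sAD sDA) (quo B sBD sDB)) _.
have nC (E : {group {perm X}}) : E \subset D -> E \subset 'N(cofactor i).
  by move=> sE; apply: subset_trans sE (stabN_norm i).
by rewrite -quotientR ?nC // quotient_sub1 // comm_subG ?nC.
Qed.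

Lemma kernel_eq i j : K i \subset K j -> K i = K j.
Proof.
move=> sij; apply: val_inj; apply/eqP; rewrite /= eqEsubset sij /= subsetI subsetIl /=.
have nK t : D \subset 'N(K t) by rewrite normsI ?normG ?stabN_norm.
case: (subdirect_dichotomy i (subsetIl D (cofactor j)) (nK j)) => // sD.
case/negP: (stabN_cofactor j); apply: subset_trans sD _.
by rewrite mul_subG ?subsetIr // (subset_trans sij) ?subsetIr.
Qed.

(** The factors on which [D] has the same kernel form a block: [D] is the direct
    product of its projections to the blocks. *)
Let kernels : {set {group {perm X}}} := [set K i | i : 'I_k].
Let r := #|kernels|.
Definition block (j : 'I_r) : {group {perm X}} := enum_val j.

Lemma block_ex j : exists i, block j = K i.
Proof. by have /imsetP[i _ e] : block j \in kernels := enum_valP j; exists i. Qed.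

Lemma block_onto i : exists j, block j = K i.
Proof.
have Ki : K i \in kernels by apply: imset_f.
by exists (enum_rank_in Ki (K i)); rewrite /block enum_rankK_in.
Qed.

Definition block_cofactor j : {group {perm X}} :=
  (N :&: \bigcap_(i | K i == block j) cofactor i)%G.

Lemma block_cofactorP j y :
  reflect (y \in N /\ forall i, K i = block j -> y \in cofactor i) (y \in block_cofactor j).
Proof.
apply: (iffP setIP) => -[Ny h]; split=> //.
  by move=> i e; move/bigcapP: h => /(_ i); rewrite e eqxx; apply.
by apply/bigcapP => i /eqP; apply: h.
Qed.

Lemma block_cofactor_normal j : block_cofactor j <| N.
Proof.
rewrite /normal subsetIl /=; apply/subsetP => n Nn; rewrite inE.
apply/subsetP => _ /imsetP[y /block_cofactorP[Ny h] ->]; apply/block_cofactorP.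
split=> [|i /h]; first by rewrite groupJ.
by rewrite memJ_norm //; have /andP[_ /subsetP] := cofactor_normal i; apply.
Qed.

Lemma kernelJ h : h \in G -> h x0 = x0 ->
  exists al : 'S_k, forall i, cofactor i :^ h = cofactor (al i) /\ K i :^ h = K (al i).
Proof.
move=> Gh hx; have [al alE] := cofactorJ Gh; exists al => i; split=> //.
by rewrite /K /= conjIg alE [in LHS](stabN_conj Gh hx).
Qed.

Lemma block_cofactor_subJ h j j' : h \in G -> h x0 = x0 -> block j :^ h = block j' ->
  block_cofactor j :^ h \subset block_cofactor j'.
Proof.
move=> Gh hx e; have [al alE] := kernelJ Gh hx.
apply/subsetP => _ /imsetP[y /block_cofactorP[Ny H] ->]; apply/block_cofactorP.
split=> [|i' e']; first by rewrite -(NJ Gh) memJ_conjg.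
have [ec eK] := alE (al^-1 i'); rewrite permKV in ec eK.
rewrite -ec memJ_conjg; apply: H; apply: val_inj; apply: (@conjsg_inj _ h) => /=.
by rewrite e -e' -eK.
Qed.

Lemma block_cofactorJ h j j' : h \in G -> h x0 = x0 -> block j :^ h = block j' ->
  block_cofactor j :^ h = block_cofactor j'.
Proof.
move=> Gh hx e; apply/eqP; rewrite eqEsubset block_cofactor_subJ //=.
rewrite -sub_conjgV block_cofactor_subJ ?groupV //; last by rewrite -e conjsgK.
by rewrite -{1}hx permK.
Qed.

Lemma block_cofactor_perm g : g \in G ->
  exists al : 'S_r, forall j, block_cofactor j :^ g = block_cofactor (al j).
Proof.
move=> Gg; have [h [c [Gh Nc hx eg _]]] :=
  prim_factor x0 primG minnormal_nt minnormal_normal Gg.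
have alP j : exists j', block j :^ h = block j'.
  have [i ->] := block_ex j; have [al alE] := kernelJ Gh hx.
  by have [j' e] := block_onto (al i); exists j'; rewrite (alE i).2 e.
have [al alE] := fin_all_exists alP.
have al_inj : injective al.
  move=> j j' e; apply/enum_val_inj/val_inj; apply: (@conjsg_inj _ h) => /=.
  by rewrite -[enum_val j]/(block j) -[enum_val j']/(block j') !alE e.
exists (perm al_inj) => j; rewrite permE eg conjsgM (block_cofactorJ Gh hx (alE j)).
by have /andP[_ /subsetP/(_ c Nc)/normP] := block_cofactor_normal (al j).
Qed.

Lemma block_cofactor_trans j j' :
  exists2 g, g \in G & block_cofactor j :^ g = block_cofactor j'.
Proof.
have [i ei] := block_ex j; have [i' ei'] := block_ex j'.
have [g Gg eg] := cofactor_trans i i'.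
have [h [c [Gh Nc hx egc _]]] := prim_factor x0 primG minnormal_nt minnormal_normal Gg.
exists h => //; apply: block_cofactorJ => //; rewrite ei ei' /K /= conjIg (stabN_conj Gh hx).
rewrite -eg egc conjsgM; congr (_ :&: _).
have [al alE] := kernelJ Gh hx; rewrite (alE i).1.
by have /andP[_ /subsetP/(_ c Nc)/normP] := cofactor_normal (al i).
Qed.

Lemma block_cofactor_crt (n : 'I_r -> {perm X}) : (forall j, n j \in N) ->
  exists2 n0, n0 \in N & forall j, n0 * (n j)^-1 \in block_cofactor j.
Proof.
move=> Nn; have [b bE] := fin_all_exists block_onto.
have [n0 Nn0 n0E] := cofactor_crt (fun i => Nn (b i)).
exists n0 => // j; apply/block_cofactorP; split=> [|i e].
  by rewrite groupM ?groupV.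
have -> : j = b i by apply: enum_val_inj; rewrite -/(block j) -e -bE.
exact: n0E.
Qed.

Lemma kernel_norm i : D \subset 'N(K i).
Proof. by rewrite normsI ?normG ?stabN_norm. Qed.

Lemma block_norm j : D \subset 'N(block j).
Proof. by have [i ->] := block_ex j; apply: kernel_norm. Qed.

Lemma block_sub j : block j \subset D.
Proof. by have [i ->] := block_ex j; apply: subsetIl. Qed.

(** The intersection [L] of the kernels of the other blocks covers [D] modulo the
    kernel of block [j]: otherwise [kernel_prime] would put one of them in it. *)
Lemma stabN_block_crt (d : 'I_r -> {perm X}) : (forall j, d j \in D) ->
  exists2 d0, d0 \in D & forall j, d0 * (d j)^-1 \in block j.
Proof.
apply: crt => [j|j]; first by rewrite /normal block_sub block_norm.
have [i ei] := block_ex j.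
pose L := foldr (fun j' (A : {group {perm X}}) => (block j' :&: A)%G) D.
have sL s : L s \subset D.
  by elim: s => //= j' s IHs; apply: subset_trans (subsetIr _ _) IHs.
have nL s : D \subset 'N(L s).
  by elim: s => [|j' s IHs]; rewrite ?normG //= normsI ?block_norm.
have nLC s : j \notin s -> ~~ (L s \subset cofactor i).
  elim: s => [|j' s IHs]; first by rewrite /= stabN_cofactor.
  rewrite inE negb_or => /andP[jj' js]; apply/negP => sLC.
  have sub : [~: block j', L s] \subset cofactor i.
    apply: subset_trans sLC; rewrite /= subsetI; apply/andP; split.
      by rewrite commg_subl (subset_trans (sL s) (block_norm j')).
    by rewrite commg_subr (subset_trans (block_sub j') (nL s)).
  case: (kernel_prime (block_sub j') (block_norm j') (sL s) (nL s) sub).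
    have [i' ei'] := block_ex j'; rewrite ei' => sK.
    case/eqP: jj'; apply: enum_val_inj; rewrite -/(block j) -/(block j') ei ei'.
    by apply/esym/kernel_eq; rewrite subsetI subsetIl.
  exact/negP/IHs.
pose s := [seq j' <- enum 'I_r | j' != j]; exists (L s); split.
- exact: sL.
- move=> j' jj'; have : j' \in s by rewrite mem_filter jj' mem_enum.
  elim: s {nL nLC sL} => //= j1 s IHs; rewrite inE => /predU1P[<-|/IHs]; first exact: subsetIl.
  exact: subset_trans (subsetIr _ _).
have : j \notin s by rewrite mem_filter eqxx.
move/nLC/negP => nsLC; rewrite ei.
by case: (subdirect_dichotomy i (sL s) (nL s)).
Qed.

(** [block_cofactor j] is the product of the factors outside block [j]. *)
Lemma subdirect_wreath : 1 < r -> wreath_type G.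
Proof.
move=> r1; apply: (cart_family_wreath r1 block_cofactor_normal block_cofactor_perm
                     block_cofactor_trans block_cofactor_crt).
move=> n Nn /(fin_all_exists (P := fun j d => [/\ d \in N, d x0 = x0 & d^-1 * n \in block_cofactor j])).
case=> d dE; have Dd j : d j \in D by have [Nd dx _] := dE j; rewrite stabN_mem Nd dx eqxx.
have [d0 Dd0 d0E] := stabN_block_crt Dd.
have Nd0 := subsetP stabN_sub _ Dd0.
suff : d0^-1 * n = 1.
  move/(canRL (mulKVg d0)); rewrite mulg1 => ->.
  by move: Dd0; rewrite stabN_mem => /andP[_ /eqP].
apply: cofactor_cap => [i|]; last by rewrite groupM ?groupV.
have [j ej] := block_onto i; have [Nd dx /block_cofactorP[_ /(_ i (esym ej)) dn]] := dE j.
have : d0 * (d j)^-1 \in cofactor i.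
  by have := d0E j; rewrite ej => /setIP[].
rewrite -groupV invMg invgK => dd0.
have nC : d j \in 'N(cofactor i).
  by have /andP[_ /subsetP] := cofactor_normal i; apply.
have -> : d0^-1 * n = (d j * d0^-1) ^ d j * ((d j)^-1 * n).
  by rewrite conjgE !mulgA mulVg mul1g mulgK.
by rewrite groupM // memJ_norm.
Qed.

(** With a single block an element of one kernel lies in all cofactors. *)
Lemma subdirect_full : r <= 1 -> forall i d, d \in D -> d \in cofactor i -> d = 1.
Proof.
move=> r1 i d Dd dC; apply: cofactor_cap (subsetP stabN_sub _ Dd) => j.
have eK : K i = K j.
  by apply: (card_le1_eqP r1); apply: imset_f.
have : d \in K i by rewrite inE Dd.
by rewrite eK => /setIP[].
Qed.

End Subdirect.

Section FullDiagonal.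

Hypothesis k_gt1 : 1 < k.
Hypothesis sub_dir : forall i, D * cofactor i = N.
Hypothesis full_diag : forall i d, d \in D -> d \in cofactor i -> d = 1.

Lemma stabN_simple : simple D /\ ~~ abelian D.
Proof.
have i0 : 'I_k := Ordinal (ltnW k_gt1).
have nt : ~~ (D \subset cofactor i0) := stabN_cofactor sub_dir i0.
have K1 : D :&: cofactor i0 = 1.
  apply/trivgP/subsetP => d /setIP[Dd dC]; apply/set1P; exact: full_diag dC.
split; last first.
  apply/negP => /derG1P abD; case/negP: (stabN_der sub_dir i0).
  by rewrite abD sub1G.
apply/simpleP; split=> [|A /andP[sAD nAD]].
  by apply: contraNneq nt => ->; rewrite sub1G.
case: (subdirect_dichotomy sub_dir i0 sAD nAD) => [sAC|sDA]; [left | right].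
  by apply/trivgP; rewrite -K1 subsetI sAD.
rewrite /= in sDA; rewrite K1 mulg1 in sDA.
by apply/eqP; rewrite eqEsubset sAD.
Qed.

(** [phi i n] is the element of [D] with the same [i]-th component as [n]. In this
    way [N] becomes [D^k] with [D] as its diagonal, and the points are the cosets
    of the diagonal. An element of [G] is a conjugation fixing [x0], which permutes
    the components and acts on all of them by one automorphism of [D], followed by
    a translation by an element of [N]. *)
Lemma full_diagonal_type : diagonal_type G.
Proof.
have nt := minnormal_nt; have nNG := minnormal_normal.
have [nu nuE] := trans_section x0 primG nt nNG.
have [phi phiE] : exists phi : 'I_k -> {perm X} -> {perm X}, forall i n, n \in N ->
    phi i n \in D /\ (phi i n)^-1 * n \in cofactor i.
  apply: (fin_all_exists (P := fun i p => forall n : {perm X}, n \in N ->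
     p n \in D /\ (p n)^-1 * n \in cofactor i)) => i.
  apply: (fin_all_exists (P := fun n d => n \in N ->
     d \in D /\ d^-1 * n \in cofactor i)) => n.
  have [Nn|nNn] := boolP (n \in N); last by exists 1.
  have : n \in D * cofactor i by rewrite sub_dir.
  by case/mulsgP => d c Dd Cc ->; exists d => _; rewrite mulKg.
have CN i n : n \in N -> n \in 'N(cofactor i).
  by have /andP[_ /subsetP] := cofactor_normal i; apply.
have DN d : d \in D -> d \in N := subsetP stabN_sub d.
have phi_uniq i n d : n \in N -> d \in D -> d^-1 * n \in cofactor i -> phi i n = d.
  move=> Nn Dd dC; have [Dp pC] := phiE i n Nn.
  have e : (phi i n)^-1 * d = 1.
    apply: (full_diag (i := i)); first by rewrite groupM ?groupV.
    have -> : (phi i n)^-1 * d = (phi i n)^-1 * n * (d^-1 * n)^-1.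
      by rewrite invMg invgK mulgA mulgK.
    by rewrite groupM ?groupV.
  by rewrite -[d](mulKVg (phi i n)) e mulg1.
have phiM i n n' : n \in N -> n' \in N -> phi i (n * n') = phi i n * phi i n'.
  move=> Nn Nn'; have [Dp pC] := phiE i n Nn; have [Dp' pC'] := phiE i n' Nn'.
  apply: phi_uniq; [exact: groupM | exact: groupM |].
  have -> : (phi i n * phi i n')^-1 * (n * n') =
            ((phi i n)^-1 * n) ^ phi i n' * ((phi i n')^-1 * n').
    by rewrite conjgE invMg -!mulgA mulKVg.
  by rewrite groupM // memJ_norm // CN ?DN.
have phiD i d : d \in D -> phi i d = d.
  by move=> Dd; apply: phi_uniq; rewrite ?DN // mulVg group1.
have phiJ i j h n : h \in G -> h x0 = x0 -> n \in N -> cofactor i :^ h = cofactor j ->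
    phi j (n ^ h) = phi i n ^ h.
  move=> Gh hx Nn e; have [Dp pC] := phiE i n Nn; apply: phi_uniq.
  - by rewrite -(NJ Gh) memJ_conjg.
  - by rewrite -(stabN_conj Gh hx) memJ_conjg.
  by rewrite -conjVg -conjMg -e memJ_conjg.
have phi_inj n n' : n \in N -> n' \in N -> (forall i, phi i n = phi i n') -> n = n'.
  move=> Nn Nn' e; apply/eqP; rewrite eq_mulgV1; apply/eqP.
  apply: cofactor_cap => [i|]; last by rewrite groupM ?groupV.
  have [Dp pC] := phiE i n Nn; have [Dp' pC'] := phiE i n' Nn'.
  have -> : n * n'^-1 = ((phi i n)^-1 * n * ((phi i n')^-1 * n')^-1) ^ (phi i n)^-1.
    by rewrite e conjgE invMg !invgK !mulgA mulgV mul1g mulgK.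
  by rewrite memJ_norm ?groupV ?CN ?DN // groupM ?groupV.
have nu_rel n y : n \in N -> n x0 = y -> exists2 d, d \in D & nu y = d * n.
  move=> Nn ny; have [Ny yE] := nuE y; exists (nu y * n^-1); last by rewrite mulgKV.
  by rewrite stabN_mem groupM ?groupV //= permM yE -ny permK.
pose w y : word (subg_of D) k := [ffun i => subg D (phi i (nu y))].
have [simD nabD] := stabN_simple.
have sgw y i : sgval (w y i) = phi i (nu y).
  by rewrite ffunE subgK //; have [Ny _] := nuE y; have [] := phiE i _ Ny.
apply: (diagonal_typeI (w := w) Gmax (subg_nonabelian_simple simD nabD) k_gt1).
- move=> y y' /eqP/diag_coset_eqP[d e].
  have [Ny yE] := nuE y; have [Ny' yE'] := nuE y'; have Dd := subgP d.
  have en : nu y' = sgval d * nu y.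
    have Nd := DN _ Dd.
    apply: phi_inj; [exact: Ny' | exact: groupM |] => i.
    rewrite (phiM _ _ _ Nd Ny) (phiD _ _ Dd).
    by have := congr1 (fun v : word _ _ => sgval (v i)) e; rewrite /= sgw ffunE /= sgw.
  rewrite -yE -yE' en permM.
  by move: Dd; rewrite stabN_mem => /andP[_ /eqP ->].
- move=> t; have [n Nn nE] := cofactor_crt (fun i => DN _ (subgP (t i))).
  exists (n x0); have [d Dd dE] := nu_rel n (n x0) Nn erefl.
  have phit i : phi i n = sgval (t i).
    apply: phi_uniq => //; first exact: subgP.
    have -> : (sgval (t i))^-1 * n = (n * (sgval (t i))^-1) ^ sgval (t i).
      by rewrite conjgE mulgKV.
    by rewrite memJ_norm ?CN ?DN ?subgP.
  rewrite -(diag_coset_lmul (subg D d) t); congr diag_coset; apply/ffunP => i.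
  apply: val_inj; rewrite -[LHS]/(sgval _) -[RHS]/(sgval _) sgw dE.
  rewrite (phiM _ _ _ (DN _ Dd) Nn) (phiD _ _ Dd).
  by rewrite ffunE /= subgK // phit.
move=> g Gg; have [h [c [Gh Nc hx eg gE]]] := prim_factor x0 primG nt nNG Gg.
have nDh : h \in 'N(D) by apply/normP; apply: stabN_conj.
have [al alE] := cofactorJ Gh.
exists (subg_conj D h), [ffun i => subg D (phi i c)], al; split; first exact: subg_conj_Aut.
move=> y; have [Ny yE] := nuE y.
have Nh : nu y ^ h \in N by rewrite -(NJ Gh) memJ_conjg.
have gy : (nu y ^ h * c) x0 = g y by rewrite -gE yE.
have [d Dd dE] := nu_rel _ _ (groupM Nh Nc) gy.
rewrite -(diag_coset_lmul (subg D d) (diag_map _ _ _ _)); congr diag_coset.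
apply/ffunP => i; apply: val_inj; rewrite -[LHS]/(sgval _) -[RHS]/(sgval _) sgw dE.
rewrite (phiM _ _ _ (DN _ Dd) (groupM Nh Nc)) (phiD _ _ Dd) (phiM _ _ _ Nh Nc) !ffunE /= !subgK //; last by have [] := phiE i c Nc.
have Dp : phi (al^-1 i) (nu y) \in D by have [] := phiE (al^-1 i) _ Ny.
rewrite [val (subg_conj _ _ _)]subg_conjE // subgK //; congr (_ * (_ * _)).
by apply: phiJ; rewrite // alE permKV.
Qed.

End FullDiagonal.

Lemma minnormal_composite : 1 < k -> wreath_type G \/ diagonal_type G.
Proof.
move=> k1; case: (wreath_or_subdirect k1) => [|sub_dir]; [by left|].
have [r1|r1] := leqP #|[set (D :&: cofactor i)%G | i : 'I_k]| 1; last first.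
  by left; apply: subdirect_wreath r1.
by right; apply: full_diagonal_type => // i d; apply: subdirect_full.
Qed.

Lemma minnormal_simple : k <= 1 -> simple N.
Proof.
move=> k1; have [/andP[_ nNG] minN'] := mingroupP minN.
have nTG : G \subset 'N(T).
  apply/subsetP => g Gg; apply/normP; apply: (congr1 val (x := (T :^ g)%G) (y := T)).
  have TS : T \in simples by apply: orbit_refl.
  have TgS : (T :^ g)%G \in simples by apply/imsetP; exists g.
  by move/card_le1_eqP: k1 => /(_ _ _ TgS TS).
have [/andP[nT _] minT'] := mingroupP minT.
have <- : T :=: N by apply: minN'; rewrite ?nT.
apply/mingroupP; split; first by rewrite nT normG.
move=> H /andP[ntH nHT] sHT; apply: minT' => //; rewrite ntH.
by have -> : N :=: T by apply/esym/minN'; rewrite ?nT.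
Qed.

End Factors.

(** ** A simple minimal normal subgroup *)

(** The points are the elements of the regular group [N], where [n] stands for the
    coset of [(1, n)]. Conjugations and right translations are diagonal maps. *)
Lemma simple_regular_diagonal : simple N ->
  (forall n : {perm X}, n \in N -> n x0 = x0 -> n = 1) -> diagonal_type G.
Proof.
move=> simN regN; have nt := minnormal_nt; have nNG := minnormal_normal.
have [nu nuE] := trans_section x0 primG nt nNG.
have nu_uniq n y : n \in N -> n x0 = y -> nu y = n.
  move=> Nn ny; have [Ny yE] := nuE y; apply/eqP; rewrite eq_mulgV1; apply/eqP.
  by apply: regN; rewrite ?groupM ?groupV // permM yE -ny permK.
pose w y : word (subg_of N) 2 := [ffun i => if i == ord0 then 1 else subg N (nu y)].
apply: (diagonal_typeI (w := w) Gmax (subg_nonabelian_simple simN nabN)) => //.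
- move=> y y' /eqP/diag_coset_eqP[d /ffunP e].
  have [Ny yE] := nuE y; have [Ny' yE'] := nuE y'.
  have := e ord0; rewrite !ffunE eqxx mulg1 => d1.
  have := e ord_max; rewrite !ffunE /= -d1 mul1g => /(congr1 (@sgval _ _)).
  by rewrite !subgK // => en; rewrite -yE -yE' en.
- move=> t; pose n := (sgval (t ord0))^-1 * sgval (t ord_max).
  have Nn : n \in N by rewrite groupM ?groupV ?subgP.
  exists (n x0); rewrite -(diag_coset_lmul (t ord0)); congr diag_coset.
  apply/ffunP => i; rewrite !ffunE; case: eqP => [->|ni]; first by rewrite mulg1.
  have -> : i = ord_max.
    apply: val_inj; move: ni; case: i => -[|[|//]] //= h [].
    exact: val_inj.
  apply: val_inj; rewrite -[LHS]/(sgval _) /= (nu_uniq n) // subgK //.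
  by rewrite mulKVg.
move=> g Gg; have [h [c [Gh Nc hx eg gE]]] := prim_factor x0 primG nt nNG Gg.
have nNh : h \in 'N(N) by have /andP[_ /subsetP] := nNG; apply.
exists (subg_conj N h), [ffun i => if i == ord0 then 1 else subg N c], 1.
split; first exact: subg_conj_Aut.
move=> y; have [Ny yE] := nuE y; congr diag_coset; apply/ffunP => i.
have NJy : nu y ^ h \in N by rewrite memJ_norm.
rewrite !ffunE invg1 perm1; apply: val_inj.
rewrite -[LHS]/(sgval _) -[RHS]/(sgval _); case: eqP => _ /=.
  by rewrite [val _](subg_conjE _ nNh) /= conj1g mulg1.
have NJc := groupM NJy Nc.
rewrite (nu_uniq (nu y ^ h * c)) //; last by rewrite -gE yE.
by rewrite (subg_conjE _ nNh) !subgK.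
Qed.

(** A group [N] of the order of the alternating group has index 2, so it is the
    alternating group: this is the case that the almost simple type leaves out. *)
Lemma simple_almost_simple : simple N -> 'C_G(N) = 1 -> 4 < #|X| ->
  alternating_type G \/ almost_simple_type G.
Proof.
move=> simN cGN X5; have nNG := minnormal_normal; have [_ nNG'] := andP nNG.
have [cN|cN] := eqVneq #|N| #|'Alt_X|.
  left; suff sAN : 'Alt_X \subset N.
    by apply: max_perm_Alt_sub => //; apply: subset_trans sNG.
  have X2 : 1 < #|X| := leq_trans (isT : 1 < 5) X5.
  apply: normal_Sym_Alt => //; last first.
    by apply: leq_trans (nonabelian_simple_card simN nabN).
  apply: index2_normal; first exact: subsetT.
  apply/eqP; rewrite -(eqn_pmul2l (cardG_gt0 N)) Lagrange ?subsetT //.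
  by rewrite -/('Sym_X) card_Sym -(card_Alt X2) cN mulnC.
right; have conjM : {in G &, {morph subg_conj N : g h / g * h}}.
  by move=> g h Gg Gh; rewrite subg_conjM ?(subsetP nNG').
pose f := Morphism conjM.
exists (subg_of N), (f @* G)%G; split.
- exact: subg_nonabelian_simple.
- apply: contra cN => /card_isog e; rewrite -e cardsT.
  by rewrite -[X in _ == X]cardsT (card_isog (isog_subg N)).
- split.
    apply/subsetP => _ /morphimP[t _ _ ->].
    have Gt : sgval t \in G by rewrite (subsetP sNG) ?subgP.
    rewrite (_ : conj_aut_morphism _ t = f (sgval t)); first exact: mem_morphim.
    apply/permP => x; have tN : t \in 'N([group of [set: subg_of N]]).
      by apply: subsetP (normG _) _ (in_setT t).
    rewrite [LHS](norm_conj_autE tN (in_setT x)).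
    by apply: val_inj; rewrite -[RHS]/(sgval _) /= subg_conjE ?(subsetP nNG').
  apply/subsetP => _ /morphimP[g _ Gg ->].
  by apply: subg_conj_Aut; rewrite (subsetP nNG').
- apply/isogP; exists f => //; apply/injmP => g h Gg Gh e.
  apply/eqP; rewrite eq_mulgV1; apply/eqP.
  suff : g * h^-1 \in 'C_G(N) by rewrite cGN => /set1P.
  rewrite inE groupM ?groupV //=.
  apply/centP => n Nn; apply/commute_sym/commgP/conjg_fixP.
  have := congr1 (fun p : {perm _} => sgval (p (subg N n))) e.
  rewrite /= !subg_conjE ?(subsetP nNG') // subgK // => en.
  by rewrite conjgM en conjgK.
exact: primG.
Qed.

(** A nontrivial centralizer of a simple [N] is a transitive normal subgroup of
    [G], and so [N], which commutes with it, is regular. *)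
Lemma max_primitive_nonabelian : 4 < #|X| ->
  alternating_type G \/ diagonal_type G \/ wreath_type G \/ almost_simple_type G.
Proof.
move=> X5; have nNG := minnormal_normal; have [_ nNG'] := andP nNG.
have [T minT sTN] := minnormal_exists minnormal_nt (normG N).
have [k1|k1] := leqP #|orbit 'JG G T| 1; last first.
  by case: (minnormal_composite minT sTN k1); [right; right; left | right; left].
have simN := minnormal_simple minT sTN k1.
have [c1|ntC] := eqVneq 'C_G(N) 1.
  by case: (simple_almost_simple simN c1 X5); [left | right; right; right].
right; left; apply: (simple_regular_diagonal simN) => n Nn nx.
have nCG : 'C_G(N) <| G.
  by rewrite /normal subsetIl /= normsI ?normG // (subset_trans nNG') ?cent_norm.
apply: (centralizer_semiregular primG ntC nCG _ Nn nx).
by rewrite centsC subsetIr.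
Qed.

End Nonabelian.

(** * The O'Nan-Scott theorem for maximal subgroups *)

Section ONanScott.

Variables (X : finType) (G : {group {perm X}}).
Hypothesis Gmax : max_perm_group G.

(** A minimal normal subgroup of [G] is abelian, or a product of several nonabelian
    simple groups, or simple. *)
Theorem max_primitive_types : [primitive G, on [set: X] | 'P] ->
  alternating_type G \/ affine_type G \/ diagonal_type G \/ wreath_type G \/
  almost_simple_type G.
Proof.
move=> primG; have [X4|X5] := leqP #|X| 4.
  by left; apply: max_primitive_le4.
have [x0 _] : exists x, x \in [set: X].
  by apply/set0Pn; rewrite -card_gt0 cardsT (leq_trans _ X5).
have ntG : G :!=: 1.
  apply/eqP => G1; have [trG _] := andP primG.
  have := atrans_dvd trG; rewrite cardsT G1 cards1 dvdn1 => /eqP e.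
  by rewrite e in X5.
have [N minN sNG] := minnormal_exists ntG (normG G).
have [abN|nabN] := boolP (abelian N).
  by case: (max_primitive_affine Gmax primG minN sNG abN); [left | right; left].
case: (max_primitive_nonabelian x0 Gmax primG minN sNG nabN X5); first by left.
by move=> h; right; right.
Qed.

Theorem max_perm_list_L : list_L G.
Proof.
rewrite /list_L; have [trG|ntr] := boolP [transitive G, on [set: X] | 'P]; last first.
  by case: (max_perm_intransitive Gmax ntr); [right; left | left].
have [primG|nprim] := boolP [primitive G, on [set: X] | 'P]; last first.
  by right; right; left; apply: max_perm_imprimitive.
case: (max_primitive_types primG) => [|h]; first by left.
by right; right; right.
Qed.

End ONanScott.

(** * Permutations of a square grid *)

Lemma sum_ge_outside (A : finType) (k : A -> nat) (D : {set A}) q :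
  (forall i, i \notin D -> q <= k i) ->
  \sum_(i in D) k i + q * (#|A| - #|D|) <= \sum_i k i.
Proof.
move=> h; rewrite [X in _ <= X](bigID (mem D)) /= leq_add2l.
have -> : #|A| - #|D| = #|~: D| by rewrite -(cardsC D) addKn.
rewrite mulnC -sum_nat_const [X in _ <= X](eq_bigl (fun i => i \in ~: D)).
  by apply: leq_sum => i; rewrite inE => /h.
by move=> i; rewrite inE.
Qed.

Lemma exists_outside (A : finType) (D : {set A}) : #|D| < #|A| -> exists a, a \notin D.
Proof.
move=> lt; have : 0 < #|~: D| by rewrite -(ltn_add2l #|D|) cardsC addn0.
by case/card_gt0P=> a; rewrite inE; exists a.
Qed.

(** Rows and columns enter symmetrically: all that is proved for rows is used for
    columns as well, through [transpose]. *)
Record grid (Om A : finType) := Grid {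
  row : Om -> A; col : Om -> A; cell : A -> A -> Om;
  row_cell : forall a b, row (cell a b) = a;
  col_cell : forall a b, col (cell a b) = b;
  cell_row_col : forall x, cell (row x) (col x) = x }.

Definition transpose (Om A : finType) (g : grid Om A) : grid Om A :=
  @Grid Om A (col g) (row g) (fun a b => cell g b a)
    (fun a b => col_cell g b a) (fun a b => row_cell g b a) (cell_row_col g).

Section Rows.

Variables (Om A : finType) (g : grid Om A).
Implicit Types (x y : Om) (a b : A) (v : {perm Om}).

Lemma grid_inj x y : row g x = row g y -> col g x = col g y -> x = y.
Proof. by move=> er ec; rewrite -(cell_row_col g x) er ec cell_row_col. Qed.

Definition row_move_fun (p : {perm A}) x := cell g (p (row g x)) (col g x).

Lemma row_move_inj p : injective (row_move_fun p).
Proof.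
move=> x y e; have := congr1 (row g) e; have := congr1 (col g) e.
by rewrite !row_cell !col_cell => ec /perm_inj er; apply: grid_inj.
Qed.

Definition row_move p : {perm Om} := perm (@row_move_inj p).

Lemma row_row_move p x : row g (row_move p x) = p (row g x).
Proof. by rewrite permE row_cell. Qed.

Lemma col_row_move p x : col g (row_move p x) = col g x.
Proof. by rewrite permE col_cell. Qed.

Lemma row_moveM p q : row_move (p * q) = row_move p * row_move q.
Proof.
by apply/permP => x; apply: grid_inj; rewrite !permM ?row_row_move ?col_row_move // permM.
Qed.

Lemma row_move1 : row_move 1 = 1.
Proof.
by apply/permP => x; rewrite perm1; apply: grid_inj; rewrite ?row_row_move ?col_row_move // perm1.
Qed.

Definition row_swap a b := row_move (tperm a b).

Lemma row_row_swap a b x : row g (row_swap a b x) = tperm a b (row g x).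
Proof. exact: row_row_move. Qed.

Lemma col_row_swap a b x : col g (row_swap a b x) = col g x.
Proof. exact: col_row_move. Qed.

Lemma row_swapK a b x : row_swap a b (row_swap a b x) = x.
Proof. by apply: grid_inj; rewrite ?row_row_swap ?col_row_swap // tpermK. Qed.

Lemma row_swapC a b : row_swap a b = row_swap b a. Proof. by rewrite /row_swap tpermC. Qed.

Lemma row_swap2 a b : row_swap a b * row_swap a b = 1.
Proof. by apply/permP => x; rewrite permM row_swapK perm1. Qed.

Lemma row_swap_fix a b x : row g x != a -> row g x != b -> row_swap a b x = x.
Proof. by move=> xa xb; apply: grid_inj; rewrite ?row_row_swap ?col_row_swap // tpermD // eq_sym. Qed.

Lemma supp_row_swap a b x : a != b -> (x \in supp (row_swap a b)) = (row g x == a) || (row g x == b).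
Proof.
move=> ab; rewrite inE; apply/idP/idP => [|h].
  by apply: contraR; rewrite negb_or => /andP[xa xb]; rewrite row_swap_fix.
apply/eqP => /(congr1 (row g)); rewrite row_row_swap => /eqP.
by case/orP: h => /eqP ->; rewrite ?tpermL ?tpermR; [rewrite eq_sym|]; rewrite (negPf ab).
Qed.

Definition moved_in v a := [set x in supp v | row g x == a].
Definition row_degree v a := #|moved_in v a|.

Lemma moved_inP v a x : reflect (x \in supp v /\ row g x = a) (x \in moved_in v a).
Proof.
have -> : (x \in moved_in v a) = (x \in supp v) && (row g x == a) by rewrite in_set.
by apply: (iffP andP) => -[xv /eqP].
Qed.

Lemma sum_row_degree v : \sum_a row_degree v a = #|supp v|.
Proof.
rewrite -sum1_card (partition_big (row g) predT) //=; apply: eq_bigr => a _.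
by rewrite /row_degree -sum1_card; apply: eq_bigl => x; rewrite !inE.
Qed.

Lemma card_supp_row_swap a b : a != b -> #|supp (row_swap a b)| = (2 * #|A|)%N.
Proof.
move=> ab; pose L d := [set cell g d j | j : A].
have LP d x : (x \in L d) = (row g x == d).
  apply/imsetP/eqP => [[j _ ->]|<-]; first by rewrite row_cell.
  by exists (col g x); rewrite ?cell_row_col.
have cL d : #|L d| = #|A|.
  by rewrite card_imset // => i j /(congr1 (col g)); rewrite !col_cell.
have -> : supp (row_swap a b) = L a :|: L b.
  by apply/setP => x; rewrite supp_row_swap // inE !LP.
rewrite cardsU !cL (_ : L a :&: L b = set0) ?cards0 ?subn0 ?mul2n ?addnn //.
apply/setP => x; rewrite !inE !LP; apply/negP => /andP[/eqP -> ].
by rewrite (negPf ab).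
Qed.

(** ** The commutator of a row transposition with a permutation *)

Definition overlap v a b := moved_in v a :|: moved_in v b.
(** The commutator of an involution with [v]. Its support is small when [v] moves
    few points in the rows [a] and [b]. *)
Definition zcom v a b := row_swap a b * row_swap a b ^ v.
(** An explicit set containing the support of [zcom v a b]. *)
Definition zsupp v a b := overlap v a b :|: row_swap a b @: overlap v a b :|: v @: overlap v a b.

Lemma overlapP v a b x :
  (x \in overlap v a b) = (x \in supp v) && ((row g x == a) || (row g x == b)).
Proof. by rewrite in_setU !in_set andb_orr. Qed.

Lemma overlapE v a b : a != b -> overlap v a b = supp v :&: supp (row_swap a b).
Proof. by move=> ab; apply/setP => x; rewrite overlapP in_setI supp_row_swap. Qed.

Lemma zcomE v a b x : zcom v a b x = v (row_swap a b (v^-1 (row_swap a b x))).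
Proof. by rewrite permM conjgE !permM. Qed.

Lemma mem_overlap_row_swap v a b x : a != b -> x \in supp v -> x \notin overlap v a b ->
  row_swap a b x = x.
Proof.
move=> ab xv; rewrite overlapP xv negb_or /= => /andP[xa xb].
exact: row_swap_fix.
Qed.

(** Outside the overlap of the two supports, [v] and the transposition do not
    interact. *)
Lemma supp_zcom v a b : a != b -> supp (zcom v a b) \subset zsupp v a b.
Proof.
move=> ab; apply/subsetP => x; rewrite inE => zx.
have invol y : row_swap a b (row_swap a b y) = y := row_swapK a b y.
have XE y : (y \in overlap v a b) = (y \in supp v) && (y \in supp (row_swap a b)).
  by rewrite overlapE // in_setI.
have [xX|xX] := boolP (x \in overlap v a b); first by rewrite /zsupp 2!in_setU xX.
have vV w : v w = w -> v^-1 w = w by move=> {1}<-; rewrite permK.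
have [tx|tx] := eqVneq (row_swap a b x) x.
  suff wX : v^-1 x \in overlap v a b.
    have := imset_f v wX; rewrite permKV => h.
    by rewrite /zsupp in_setU h orbT.
  move: zx; rewrite zcomE tx => zx; rewrite XE !inE permKV; apply/andP; split.
    by apply: contraNneq zx => e; rewrite -e tx {1}e permKV.
  by apply: contra zx => /eqP ->; rewrite permKV.
have xv : v x = x.
  by apply/supp0P; apply: contra xX => xv; rewrite XE xv inE.
suff yX : row_swap a b x \in overlap v a b.
  have := imset_f (row_swap a b) yX; rewrite invol => h.
  by rewrite /zsupp 2!in_setU h orbT.
rewrite XE supp_perm [x \in _]inE tx andbT; apply: contraR zx => /supp0P yv.
by rewrite zcomE (vV _ yv) invol xv.
Qed.

(** Commuting permutations preserve each other's supports. *)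
Lemma zcom1_stable v a b x : a != b -> zcom v a b = 1 -> x \in overlap v a b ->
  row_swap a b x \in overlap v a b /\ v x \in overlap v a b.
Proof.
move=> ab z1; have tv : row_swap a b ^ v = row_swap a b.
  by rewrite -[LHS]mul1g -(row_swap2 a b) -mulgA -/(zcom v a b) z1 mulg1.
have vt y : v (row_swap a b y) = row_swap a b (v y) by rewrite -{2}tv permJ.
rewrite overlapE // !inE => /andP[xv xt]; split; rewrite !(inj_eq perm_inj) ?xv ?xt ?andbT.
  by rewrite vt (inj_eq perm_inj).
by rewrite /= -vt (inj_eq perm_inj).
Qed.

Lemma zcom1_commute v a b x : zcom v a b = 1 -> v (row_swap a b x) = row_swap a b (v x).
Proof.
move=> z1; have tv : row_swap a b ^ v = row_swap a b.
  by rewrite -[LHS]mul1g -(row_swap2 a b) -mulgA -/(zcom v a b) z1 mulg1.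
by rewrite -{2}tv permJ.
Qed.

Lemma card_overlap v a b : a != b -> #|overlap v a b| = row_degree v a + row_degree v b.
Proof.
move=> ab; rewrite cardsU (_ : moved_in v a :&: moved_in v b = set0) ?cards0 ?subn0 //.
apply/setP => x; rewrite !inE; apply/negP => /andP[/andP[_ /eqP ->] /andP[_]].
by rewrite (negPf ab).
Qed.

Lemma card_zsupp v a b : a != b -> #|zsupp v a b| <= 3 * (row_degree v a + row_degree v b).
Proof.
move=> ab; rewrite -card_overlap // mulSn mul2n -addnn addnA.
apply: leq_trans (leq_card_setU _ _) _; apply: leq_add; last exact: leq_imset_card.
by apply: leq_trans (leq_card_setU _ _) _; rewrite leq_add2l leq_imset_card.
Qed.

Lemma row_degree0 v a x : row_degree v a = 0 -> row g x = a -> v x = x.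
Proof.
move/eqP; rewrite cards_eq0 => /eqP e xa; apply/supp0P/negP => xv.
by have := in_set0 x; rewrite -e; case/moved_inP.
Qed.

Lemma row_degree_gt0 v a : 0 < row_degree v a -> exists2 x, x \in supp v & row g x = a.
Proof. by case/card_gt0P => x /moved_inP[]; exists x. Qed.

Lemma row_degree_pos v x : x \in supp v -> 0 < row_degree v (row g x).
Proof. by move=> xv; apply/card_gt0P; exists x; apply/moved_inP. Qed.

Lemma row_degree1_uniq v a x y : row_degree v a = 1%N -> x \in supp v -> y \in supp v ->
  row g x = a -> row g y = a -> x = y.
Proof.
move/eqP/cards1P => [z e] xv yv xa ya.
have /set1P -> : x \in [set z] by rewrite -e; apply/moved_inP.
by have /set1P -> : y \in [set z] by rewrite -e; apply/moved_inP.
Qed.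

End Rows.

Section RowsInGroup.

Variables (Om A : finType) (g : grid Om A) (G : {group {perm Om}}).
Hypothesis A5 : 4 < #|A|.
Hypothesis row_swapG : forall a b, row_swap g a b \in G.
Hypothesis no3 : ~~ has_c3 G.
Implicit Types (x y : Om) (a b : A) (v : {perm Om}).

Local Notation row_degree := (row_degree g).

Lemma zcomG v a b : v \in G -> zcom g v a b \in G.
Proof. by move=> Gv; rewrite groupM ?groupJ. Qed.

(** The transposition of the two rows and [v] have one moved point in common. *)
Lemma untouched_once v a b : v \in G -> row_degree v a = 0 -> row_degree v b <> 1%N.
Proof.
move=> Gv ka kb; case/negP: no3; have ab : a != b.
  by apply/eqP => e; rewrite e kb in ka.
have /eqP/cards1P[x e] := kb.
apply: (overlap1_has_c3 (v := v) (w := row_swap g a b) (x := x)) => //.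
rewrite -overlapE // /overlap e.
have /eqP := ka; rewrite cards_eq0 => /eqP ->.
by rewrite set0U.
Qed.

Lemma zcom_untouched v a b : row_degree v a = 0 -> 0 < row_degree v b -> zcom g v a b != 1.
Proof.
move=> ka /row_degree_gt0[x xv xb]; apply/eqP => z1; have ab : a != b.
  by apply/eqP => e; have := row_degree0 ka; rewrite e => /(_ x xb); apply/suppP.
have xX : x \in overlap g v a b by rewrite overlapP xv xb eqxx orbT.
have [] := zcom1_stable ab z1 xX; rewrite overlapP => /andP[tv _] _.
have := row_degree0 ka (x := row_swap g a b x); rewrite row_row_swap xb tpermR => /(_ erefl).
exact/suppP.
Qed.

(** If they commute, [v] preserves the overlap, and the transposition maps the
    moved points of row [c] to those of row [a]. *)
Lemma zcom_once v a c x : x \in supp v -> row g x = a -> row_degree v a = 1%N ->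
  a != c -> 0 < row_degree v c -> row g (v x) != c \/ row_degree v c != 1%N -> zcom g v a c != 1.
Proof.
move=> xv xa ka ac kc h; apply/eqP => z1.
have xX : x \in overlap g v a c by rewrite overlapP xv xa eqxx.
case: h => [rc|kc1].
  have [_] := zcom1_stable ac z1 xX; rewrite overlapP supp_perm xv (negPf rc) orbF /=.
  move/eqP => ra; have e : v x = x by apply: (row_degree1_uniq ka); rewrite ?supp_perm.
  by move/suppP: xv.
have inj y : y \in moved_in g v c -> y = row_swap g a c x.
  case/moved_inP => yv yc; rewrite -[y](row_swapK g a c); congr (row_swap g a c _).
  have yX : y \in overlap g v a c by rewrite overlapP yv yc eqxx orbT.
  have [] := zcom1_stable ac z1 yX; rewrite overlapP => /andP[tv _] _.
  by apply: (row_degree1_uniq ka) => //; rewrite row_row_swap yc tpermR.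
case/eqP: kc1; apply/eqP; rewrite eqn_leq kc andbT.
by apply/card_le1_eqP => y y' /inj -> /inj ->.
Qed.

Section MinimalDegree.

Variable s : nat.
Hypothesis s_min : forall v, v \in G -> v != 1 -> s <= #|supp v|.

Lemma zcom_bound v a b : v \in G -> a != b -> zcom g v a b != 1 -> s <= #|zsupp g v a b|.
Proof.
move=> Gv ab nz; apply: leq_trans (s_min (zcomG a b Gv) nz) _.
exact: subset_leq_card (supp_zcom g v ab).
Qed.

Lemma zcom_bound3 v a b : v \in G -> a != b -> zcom g v a b != 1 ->
  s <= 3 * (row_degree v a + row_degree v b).
Proof. by move=> Gv ab nz; apply: leq_trans (zcom_bound Gv ab nz) (card_zsupp g v ab). Qed.

Lemma untouched_bound v a b : v \in G -> row_degree v a = 0 -> 0 < row_degree v b -> s <= 3 * row_degree v b.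
Proof.
move=> Gv ka kb; have ab : a != b by apply: contraTneq kb => <-; rewrite ka.
by have := zcom_bound3 Gv ab (zcom_untouched ka kb); rewrite ka.
Qed.

Definition touched v := [set a | 0 < row_degree v a].

Lemma touchedE v a : (a \in touched v) = (0 < row_degree v a). Proof. by rewrite inE. Qed.

Lemma sum_touched v : \sum_(a in touched v) row_degree v a = #|supp v|.
Proof.
rewrite -(sum_row_degree g) [RHS](bigID (mem (touched v))) /= [X in _ + X]big1 ?addn0 // => a.
by rewrite inE -eqn0Ngt => /eqP.
Qed.

(** As some row is not moved, every moved row contains at least a third of the
    moved points. *)
Lemma untouched_le3 v a : v \in G -> 0 < s -> #|supp v| = s -> row_degree v a = 0 ->
  #|touched v| <= 3.
Proof.
move=> Gv s0 vs ka; have : \sum_(b in touched v) s <= 3 * s.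
  rewrite -[in X in _ <= X]vs -sum_touched big_distrr /=.
  by apply: leq_sum => b; rewrite inE; apply: untouched_bound ka.
by rewrite sum_nat_const leq_pmul2r.
Qed.

(** If all rows are moved, a row [a] with one moved point can be paired with a row
    having at most two, so that the commutator is not trivial and has degree at most
    9. Without such an [a] the bound on [s] leaves exactly two points to each row. *)
Lemma row_cases v : v \in G -> #|supp v| = s -> 9 < s -> s <= 2 * #|A| ->
  #|touched v| <= 3 \/ (s = (2 * #|A|)%N /\ forall a, row_degree v a = 2).
Proof.
move=> Gv vs s10 s2m; have s0 : 0 < s by apply: leq_ltn_trans s10.
have [/existsP[a /eqP ka]|/existsPn all1] := boolP [exists a, row_degree v a == 0].
  by left; apply: untouched_le3 ka.
have k0 a : 0 < row_degree v a by rewrite lt0n all1.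
have total := sum_row_degree g v; rewrite vs in total.
have [/existsP[a /eqP ka]|/existsPn none1] := boolP [exists a, row_degree v a == 1%N]; last first.
  right; have k2 a : 2 <= row_degree v a.
    by case: (row_degree v a) (k0 a) (none1 a) => [|[|]].
  have es : s = (2 * #|A|)%N.
    apply/eqP; rewrite eqn_leq s2m -total /= mulnC -sum_nat_const.
    by apply: leq_sum => a _; apply: k2.
  split=> // a; apply/eqP; rewrite eqn_leq k2 andbT leqNgt; apply/negP => k3.
  have := sum_ge_outside (k := row_degree v) (D := [set a]) (q := 2) (fun i _ => k2 i).
  by rewrite big_set1 cards1 total es; lia.
have [x xv xa] := row_degree_gt0 (k0 a).
have small (D : {set A}) : #|D| <= 2 -> exists2 c, c \notin D & row_degree v c <= 2.
  move=> D2; have [/exists_inP //|/exists_inPn h] := boolP [exists (c | c \notin D), row_degree v c <= 2].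
  have := sum_ge_outside (k := row_degree v) (D := D) (q := 3).
  rewrite total => H; have {}H : \sum_(i in D) row_degree v i + 3 * (#|A| - #|D|) <= s.
    by apply: H => i iD; rewrite ltnNge h.
  have : #|D| <= \sum_(i in D) row_degree v i.
    by rewrite -sum1_card; apply: leq_sum => i _; apply: k0.
  lia.
have once c : a != c -> row_degree v c <= 2 -> (row_degree v c == 2) || (row g (v x) != c) -> False.
  move=> ac kc h; have nz : zcom g v a c != 1.
    apply: (zcom_once xv xa ka ac (k0 c)).
    by case/orP: h => [/eqP ->|]; [right | left].
  by have := zcom_bound3 Gv ac nz; rewrite ka; lia.
have [|b] := small [set a]; first by rewrite cards1.
rewrite inE eq_sym => ab kb.
have [kb2|kb2] := eqVneq (row_degree v b) 2; first by case: (once b ab kb); rewrite kb2 eqxx.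
have [rb|rb] := eqVneq (row g (v x)) b; last by case: (once b ab kb); rewrite rb orbT.
have [|c] := small [set a; b]; first by rewrite cards2 ab.
rewrite !inE negb_or => /andP[ca cb] kc; rewrite eq_sym in ca.
by case: (once c ca kc); rewrite rb [b == c]eq_sym cb orbT.
Qed.

End MinimalDegree.

Lemma row_moveG p : row_move g p \in G.
Proof.
have [ts -> _] := prod_tpermP p; elim: ts => [|t ts IHts].
  by rewrite big_nil row_move1.
by rewrite big_cons row_moveM groupM // row_swapG.
Qed.

End RowsInGroup.

(** Five points allow to move away the at most two other points of [B]. *)
Lemma perm_avoid (A : finType) (B : {set A}) b : 4 < #|A| -> #|B| <= 3 -> b \in B ->
  exists2 p : {perm A}, p b = b & forall b', b' \in B -> p b' \in B -> b' = b.
Proof.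
move=> A5 B3 Bb; have [e1 e1B] : exists e, e \notin B.
  by apply: exists_outside; apply: leq_ltn_trans B3 _; apply: leq_trans A5.
have [e2] : exists e, e \notin e1 |: B.
  by apply: exists_outside; rewrite cardsU1 e1B; apply: leq_ltn_trans A5.
rewrite !inE negb_or => /andP[e21 e2B].
have nb e : e \notin B -> forall c, c \in B -> e != c.
  by move=> eB c cB; apply: contraNneq eB => ->.
have [/eqP B1|] := eqVneq (B :\ b) set0.
  exists 1; rewrite ?perm1 // => b' b'B _; apply/eqP; move: B1; apply: contraTT => b'b.
  by apply/set0Pn; exists b'; rewrite !inE b'b.
case/set0Pn => b1; rewrite !inE => /andP[b1b b1B].
have B1 : #|B :\ b :\ b1| <= 1.
  move: B3; rewrite (cardsD1 b) Bb (cardsD1 b1) !inE b1b b1B.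
  by rewrite !add1n !ltnS.
have [/eqP B2|] := eqVneq (B :\ b :\ b1) set0.
  exists (tperm b1 e1); first by rewrite tpermD // nb.
  move=> b' b'B; have [->|b'b1] := eqVneq b' b1; first by rewrite tpermL (negPf e1B).
  move=> _; apply/eqP; move: B2; apply: contraTT => b'b.
  by apply/set0Pn; exists b'; rewrite !inE b'b b'b1.
case/set0Pn => b2 b2D; move: (b2D); rewrite !inE => /and3P[b21 b2b b2B].
exists (tperm b1 e1 * tperm b2 e2).
  by rewrite permM ![tperm _ _ b]tpermD // nb.
move=> b' b'B; have [->|b'b1] := eqVneq b' b1.
  by rewrite permM tpermL tpermD ?(negPf e1B) // eq_sym nb.
have [->|b'b2] := eqVneq b' b2.
  by rewrite permM [tperm b1 e1 b2]tpermD ?tpermL ?(negPf e2B) // 1?eq_sym // eq_sym nb.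
move=> _; have [//|b'b] := eqVneq b' b.
case/eqP: b'b2; apply: (card_le1_eqP B1) => //.
by rewrite !inE b'b1 b'b.
Qed.

Section GridGroup.

Variables (Om A : finType) (g : grid Om A) (G : {group {perm Om}}).
Hypothesis A5 : 4 < #|A|.
Hypothesis rowG : forall a b, row_swap g a b \in G.
Hypothesis colG : forall a b, row_swap (transpose g) a b \in G.
Hypothesis no3 : ~~ has_c3 G.
Implicit Types (x y : Om) (a b c d e j l : A) (v : {perm Om}).

(** The support of such a permutation meets that of a conjugate by permutations of
    the rows and of the columns in a single point, by [perm_avoid]. *)
Lemma small_box v : v \in G -> v != 1 ->
  #|touched g v| <= 3 -> #|touched (transpose g) v| <= 3 -> False.
Proof.
move=> Gv nt R3 C3; case/negP: no3.
have /set0Pn[x xv] : supp v != set0 by rewrite supp_eq1.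
have tr y : y \in supp v -> row g y \in touched g v.
  by rewrite touchedE; apply: row_degree_pos.
have tc y : y \in supp v -> col g y \in touched (transpose g) v.
  by rewrite touchedE; exact: (row_degree_pos (transpose g)).
have [p px pB] := perm_avoid A5 R3 (tr x xv).
have [q qx qB] := perm_avoid A5 C3 (tc x xv).
pose w := row_move g p * row_move (transpose g) q.
have rw y : row g (w y) = p (row g y).
  by rewrite permM -[row g _]/(col (transpose g) _) col_row_move /= row_row_move.
have cw y : col g (w y) = q (col g y).
  by rewrite permM -[col g _]/(row (transpose g) _) row_row_move /= col_row_move.
have Gw : w \in G by rewrite groupM // row_moveG.
have wx : w x = x by apply: (grid_inj (g := g)); rewrite ?rw ?cw.
apply: (overlap1_has_c3 (v := v) (w := v ^ w) (x := x)); rewrite ?groupJ //.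
apply/setP => y; rewrite in_setI in_set1 suppJ; apply/andP/eqP => [[yv /imsetP[z zv e]]|->].
  have rz : row g z = row g x by apply: pB (tr z zv) _; rewrite -rw -e tr.
  have cz : col g z = col g x by apply: qB (tc z zv) _; rewrite -cw -e tc.
  by rewrite e (grid_inj rz cz) wx.
by split=> //; rewrite -{1}wx imset_f.
Qed.

Lemma row_swap_transpose2 a b : row_swap (transpose (transpose g)) a b \in G.
Proof.
suff -> : row_swap (transpose (transpose g)) a b = row_swap g a b by [].
by apply/permP => x; rewrite !permE.
Qed.

Section MinimalDegree.

Variable s : nat.
Hypothesis s_min : forall v, v \in G -> v != 1 -> s <= #|supp v|.
Hypothesis s2m : s <= 2 * #|A|.

Section LargeDegree.

Hypothesis s10 : 9 < s.

Let s_gt0 : 0 < s. Proof. exact: leq_ltn_trans s10. Qed.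

Lemma supp_min_neq1 v : #|supp v| = s -> v != 1.
Proof.
by rewrite -supp_eq1 -cards_eq0 => ->; rewrite -lt0n.
Qed.

(** The overlap and its translate lie in two columns and in the rows moved by [v]. *)
Lemma zsupp_col_bound v j l : j != l ->
  #|zsupp (transpose g) v j l| <= 2 * #|touched g v| + 4 \/
  #|overlap (transpose g) v j l| != 4.
Proof.
move=> jl; have [Y4|] := eqVneq #|overlap (transpose g) v j l| 4; [left | by right].
apply: leq_trans (leq_card_setU _ _) _; apply: leq_add; last first.
  by rewrite -Y4 leq_imset_card.
have -> : (2 * #|touched g v|)%N = #|setX (touched g v) [set j; l]|.
  by rewrite cardsX cards2 jl mulnC.
rewrite -(card_in_imset (f := fun x => (row g x, col g x))); last first.
  by move=> x y _ _ [er ec]; apply: grid_inj er ec.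
have Yok x : x \in overlap (transpose g) v j l ->
    (row g x \in touched g v) /\ col g x \in [set j; l].
  rewrite overlapP => /andP[xv xc]; rewrite touchedE row_degree_pos //.
  by rewrite in_set2.
apply/subset_leq_card/subsetP => _ /imsetP[x xY ->]; rewrite in_setX /=.
move: xY; rewrite in_setU => /orP[/Yok[-> ->] //|/imsetP[y /Yok[yr yc] ->]].
rewrite -[row g (row_swap _ _ _ y)]/(col (transpose g) _) col_row_swap /= yr /=.
rewrite -[col g (row_swap _ _ _ y)]/(row (transpose g) _) row_row_swap /=.
move: yc; rewrite !in_set2 => /orP[] /eqP ->; rewrite ?tpermL ?tpermR eqxx ?orbT //.
Qed.

(** Otherwise the commutator has degree at most 10 by [zsupp_col_bound]. Hence
    [s = 10] and [v] moves three rows, with at least four moved points in each. *)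
Lemma rows3_cols2_commute v j l : v \in G -> #|supp v| = s ->
  #|touched g v| <= 3 -> (forall j, row_degree (transpose g) v j = 2) -> j != l ->
  zcom (transpose g) v j l = 1.
Proof.
move=> Gv vs R3 C2 jl; apply/eqP; apply: contraT => nz.
have := zcom_bound colG s_min Gv jl nz.
case: (zsupp_col_bound v jl) => [b|]; last by rewrite card_overlap // !C2.
move=> sb; have : s <= 10 by apply: leq_trans sb (leq_trans b _); lia.
move=> s10'; have es : s = 10 by apply/eqP; rewrite eqn_leq s10'.
have R2 : 2 < #|touched g v| by lia.
have [a aT] : exists a, a \notin touched g v.
  by apply: exists_outside; apply: leq_ltn_trans R3 _; apply: leq_trans A5.
rewrite touchedE -eqn0Ngt in aT.
have : \sum_(b in touched g v) 4 <= s.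
  rewrite -vs -(sum_touched g); apply: leq_sum => c; rewrite touchedE => kc.
  by have := untouched_bound rowG s_min Gv (eqP aT) kc; lia.
by rewrite sum_nat_const; lia.
Qed.

(** If [v] maps [x] to another column, exchange that column with a third one. *)
Lemma commute_col v : (forall j l, j != l -> zcom (transpose g) v j l = 1) ->
  forall x, col g (v x) = col g x.
Proof.
move=> h x; apply/eqP; apply: contraT => ne.
have [l] : exists l, l \notin [set col g x; col g (v x)].
  apply: exists_outside; apply: leq_trans A5; rewrite ltnS.
  by apply: leq_trans (leq_card_setU _ _) _; rewrite !cards1.
rewrite !inE negb_or => /andP[lx lvx]; rewrite eq_sym in lvx.
have := zcom1_commute x (h _ _ lvx); rewrite (row_swap_fix (g := transpose g)); first last.
- by rewrite /= eq_sym.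
- by rewrite /= eq_sym.
move/(congr1 (row (transpose g))); rewrite row_row_swap /= tpermL => e.
by rewrite e eqxx in lvx.
Qed.

Lemma row2P v a : row_degree g v a = 2 -> exists p p',
  [/\ p \in supp v, p' \in supp v, row g p = a, row g p' = a & p != p'] /\
  forall x, x \in supp v -> row g x = a -> x = p \/ x = p'.
Proof.
rewrite /row_degree => /eqP/cards2P[p [p' [pp' e]]]; exists p, p'.
have /moved_inP[pv pa] : p \in moved_in g v a by rewrite e !inE eqxx.
have /moved_inP[pv' pa'] : p' \in moved_in g v a by rewrite e !inE eqxx orbT.
split=> // x xv xa; have : x \in moved_in g v a by apply/moved_inP.
by rewrite e in_set2 => /orP[] /eqP; [left | right].
Qed.

Lemma row2_cases v p p' x : row_degree g v (row g p) = 2 -> p \in supp v -> p' \in supp v ->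
  row g p' = row g p -> p != p' -> x \in supp v -> row g x = row g p -> x = p \/ x = p'.
Proof.
move=> k2 pv pv' pa pp' xv xa; have [q [q' [[qv qv' qa qa' qq'] cases]]] := row2P k2.
case: (cases p pv erefl) => e; case: (cases p' pv' pa) => e';
  case: (cases x xv xa) => ex; subst; rewrite ?eqxx in pp'; by [left | right | ].
Qed.

End LargeDegree.

End MinimalDegree.

End GridGroup.

(** ** Minimal degree at least ten *)

Lemma setU_card_disjoint (X : finType) (A B : {set X}) x :
  #|A| + #|B| <= #|A :|: B| -> x \in B -> x \notin A.
Proof.
rewrite cardsU leq_subRL ?cardsU ?leq_subr; last first.
  by apply: leq_trans (subset_leq_card (subsetIl A B)) (leq_addr _ _).
rewrite -[X in _ <= X]add0n leq_add2r leqn0 cards_eq0 => /eqP AB xB.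
by apply/negP => xA; have := in_set0 x; rewrite -AB in_setI xA xB.
Qed.

Section GridGroup.

Variables (Om A : finType) (g : grid Om A) (G : {group {perm Om}}).
Hypothesis A5 : 4 < #|A|.
Hypothesis rowG : forall a b, row_swap g a b \in G.
Hypothesis colG : forall a b, row_swap (transpose g) a b \in G.
Hypothesis no3 : ~~ has_c3 G.
Implicit Types (x y : Om) (a b c d e j l : A) (v : {perm Om}).

Section MinimalDegree.

Variable s : nat.
Hypothesis s_min : forall v, v \in G -> v != 1 -> s <= #|supp v|.
Hypothesis s2m : s <= 2 * #|A|.

Section LargeDegree.

Hypothesis s10 : 9 < s.

(** The commutator [z] exchanges [p] with [q] and [v p] with [v q]. So [z * z] moves
    at most six of the at most ten points of [zsupp], but it is not trivial, since
    [z] maps [p'] to [v p'] and [v p'] to the translate of [p']. *)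
Lemma share_one_false v p p' q q' : v \in G ->
  row_degree g v (row g p) = 2 -> row_degree g v (row g q) = 2 -> row g p != row g q ->
  [/\ p \in supp v, p' \in supp v, q \in supp v & q' \in supp v] ->
  row g p' = row g p -> p != p' -> row g q' = row g q -> q != q' ->
  col g p = col g q -> col g p' != col g q' -> False.
Proof.
move=> Gv ka kb ab [pv pv' qv qv'] pa pp' qb qq' cpq cpq'.
have ca := row2_cases ka pv pv' pa pp'; have cb := row2_cases kb qv qv' qb qq'.
pose t := row_swap g (row g p) (row g q); pose X := overlap g v (row g p) (row g q).
have tK y : t (t y) = y by apply: row_swapK.
have tp : t p = q by apply: (grid_inj (g := g)); rewrite ?row_row_swap ?col_row_swap ?tpermL.
have tq : t q = p by rewrite -tp tK.
have XE : X = [set p; p'; q; q'].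
  apply/setP => x; rewrite /X overlapP !in_setU !in_set1 -!orbA; apply/andP/idP => [[xv /orP[]/eqP e]|].
  - by case: (ca x xv e) => ->; rewrite eqxx ?orbT.
  - by case: (cb x xv e) => ->; rewrite eqxx ?orbT.
  by case/or4P=> /eqP ->; rewrite ?pv ?pv' ?qv ?qv' ?pa ?qb !eqxx ?orbT.
have [Xp Xp' Xq] : [/\ p \in X, p' \in X & q \in X].
  by rewrite XE !inE !eqxx ?orbT.
have nT : t p' \notin supp v.
  apply/negP => tv; have rt : row g (t p') = row g q by rewrite row_row_swap pa tpermL.
  have ct : col g (t p') = col g p' by rewrite col_row_swap.
  case: (cb _ tv rt) => e; rewrite e in ct.
    by case/eqP: pp'; apply: (grid_inj (g := g)); rewrite ?pa // cpq.
  by rewrite ct eqxx in cpq'.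
have vT : v (t p') = t p' by apply/supp0P.
have vVT : v^-1 (t p') = t p' by rewrite -{1}vT permK.
have nz : zcom g v (row g p) (row g q) != 1.
  apply/eqP => /(zcom1_stable ab)/(_ Xp') []; rewrite overlapP -/t => /andP[tv _].
  by rewrite tv in nT.
set z := zcom g v (row g p) (row g q) in nz.
have sz := zcom_bound rowG s_min Gv ab nz.
pose XT := X :|: t @: X.
have cX : #|X| = 4 by rewrite card_overlap // ka kb.
have cXT : #|XT| <= 6.
  have sub : XT \subset [set p; p'; q; q'; t p'; t q'].
    apply/subsetP => x /setUP[|/imsetP[y yX ->]].
      by rewrite XE !in_setU !in_set1 -!orbA => /or4P[] -> ; rewrite ?orbT.
    move: yX; rewrite XE !in_setU !in_set1 -!orbA.
    by case/or4P=> /eqP ->; rewrite ?tp ?tq eqxx ?orbT.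
  apply: leq_trans (subset_leq_card sub) _.
  by rewrite -!setUA !cardsU1 cards1; do !case: (_ \notin _).
have cvX : #|v @: X| = 4 by rewrite (card_imset _ perm_inj).
have nvX x : x \in X -> v x \notin XT.
  move=> xX; apply: (setU_card_disjoint (B := v @: X)); last exact: imset_f.
  by rewrite cvX; apply: leq_trans (leq_add cXT (leqnn 4)) (leq_trans s10 sz).
have nvX' x : x \in X -> v x \notin X.
  by move=> /nvX; apply: contra => h; rewrite in_setU h.
have XvS x : x \in X -> x \in supp v by rewrite overlapP => /andP[].
have tvx x : x \in X -> t (v x) = v x.
  by move=> xX; apply: (mem_overlap_row_swap (v := v) ab); rewrite ?supp_perm ?XvS ?nvX'.
have tvV x : x \in X -> t (v^-1 x) = v^-1 x.
  move=> xX; apply: (mem_overlap_row_swap (v := v) ab); first by rewrite -supp_perm permKV XvS.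
  by apply: contraL xX => /nvX'; rewrite permKV.
have zE x : z x = v (t (v^-1 (t x))) by apply: zcomE.
have zp : z p = q by rewrite zE tp tvV // permKV.
have zq : z q = p by rewrite zE tq tvV // permKV.
have zvp : z (v p) = v q by rewrite zE tvx // permK tp.
have zvq : z (v q) = v p by rewrite zE tvx // permK tq.
have zp' : z p' = v p' by rewrite zE vVT tK.
have zvp' : z (v p') = t p' by rewrite zE tvx // permK vT.
have nz2 : z * z != 1.
  apply/eqP => /(congr1 (fun w : {perm Om} => w p')); rewrite permM zp' zvp' perm1 => e.
  by rewrite e pv' in nT.
have Gz2 : z * z \in G by rewrite groupM // zcomG.
pose F := [set p; q; v p; v q].
have cF : #|F| = 4.
  have npv x y : x \in X -> y \in X -> x != v y.
    by move=> xX yX; apply: contraTneq xX => ->; apply: nvX'.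
  have pq : p != q by apply: contraNneq ab => ->.
  rewrite /F -!setUA !cardsU1 cards1 !in_setU !in_set1 !negb_or (inj_eq perm_inj) pq.
  by rewrite !npv.
have sF : F \subset zsupp g v (row g p) (row g q).
  apply/subsetP => x /setUP[/setUP[/setUP[]|]|] /set1P ->; rewrite /zsupp.
  - by apply/setUP; left; apply/setUP; left.
  - by apply/setUP; left; apply/setUP; left.
  - by apply/setUP; right; apply: imset_f.
  - by apply/setUP; right; apply: imset_f.
have sub2 : supp (z * z) \subset zsupp g v (row g p) (row g q) :\: F.
  apply/subsetP => x xz; rewrite in_setD; apply/andP; split.
    apply: contraL xz => Fx; apply/supp0P; rewrite permM; move: Fx.
    by move=> /setUP[/setUP[/setUP[]|]|] /set1P ->; rewrite ?zp ?zq ?zvp ?zvq ?zp ?zq ?zvp ?zvq.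
  apply: (subsetP (supp_zcom g v ab)); apply: contraTT xz => /supp0P e.
  by apply/supp0P; rewrite permM !e.
have := leq_trans (s_min Gz2 nz2) (subset_leq_card sub2).
rewrite cardsD (setIidPr sF) cF leqNgt ltn_subLR; last by rewrite -cF subset_leq_card.
case/negP; apply: leq_ltn_trans (leq_card_setU _ _) _; rewrite cvX.
apply: leq_ltn_trans (leq_add cXT (leqnn 4)) _.
by rewrite -[6 + 4]/(4 + 6) ltn_add2l; apply: leq_trans s10.
Qed.

Definition disjoint_columns v a c :=
  forall x y, x \in supp v -> y \in supp v -> row g x = a -> row g y = c -> col g x != col g y.

Lemma disj_col_inj v a c : disjoint_columns v a c -> {in overlap g v a c &, injective (col g)}.
Proof.
move=> dj x y; rewrite !overlapP => /andP[xv xac] /andP[yv yac] e.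
case/orP: xac => /eqP xa; case/orP: yac => /eqP ya.
- by apply: (grid_inj (g := g)); rewrite ?xa.
- by have := dj x y xv yv xa ya; rewrite e eqxx.
- by have := dj y x yv xv ya xa; rewrite e eqxx.
by apply: (grid_inj (g := g)); rewrite ?xa.
Qed.

(** The commutator [z] is not trivial and has degree at most 12, so [s = 12] and [z]
    has minimal degree too. It moves points in four columns; by [row_cases] it
    moves two points in each column, and in the columns of the overlap these are the
    points of the overlap and of its translate. *)
Lemma disj_rows_away v a c p : v \in G -> 12 <= s -> a != c -> disjoint_columns v a c ->
  row_degree g v a = 2 -> row_degree g v c = 2 -> p \in overlap g v a c ->
  s = 12 /\ forall x, x \in overlap g v a c -> col g (v p) != col g x.
Proof.
move=> Gv s12 ac dj ka kc pX; set X := overlap g v a c in pX *.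
pose t := row_swap g a c.
have XP x : x \in X -> x \in supp v /\ ((row g x == a) || (row g x == c)).
  by rewrite /X overlapP => /andP[].
have tX x : x \in X -> t x \notin X.
  move=> xX; apply/negP => tX; have e : col g (t x) = col g x by apply: col_row_swap.
  have /esym tx := disj_col_inj dj tX xX e.
  have /suppP[] : x \in supp t; last exact: esym.
  by rewrite supp_row_swap //; case: (XP x xX).
have nz : zcom g v a c != 1.
  by apply/eqP => /(zcom1_stable ac)/(_ pX)[/(negP (tX p pX))].
set z := zcom g v a c in nz; have Gz : z \in G by apply: zcomG.
have cX : #|X| = 4 by rewrite card_overlap // ka kc.
have cU : #|zsupp g v a c| <= 12 by apply: leq_trans (card_zsupp g v ac) _; rewrite ka kc.
have sz : #|supp z| <= #|zsupp g v a c| by apply: subset_leq_card (supp_zcom g v ac).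
have ssz := s_min Gz nz.
have es : s = 12 by apply/eqP; rewrite eqn_leq s12 andbT; apply: leq_trans ssz (leq_trans sz cU).
have zs : #|supp z| = s.
  by apply/eqP; rewrite eqn_leq ssz andbT es; apply: leq_trans sz cU.
have zU : supp z = zsupp g v a c by apply/eqP; rewrite eqEcard supp_zcom // zs es.
split=> // x xX; apply/negP => /eqP e.
have colX : #|col g @: X| = 4 by rewrite card_in_imset //; apply: disj_col_inj.
case: (row_cases (g := transpose g) (G := G) A5 colG no3 s_min Gz zs s10 s2m) => [T3|[_ k2]].
  have : 4 <= #|touched (transpose g) z|.
    rewrite -colX; apply/subset_leq_card/subsetP => _ /imsetP[y yX ->].
    rewrite touchedE; apply: (row_degree_pos (transpose g)).
    by rewrite zU; apply/setUP; left; apply/setUP; left.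
  by rewrite leqNgt ltnS T3.
have vp : v p \notin X :|: t @: X.
  apply: (setU_card_disjoint (B := v @: X)); last exact: imset_f.
  rewrite -/(zsupp g v a c) -zU zs es (card_imset _ perm_inj) cX -[12]/(8 + 4) leq_add2r.
  by apply: leq_trans (leq_card_setU _ _) _; rewrite (card_imset _ perm_inj) cX.
have := k2 (col g x); rewrite /row_degree.
have : [set x; t x; v p] \subset moved_in (transpose g) z (col g x).
  apply/subsetP => y yin; apply/moved_inP; rewrite zU.
  case/setUP: yin => [/setUP[]|] /set1P ->.
  - by split=> //; apply/setUP; left; apply/setUP; left.
  - split; last exact: (col_row_swap g).
    by apply/setUP; left; apply/setUP; right; apply: imset_f.
  by split; last exact: e; apply/setUP; right; apply: imset_f.
move/subset_leq_card => h k; rewrite k in h; move: h.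
rewrite -setUA !cardsU1 cards1 !in_setU !in_set1.
have -> : x == t x = false by apply/eqP => tx; have := tX x xX; rewrite -tx xX.
have -> : x == v p = false.
  by apply/eqP => xe; move: vp; rewrite -xe in_setU xX.
have -> // : t x == v p = false.
by apply/eqP => xe; move: vp; rewrite -xe in_setU imset_f ?orbT.
Qed.

(** By [share_one_false], a row sharing a column with row [a] shares both, and a
    column has only two moved points. *)
Lemma row_mate v a : v \in G -> (forall b, row_degree g v b = 2) ->
  (forall j, row_degree (transpose g) v j = 2) ->
  exists b, forall c, c != a -> c != b -> disjoint_columns v a c.
Proof.
move=> Gv R2 C2; have [p [p' [[pv pv' pa pa' pp'] cp]]] := row2P (R2 a).
have : exists q, forall x, x \in supp v -> col g x = col g p -> x = p \/ x = q.
  have [q1 [q2 [[q1v q2v q1c q2c q12] cq]]] := row2P (C2 (col g p)).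
  case: (cq p pv erefl) => e.
    by exists q2 => x xv xc; rewrite e; apply: cq.
  by exists q1 => x xv xc; rewrite e; case: (cq x xv xc); [right | left].
case=> q cq; exists (row g q) => c ca cb x y xv yv xa yc; apply/eqP => e.
have npc w : w \in supp v -> row g w = c -> col g w <> col g p.
  move=> wv wc /(cq w wv)[] ew; subst w; first by rewrite -wc pa eqxx in ca.
  by rewrite -wc eqxx in cb.
case: (cp x xv xa) => ex; subst x; first exact: (npc y yv yc (esym e)).
have [q1 [q2 [[q1v q2v q1c q2c q12] cq12]]] := row2P (R2 c).
have [y' [yv' yc' yy']] : exists y', [/\ y' \in supp v, row g y' = c & y != y'].
  by case: (cq12 y yv yc) => ->; [exists q2 | exists q1; rewrite eq_sym].
apply: (share_one_false (v := v) (p := p') (p' := p) (q := y) (q' := y') Gv) => //.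
- by rewrite pa' yc eq_sym.
- by rewrite pa' pa.
- by rewrite eq_sym.
- by rewrite yc yc'.
by apply/eqP => e'; apply: (npc y' yv' yc').
Qed.

(** There are three rows with pairwise disjoint columns. By [disj_rows_away] the degree
    is 12, so there are only six columns, and none of them is left for the image of
    a moved point of row [a]. *)
Lemma rows2_cols2_false v : v \in G -> s = (2 * #|A|)%N -> (forall b, row_degree g v b = 2) ->
  (forall j, row_degree (transpose g) v j = 2) -> False.
Proof.
move=> Gv es R2 C2; have /card_gt0P[a _] : 0 < #|A| by apply: leq_ltn_trans A5.
have [b hb] := row_mate a Gv R2 C2.
have [c] : exists c, c \notin [set a; b].
  by apply: exists_outside; rewrite cards2; apply: leq_ltn_trans A5; case: (_ != _).
rewrite in_set2 negb_or => /andP[ca cb].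
have [d hd] := row_mate c Gv R2 C2.
have [e] : exists e, e \notin [set a; b] :|: [set c; d].
  apply: exists_outside; apply: leq_ltn_trans A5; apply: leq_trans (leq_card_setU _ _) _.
  by rewrite !cards2; do !case: (_ != _).
rewrite in_setU !in_set2 !negb_or => /andP[/andP[ea eb] /andP[ec ed]].
have Dac := hb c ca cb; have Dae := hb e ea eb; have Dce := hd e ec ed.
rewrite eq_sym in ca; rewrite eq_sym in ea; rewrite eq_sym in ec.
pose D := col g @: overlap g v a c :|: col g @: moved_in g v e.
have cD : #|D| = 6.
  rewrite cardsU card_in_imset ?card_overlap ?R2 //; last exact: disj_col_inj.
  rewrite card_in_imset; last first.
    move=> x y /moved_inP[_ xe] /moved_inP[_ ye] exy; apply: (grid_inj (g := g)) => //.
    by rewrite xe.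
  rewrite -/(row_degree g v e) R2 (_ : _ :&: _ = set0) ?cards0 //.
  apply/setP => j; rewrite in_setI in_set0; apply/negP => /andP[].
  case/imsetP => x; rewrite overlapP => /andP[xv xac] -> /imsetP[y /moved_inP[yv ye]] /eqP.
  apply/negP; case/orP: xac => /eqP xr; [exact: Dae | exact: Dce].
have m6 : 6 <= #|A| by rewrite -cD max_card.
have s12 : 12 <= s by rewrite es -[12]/(2 * 6)%N leq_mul2l.
have [p pv pa] : exists2 p, p \in supp v & row g p = a by apply: row_degree_gt0; rewrite R2.
have pX q : p \in overlap g v a q by rewrite overlapP pv pa eqxx.
have [s_12 awc] := disj_rows_away Gv s12 ca Dac (R2 a) (R2 c) (pX c).
have [_ awe] := disj_rows_away Gv s12 ea Dae (R2 a) (R2 e) (pX e).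
have DA : D = [set: A].
  apply/eqP; rewrite eqEcard subsetT cD cardsT -(leq_pmul2l (m := 2)) //.
  by rewrite -es s_12.
have : col g (v p) \in D by rewrite DA in_setT.
case/setUP => /imsetP[x xX ev].
  by have := awc x xX; rewrite ev eqxx.
case/moved_inP: xX => xv xe; have := awe x; rewrite overlapP xv xe eqxx orbT ev eqxx.
by move/(_ isT).
Qed.

End LargeDegree.

End MinimalDegree.

End GridGroup.

Section LargeDegree.

Variables (Om A : finType) (g : grid Om A) (G : {group {perm Om}}) (s : nat).
Hypothesis A5 : 4 < #|A|.
Hypothesis rowG : forall a b, row_swap g a b \in G.
Hypothesis colG : forall a b, row_swap (transpose g) a b \in G.
Hypothesis no3 : ~~ has_c3 G.
Hypothesis s_min : forall v : {perm Om}, v \in G -> v != 1 -> s <= #|supp v|.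
Hypothesis s2m : s <= 2 * #|A|.

(** Of the combinations of [row_cases] for rows and for columns, only the mixed ones
    are possible. *)
Lemma large_degree_preserves (v : {perm Om}) : 9 < s -> v \in G -> #|supp v| = s ->
  s = (2 * #|A|)%N /\
  ((forall x, col g (v x) = col g x) \/ (forall x, row g (v x) = row g x)).
Proof.
move=> s10 Gv vs; have nt : v != 1 := supp_min_neq1 s10 vs.
have R := row_cases A5 rowG no3 s_min Gv vs s10 s2m.
have C := row_cases (g := transpose g) A5 colG no3 s_min Gv vs s10 s2m.
case: R => [R3|[es R2]]; case: C => [C3|[es' C2]].
- by case: (small_box A5 rowG colG no3 Gv nt R3 C3).
- split=> //; left; apply: (commute_col A5) => j l; exact: rows3_cols2_commute s10 _ _ _ Gv vs R3 C2.
- split=> //; right; apply: (commute_col (g := transpose g) A5) => j l.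
  apply: rows3_cols2_commute s10 _ _ _ Gv vs C3 _ => //.
  by move=> a b; apply: row_swap_transpose2.
by case: (rows2_cols2_false A5 rowG colG no3 s_min s2m s10 Gv es R2 C2).
Qed.

End LargeDegree.

(** ** Rows with a single moved point *)

Section Ones.

Variables (Om A : finType) (g : grid Om A) (G : {group {perm Om}}).
Hypothesis A5 : 4 < #|A|.
Hypothesis rowG : forall a b, row_swap g a b \in G.
Hypothesis no3 : ~~ has_c3 G.
Implicit Types (x y : Om) (a b c d e j l : A) (v : {perm Om}).

Lemma row_degree1 v a x : x \in supp v -> row g x = a ->
  (forall y, y \in supp v -> row g y = a -> y = x) -> row_degree g v a = 1%N.
Proof.
move=> xv xa u; apply/eqP/cards1P; exists x; apply/setP => y; rewrite in_set1.
by apply/moved_inP/eqP => [[yv ya]|->]; [apply: u|].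
Qed.

(** Were there four moved rows, that of [x] would have [x] as its only moved point,
    while some other row is not moved, against [untouched_once]. *)
Lemma two_rows_two_points v a c x y : v \in G ->
  (forall w, w \in supp v -> [\/ row g w = a, row g w = c, w = x | w = y]) ->
  #|touched g v| <= 3.
Proof.
move=> Gv h; have sub : touched g v \subset [set a; c; row g x; row g y].
  apply/subsetP => b; rewrite touchedE => /row_degree_gt0[w wv <-]; rewrite !in_setU !in_set1.
  by case: (h w wv) => ->; rewrite eqxx ?orbT.
have c3 (u1 u2 u3 : A) : #|[set u1; u2; u3]| <= 3.
  by rewrite -setUA !cardsU1 cards1; do !case: (_ \notin _).
have [d dT] : exists d, d \notin touched g v.
  apply: exists_outside; apply: leq_ltn_trans (subset_leq_card sub) _.
  apply: leq_ltn_trans A5.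
  by rewrite -!setUA !cardsU1 cards1; do !case: (_ \notin _).
have [xT|xT] := boolP (row g x \in touched g v); last first.
  apply: leq_trans (c3 a c (row g y)); apply/subset_leq_card/subsetP => b bT.
  have := subsetP sub b bT; rewrite !in_setU !in_set1 -!orbA => /or4P[]/eqP e; subst.
  - by rewrite eqxx.
  - by rewrite eqxx orbT.
  - by rewrite bT in xT.
  by rewrite eqxx !orbT.
have [xin|xout] := boolP (row g x \in [set a; c; row g y]).
  apply: leq_trans (c3 a c (row g y)); apply/subset_leq_card/subsetP => b bT.
  have := subsetP sub b bT; rewrite !in_setU !in_set1 -!orbA => /or4P[]/eqP e; subst.
  - by rewrite eqxx.
  - by rewrite eqxx orbT.
  - by move: xin; rewrite !in_setU !in_set1 -!orbA.
  by rewrite eqxx !orbT.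
rewrite touchedE -eqn0Ngt in dT; case: (untouched_once rowG no3 (b := row g x) Gv (eqP dT)).
rewrite touchedE in xT; have [w wv wx] := row_degree_gt0 xT.
move: xout; rewrite !in_setU !in_set1 !negb_or -!andbA => /and3P[xa xc xy].
have uw z : z \in supp v -> row g z = row g x -> z = x.
  move=> zv zx; case: (h z zv) => // e.
  - by rewrite -zx e eqxx in xa.
  - by rewrite -zx e eqxx in xc.
  by rewrite -zx e eqxx in xy.
by apply: (row_degree1 wv wx) => z zv zx; rewrite (uw z) // (uw w).
Qed.

End Ones.

Section OnesInGroup.

Variables (Om A : finType) (g : grid Om A) (G : {group {perm Om}}).
Hypothesis A5 : 4 < #|A|.
Hypothesis rowG : forall a b, row_swap g a b \in G.
Hypothesis colG : forall a b, row_swap (transpose g) a b \in G.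
Hypothesis no3 : ~~ has_c3 G.
Implicit Types (x y : Om) (a b c d e j l : A) (v : {perm Om}).

(** Otherwise the commutator is not trivial. It moves at most [x], [y], their
    translates and their images, so that by [two_rows_two_points] it is confined
    to three rows and three columns, against [small_box]. *)
Lemma ones_swapped v x y : v \in G -> x \in supp v -> y \in supp v ->
  row_degree g v (row g x) = 1%N -> row_degree g v (row g y) = 1%N -> row g x != row g y ->
  col g x = col g y /\ v x = y.
Proof.
move=> Gv xv yv kx ky xy; set a := row g x; set c := row g y; pose t := row_swap g a c.
have ux w : w \in supp v -> row g w = a -> w = x.
  by move=> wv wa; apply: (row_degree1_uniq kx).
have uy w : w \in supp v -> row g w = c -> w = y.
  by move=> wv wa; apply: (row_degree1_uniq ky).
have xX : x \in overlap g v a c by rewrite overlapP xv eqxx.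
have [z1|nz] := eqVneq (zcom g v a c) 1.
  have [] := zcom1_stable xy z1 xX; rewrite !overlapP => /andP[tv _].
  have e : t x = y by apply: uy; rewrite // row_row_swap tpermL.
  case/andP=> vv /orP[]/eqP vr; first by have /suppP[] := xv; apply: ux.
  by split; [rewrite -e col_row_swap | apply: uy].
have UE w : w \in supp (zcom g v a c) ->
    [\/ w \in [set x; y], w \in [set t x; t y], w = v x | w = v y].
  have XE u : u \in overlap g v a c -> u = x \/ u = y.
    by rewrite overlapP => /andP[uv /orP[]/eqP ur]; [left; apply: ux | right; apply: uy].
  move/(subsetP (supp_zcom g v xy)) => /setUP[/setUP[]|].
  - by case/XE => ->; constructor 1; rewrite in_set2 eqxx ?orbT.
  - by case/imsetP => u /XE[] -> ->; constructor 2; rewrite in_set2 eqxx ?orbT.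
  by case/imsetP => u /XE[] -> ->; [constructor 3 | constructor 4].
have Gz : zcom g v a c \in G by apply: zcomG.
case: (small_box A5 rowG colG no3 Gz nz).
  apply: (two_rows_two_points (a := a) (c := c) (x := v x) (y := v y) A5 rowG no3 Gz) => w /UE[].
  - by case/set2P => ->; [constructor 1 | constructor 2].
  - by case/set2P => ->; rewrite row_row_swap ?tpermL ?tpermR; [constructor 2 | constructor 1].
  - by constructor 3.
  by constructor 4.
apply: (two_rows_two_points (g := transpose g) (a := col g x) (c := col g y) (x := v x) (y := v y)
  A5 colG no3 Gz) => w /UE[].
- by case/set2P => ->; [constructor 1 | constructor 2].
- by case/set2P => ->; [constructor 1 | constructor 2]; apply: (col_row_swap g).
- by constructor 3.
by constructor 4.
Qed.

Definition ones v := [set a | row_degree g v a == 1%N].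

Lemma onesP v a : reflect (row_degree g v a = 1%N) (a \in ones v).
Proof. by rewrite in_set; apply: eqP. Qed.

(** By [ones_swapped], [v] maps the point of one such row to that of any other. *)
Lemma ones_le2 v : v \in G -> #|ones v| <= 2.
Proof.
move=> Gv; rewrite leqNgt; apply/negP => /card_gt2P[a [b [c [[/onesP a1 /onesP b1 /onesP c1]]]]].
case=> ab bc ca; have get d : row_degree g v d = 1%N -> exists2 x, x \in supp v & row g x = d.
  by move=> d1; apply: row_degree_gt0; rewrite d1.
have [[x xv xa] [y yv yb] [z zv zc]] := And3 (get a a1) (get b b1) (get c c1).
subst a b c; have [_ e] := ones_swapped Gv xv yv a1 b1 ab.
rewrite eq_sym in ca; have [_ e'] := ones_swapped Gv xv zv a1 c1 ca.
by move: bc; rewrite -e -e' eqxx.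
Qed.

End OnesInGroup.

(** ** Minimal degree at most nine *)

Section SmallDegree.

Variables (Om A : finType) (g : grid Om A) (G : {group {perm Om}}) (s : nat).
Hypothesis A5 : 4 < #|A|.
Hypothesis rowG : forall a b, row_swap g a b \in G.
Hypothesis colG : forall a b, row_swap (transpose g) a b \in G.
Hypothesis no3 : ~~ has_c3 G.
Hypothesis s_min : forall v : {perm Om}, v \in G -> v != 1 -> s <= #|supp v|.
Hypothesis s_gt0 : 0 < s.
Implicit Types (x y : Om) (a b c d e j l : A) (v : {perm Om}).

Lemma touched_all v : v \in G -> #|supp v| = s ->
  #|touched g v| <= 3 \/ (forall a, 0 < row_degree g v a).
Proof.
move=> Gv vs; have [/existsP[a /eqP ka]|/existsPn h] := boolP [exists a, row_degree g v a == 0].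
  by left; apply: (untouched_le3 rowG s_min Gv s_gt0 vs ka).
by right=> a; rewrite lt0n h.
Qed.

Lemma ones_sum v : (forall a, 0 < row_degree g v a) ->
  #|ones g v| + 2 * (#|A| - #|ones g v|) <= #|supp v|.
Proof.
move=> k0; rewrite -(sum_row_degree g v).
rewrite (leq_trans _ (sum_ge_outside (D := ones g v) (q := 2) _)) //.
  rewrite leq_add2r -sum1_card; apply: leq_sum => a _; exact: k0.
by move=> a; case: (onesP g v a) => // ka _; case: (row_degree g v a) (k0 a) ka => [|[|]].
Qed.

Lemma one_two_zcom v a c : v \in G -> a != c -> row_degree g v a = 1%N -> row_degree g v c = 2 ->
  s <= #|zsupp g v a c| /\ zcom g v a c != 1.
Proof.
move=> Gv ac ka kc; have [x xv xa] : exists2 x, x \in supp v & row g x = a.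
  by apply: row_degree_gt0; rewrite ka.
have nz : zcom g v a c != 1.
  by apply: (zcom_once xv xa ka ac); rewrite kc //; right.
by split=> //; exact: (zcom_bound rowG s_min Gv ac nz).
Qed.

(** The commutator [z] has degree 9, so the overlap, its translate and its image
    under [v] are disjoint sets of three points. Besides [a] and [c], [z] moves a
    single row, by [ones_le2] and [untouched_le3], and this row contains the whole
    image. Thus there are two columns [e] and [f] in each of which [z] moves only one
    point, which lies in the image; as [z] maps these points to the translate of the
    overlap, it does not exchange them, against [ones_swapped]. *)
Lemma degree9_false v : v \in G -> #|supp v| = s -> s = 9 -> #|A| = 5 ->
  forall a c, a != c -> row_degree g v a = 1%N -> row_degree g v c = 2 -> False.
Proof.
move=> Gv vs s9 m5 a c ac ka kc; have [sU nz] := one_two_zcom Gv ac ka kc.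
set z := zcom g v a c in nz; set X := overlap g v a c; set t := row_swap g a c.
have Gz : z \in G by apply: zcomG.
have cX : #|X| = 3 by rewrite card_overlap // ka kc.
have sz := s_min Gz nz; have zs := subset_leq_card (supp_zcom g v ac).
have U9 : #|zsupp g v a c| = s.
  apply/eqP; rewrite eqn_leq sU andbT s9.
  by apply: leq_trans (card_zsupp g v ac) _; rewrite ka kc.
have zs9 : #|supp z| = s by apply/eqP; rewrite eqn_leq sz andbT -U9.
have zU : supp z = zsupp g v a c.
  by apply/eqP; rewrite eqEcard {1}/z supp_zcom // U9 zs9 leqnn.
have ctX : #|t @: X| = 3 by rewrite (card_imset _ perm_inj).
have cvX : #|v @: X| = 3 by rewrite (card_imset _ perm_inj).
have nvX w : w \in v @: X -> w \notin X :|: t @: X.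
  apply: setU_card_disjoint; rewrite -/(zsupp g v a c) U9 s9 cvX -[9]/(6 + 3) leq_add2r.
  by apply: leq_trans (leq_card_setU _ _) _; rewrite cX ctX.
have ntX w : w \in t @: X -> w \notin X.
  apply: setU_card_disjoint; rewrite cX ctX -(leq_add2r 3) -[in X in _ <= X]cvX.
  by rewrite -[3 + 3 + 3]s9 -U9 leq_card_setU.
have XP w : w \in X -> w \in supp v /\ ((row g w == a) || (row g w == c)).
  by rewrite /X overlapP => /andP[].
have vXrow w : w \in v @: X -> row g w != a /\ row g w != c.
  move=> wvX; case/imsetP: (wvX) => x /XP[xv _] ew.
  move: (nvX w wvX); rewrite in_setU negb_or => /andP[wX _].
  by move: wX; rewrite /X overlapP ew supp_perm xv -ew negb_or => /andP[].
have zX w : w \in X -> w \in supp z by move=> wX; rewrite zU; apply/setUP; left; apply/setUP; left.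
have ztX w : w \in t @: X -> w \in supp z.
  by move=> wX; rewrite zU; apply/setUP; left; apply/setUP; right.
have zvX w : w \in v @: X -> w \in supp z by move=> wX; rewrite zU; apply/setUP; right.
have rac : #|[set a; c]| = 2 by rewrite cards2 ac.
have tXrow w : w \in t @: X -> (row g w == a) || (row g w == c).
  by case/imsetP => u /XP[_ ur] ->; rewrite row_row_swap; case/orP: ur => /eqP ->;
     rewrite ?tpermL ?tpermR eqxx ?orbT.
have kac : row_degree g z a + row_degree g z c = 6.
  rewrite -card_overlap //.
  have -> : overlap g z a c = X :|: t @: X.
    apply/setP => w; rewrite overlapP in_setU; apply/andP/orP => [[wz wr]|].
      move: wz; rewrite zU => /setUP[/setUP[]|/vXrow[wa wc]]; [by left | by right |].
      by move: wr; rewrite (negPf wa) (negPf wc).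
    by case=> wX; split; [apply: zX | case: (XP w wX) | apply: ztX | apply: tXrow].
  by rewrite cardsU (_ : X :&: _ = set0) ?cards0 ?cX ?ctX //; apply/setP => w;
    rewrite in_setI in_set0; apply/negP => /andP[wX /ntX]; rewrite wX.
have [xa xav xaa] : exists2 x, x \in supp v & row g x = a by apply: row_degree_gt0; rewrite ka.
have [xc xcv xcc] : exists2 x, x \in supp v & row g x = c by apply: row_degree_gt0; rewrite kc.
have aT : a \in touched g z.
  by rewrite touchedE -xaa row_degree_pos // zX // /X overlapP xav xaa eqxx.
have cT : c \in touched g z.
  by rewrite touchedE -xcc row_degree_pos // zX // /X overlapP xcv xcc eqxx orbT.
case: (touched_all Gz zs9) => [R3|R]; last first.
  have := ones_le2 A5 rowG colG no3 Gz; apply/negP; rewrite -ltnNge.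
  have sub : ~: [set a; c] \subset ones g z.
    apply/subsetP => b; rewrite in_setC => bac; apply/onesP/eqP.
    rewrite eqn_leq R andbT leqNgt; apply/negP => kb.
    have := sum_ge_outside (k := row_degree g z) (D := b |: [set a; c]) (q := 1%N) (fun i _ => R i).
    rewrite sum_row_degree zs9 s9 cardsU1 bac rac m5 big_setU1 //= big_setU1 ?inE //= big_set1 kac.
    by rewrite -[9]/(1 + 6 + 2) leqNgt ltn_add2r ltn_add2r kb.
  apply: leq_trans (subset_leq_card sub).
  by rewrite -(ltn_add2l #|[set a; c]|) cardsC rac m5.
case: (small_box A5 rowG colG no3 Gz nz R3).
rewrite leqNgt; apply/negP => C4.
have vXone w w' : w \in v @: X -> w' \in v @: X -> row g w = row g w'.
  move=> wX wX'; apply/eqP; apply: contraTT R3 => ne; rewrite -ltnNge.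
  have -> : 4 = #|row g w |: (row g w' |: [set a; c])|.
    have [wa wc] := vXrow w wX; have [wa' wc'] := vXrow w' wX'.
    rewrite cardsU1 cardsU1 rac !in_setU !in_set1; by rewrite (negPf ne) (negPf wa) (negPf wc) (negPf wa') (negPf wc').
  apply/subset_leq_card/subsetP => b; rewrite !in_setU !in_set1 => /or4P[]/eqP -> //.
    by rewrite touchedE row_degree_pos ?zvX.
  by rewrite touchedE row_degree_pos ?zvX.
have Call j : 0 < row_degree (transpose g) z j.
  rewrite lt0n; apply/negP => /eqP kj; move: C4; apply/negP; rewrite -leqNgt.
  by exact: (untouched_le3 colG s_min Gz s_gt0 zs9 kj).
have new j : j \notin col g @: X -> exists x, [/\ x \in X, col g (v x) = j & row_degree (transpose g) z j = 1%N].
  move=> jX; have nX u : u \in supp z -> col g u = j -> u \in v @: X.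
    rewrite zU => /setUP[/setUP[uX uj|/imsetP[x xX ->]]|//].
      by rewrite -uj imset_f in jX.
    by move=> ej; rewrite col_row_swap in ej; rewrite -ej imset_f in jX.
  have [w wz wj] := row_degree_gt0 (Call j).
  have wvX := nX w wz wj; case/imsetP: (wvX) => x xX ew.
  exists x; split; rewrite // -?ew //; apply: (row_degree1 wz wj) => u uz uj.
  by apply: (grid_inj (g := g)); [apply: (vXone u w (nX u uz uj) wvX) | exact: etrans uj (esym wj)].
have cX3 : #|col g @: X| <= 3 by rewrite -cX leq_imset_card.
have [e eX] : exists e, e \notin col g @: X.
  by apply: exists_outside; apply: leq_ltn_trans cX3 _; rewrite m5.
have [f] : exists f, f \notin e |: (col g @: X).
  by apply: exists_outside; rewrite cardsU1 eX m5 add1n ltnS.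
rewrite in_setU1 negb_or => /andP[fe fX].
have [x [xX xe ke]] := new e eX; have [y [yX yf kf]] := new f fX.
have zvx : z (v x) = t x.
  have [xa' xc'] := vXrow _ (imset_f v xX).
  rewrite zcomE (row_swap_fix xa' xc') permK; apply/supp0P.
  apply: contraNN (ntX _ (imset_f t xX)) => tv.
  by rewrite /X overlapP tv tXrow // imset_f.
have := ones_swapped (g := transpose g) A5 colG (row_swap_transpose2 rowG) no3 Gz (zvX _ (imset_f v xX)) (zvX _ (imset_f v yX)).
rewrite /= xe yf eq_sym zvx => /(_ ke kf fe)[_ e1].
have := nvX _ (imset_f v yX); rewrite -e1 in_setU imset_f ?orbT //.
Qed.

Lemma card_zsupp7 v a c : a != c -> row_degree g v a = 1%N -> row_degree g v c = 2 ->
  #|overlap g v a c :|: row_swap g a c @: overlap g v a c| <= 4 \/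
  (exists y, v @: overlap g v a c \subset y |: overlap g v a c) ->
  #|zsupp g v a c| <= 7.
Proof.
move=> ac ka kc; set X := overlap g v a c; set t := row_swap g a c.
have cX : #|X| = 3 by rewrite card_overlap // ka kc.
have ctX : #|t @: X| = 3 by rewrite (card_imset _ perm_inj).
have cvX : #|v @: X| = 3 by rewrite (card_imset _ perm_inj).
case=> [h|[y sub]].
  apply: leq_trans (leq_card_setU _ _) _; rewrite cvX -[7]/(4 + 3) leq_add2r.
  exact: h.
have : zsupp g v a c \subset y |: (X :|: t @: X).
  apply/subsetP => w /setUP[wX|wvX]; first by apply/setUP; right.
  apply/setUP; case/setUP: (subsetP sub w wvX) => wX; [by left | right].
  by apply/setUP; left.
move/subset_leq_card/leq_trans; apply; rewrite cardsU1.
apply: (leq_trans (leq_add (leq_b1 _) (leq_card_setU _ _))).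
by rewrite cX ctX.
Qed.

End SmallDegree.

Section SmallDegreeEnd.

Variables (Om A : finType) (g : grid Om A) (G : {group {perm Om}}) (s : nat).
Hypothesis A5 : 4 < #|A|.
Hypothesis rowG : forall a b, row_swap g a b \in G.
Hypothesis colG : forall a b, row_swap (transpose g) a b \in G.
Hypothesis no3 : ~~ has_c3 G.
Hypothesis s_min : forall v : {perm Om}, v \in G -> v != 1 -> s <= #|supp v|.
Hypothesis s_gt0 : 0 < s.
Implicit Types (x y : Om) (a b c d e j l : A) (v : {perm Om}).

(** Some nontrivial commutator has degree at most 7. If there is a column without
    moved points, at most two columns have some, so the overlap and its translate
    have at most four points together. Otherwise [v] exchanges two points of one
    row that are alone in their columns, and then most of the overlap is preserved
    by [v]. *)
Lemma degree8_false v : v \in G -> #|supp v| = s -> s = 8 -> #|A| = 5 ->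
  (forall a, 0 < row_degree g v a) -> forall a c, a != c -> row_degree g v a = 1%N -> row_degree g v c = 2 -> False.
Proof.
move=> Gv vs s8 m5 R a c ac ka kc.
have bound7 d : a != d -> row_degree g v d = 2 -> #|zsupp g v a d| <= 7 -> False.
  move=> ad kd; have [sU _] := one_two_zcom rowG s_min Gv ad ka kd.
  by rewrite leqNgt; case/negP; move: sU; rewrite s8.
have [p pv pa] : exists2 x, x \in supp v & row g x = a by apply: row_degree_gt0; rewrite ka.
case: (touched_all colG s_min s_gt0 Gv vs) => [C3|C].
  have [j jT] : exists j, j \notin touched (transpose g) v.
    by apply: exists_outside; apply: leq_ltn_trans C3 _; apply: leq_trans A5.
  rewrite touchedE -eqn0Ngt in jT.
  have C2 : #|touched (transpose g) v| <= 2.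
    rewrite leqNgt; apply/negP => C3'.
    have : \sum_(l in touched (transpose g) v) 3 <= s.
      rewrite -[in X in _ <= X]vs -(sum_touched (transpose g)); apply: leq_sum => l; rewrite touchedE => kl.
      have := untouched_bound colG s_min Gv (eqP jT) kl; rewrite s8.
      by case: (row_degree _ v l) => [|[|[|]]].
    by rewrite sum_nat_const s8 => h; have := leq_trans (leq_mul C3' (leqnn 3)) h.
  have [q [q' [[qv qv' qc qc' qq'] _]]] := row2P kc.
  apply: (bound7 c ac kc); apply: card_zsupp7 => //; left.
  set X := overlap g v a c; set t := row_swap g a c.
  have cX : #|X| = 3 by rewrite card_overlap // ka kc.
  have ctX : #|t @: X| = 3 by rewrite (card_imset _ perm_inj).
  have colT x : x \in supp v -> col g x \in touched (transpose g) v.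
    by move=> xv; rewrite touchedE; apply: (row_degree_pos (transpose g)).
  have cqq : col g q != col g q' by apply: contra qq' => /eqP e; apply/eqP/(grid_inj (g := g)); rewrite ?qc.
  have : touched (transpose g) v = [set col g q; col g q'].
    apply/esym/eqP; rewrite eqEcard cards2 cqq C2 andbT.
    by apply/subsetP => _ /set2P[] ->; apply: colT.
  move=> TE; have := colT p pv; rewrite TE => pq.
  have [q0 [q0v q0c e]] : exists q0, [/\ q0 \in supp v, row g q0 = c & col g p = col g q0].
    by case/set2P: pq => ->; [exists q | exists q'].
  have tp : t p = q0.
    by apply: (grid_inj (g := g)); rewrite ?row_row_swap ?col_row_swap // pa tpermL.
  have pX : p \in X by rewrite /X overlapP pv pa eqxx.
  have qX : q0 \in X by rewrite /X overlapP q0v q0c eqxx orbT.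
  rewrite cardsU cX ctX leq_subLR -[_ + 3]/(2 + 4) leq_add2r.
  have pq0 : p != q0 by apply: contraNneq ac => e'; rewrite -pa e' q0c.
  have <- : #|[set p; q0]| = 2 by rewrite cards2 pq0.
  apply/subset_leq_card/subsetP => _ /set2P[] ->; rewrite in_setI ?pX ?qX /=.
    by rewrite -[p](row_swapK g a c) imset_f // -/t tp.
  by rewrite -tp imset_f.
have two_ones (h : grid Om A) : (forall j, 0 < row_degree h v j) -> 1 < #|ones h v|.
  move=> k0; have := ones_sum k0; rewrite vs s8 m5.
  by case: #|_| => [|[|]].
have [j [l [/onesP kj /onesP kl jl]]] := card_gt1P (two_ones _ C).
have [y yv yj] : exists2 x, x \in supp v & row (transpose g) x = j by apply: row_degree_gt0; rewrite kj.
have [w wv wl] : exists2 x, x \in supp v & row (transpose g) x = l by apply: row_degree_gt0; rewrite kl.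
have swp := ones_swapped (g := transpose g) A5 colG (row_swap_transpose2 rowG) no3 Gv.
have yw : col g y != col g w by move: jl; rewrite -yj -wl.
have [ryw vy] : row g y = row g w /\ v y = w.
  by apply: swp; rewrite ?yj ?wl.
have [_ vw] : row g w = row g y /\ v w = y.
  by apply: swp; rewrite ?yj ?wl // eq_sym.
have ynw : y != w by apply: contraNneq yw => ->.
have kd : row_degree g v (row g y) = 2.
  apply/eqP; rewrite eqn_leq; apply/andP; split; last first.
    have <- : #|[set y; w]| = 2 by rewrite cards2 ynw.
    by apply/subset_leq_card/subsetP => x /set2P[] ->; apply/moved_inP.
  rewrite leqNgt; apply/negP => k3.
  have o2 : #|ones g v| = 2.
    by apply/eqP; rewrite eqn_leq two_ones // (ones_le2 A5 rowG colG no3 Gv).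
  have nd : row g y \notin ones g v by apply/onesP => e; rewrite e in k3.
  have H := sum_ge_outside (k := row_degree g v) (D := row g y |: ones g v) (q := 2).
  have := H; rewrite sum_row_degree vs s8 cardsU1 nd o2 m5 big_setU1 //=.
  have -> : \sum_(i in ones g v) row_degree g v i = 2.
    by rewrite -o2 -sum1_card; apply: eq_bigr => i /onesP.
  move=> {}H; have : row_degree g v (row g y) + 2 + 4 <= 8.
    apply: H => i; rewrite in_setU1 negb_or => /andP[_ /onesP ki].
    by case: (row_degree g v i) (R i) ki => [|[|]].
  by rewrite -[8]/(2 + 2 + 4) !leq_add2r leqNgt k3.
have ad : a != row g y by apply/eqP => e; rewrite -e ka in kd.
apply: (bound7 _ ad kd); apply: card_zsupp7 => //; right; exists (v p).
have X2 x : x \in supp v -> row g x = row g y -> x = y \/ x = w.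
  by apply: (row2_cases kd).
apply/subsetP => _ /imsetP[x xX ->]; move: (xX); rewrite overlapP => /andP[xv /orP[]/eqP xr].
  by rewrite (row_degree1_uniq ka xv pv xr pa) setU11.
have inX u : u \in supp v -> row g u = row g y -> u \in v p |: overlap g v a (row g y).
  by move=> uv ur; apply/setUP; right; rewrite overlapP uv ur eqxx orbT.
by case: (X2 x xv xr) => ->; rewrite ?vy ?vw; apply: inX.
Qed.

(** At most two rows have a single moved point, so there are only five rows and the
    degree is 8 or 9. *)
Lemma all_touched_false v : v \in G -> #|supp v| = s -> s <= 9 ->
  (forall a, 0 < row_degree g v a) -> False.
Proof.
move=> Gv vs s9 R; have o2 := ones_le2 A5 rowG colG no3 Gv.
have := ones_sum R; rewrite vs => h.
have m5 : #|A| = 5 by move: h o2 s9 A5; clear; lia.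
have s8 : 8 <= s by move: h o2 m5; clear; lia.
have [a /onesP ka] : exists a, a \in ones g v.
  by apply/card_gt0P; move: h s9 m5; clear; lia.
have [c kc] : exists c, row_degree g v c = 2.
  have [/existsP[c /eqP kc]|/existsPn none] := boolP [exists c, row_degree g v c == 2]; first by exists c.
  have H := sum_ge_outside (k := row_degree g v) (D := ones g v) (q := 3).
  have {}H : \sum_(i in ones g v) row_degree g v i + 3 * (#|A| - #|ones g v|) <= s.
    rewrite -vs -(sum_row_degree g); apply: H => i /onesP ki.
    by case: (row_degree g v i) (R i) ki (none i) => [|[|[|]]].
  have e : \sum_(i in ones g v) row_degree g v i = #|ones g v|.
    by rewrite -sum1_card; apply: eq_bigr => i /onesP.
  by move: H o2 s9 m5; rewrite e; clear; lia.
have ac : a != c by apply/eqP => e; rewrite -e ka in kc.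
have [e8|e8] := eqVneq s 8; first exact: (degree8_false Gv vs e8 m5 R ac ka kc).
have e9 : s = 9 by apply/eqP; rewrite eqn_leq s9 ltn_neqAle eq_sym e8.
exact: (degree9_false A5 rowG colG no3 s_min s_gt0 Gv vs e9 m5 ac ka kc).
Qed.

End SmallDegreeEnd.

(** ** Lines go to lines *)

Section Conclusion.

Variables (Om A : finType) (g : grid Om A) (G : {group {perm Om}}).
Hypothesis A5 : 4 < #|A|.
Hypothesis rowG : forall a b, row_swap g a b \in G.
Hypothesis colG : forall a b, row_swap (transpose g) a b \in G.
Hypothesis no3 : ~~ has_c3 G.

Lemma min_degree_preserves s (v : {perm Om}) :
  (forall w : {perm Om}, w \in G -> w != 1 -> s <= #|supp w|) -> s <= 2 * #|A| ->
  v \in G -> v != 1 -> #|supp v| = s ->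
  s = (2 * #|A|)%N /\
  ((forall x, col g (v x) = col g x) \/ (forall x, row g (v x) = row g x)).
Proof.
move=> s_min s2m Gv nt vs; have s0 : 0 < s by rewrite -vs card_gt0 supp_eq1.
have [s9|s10] := leqP s 9; last exact: (large_degree_preserves A5 rowG colG no3 s_min s2m s10 Gv vs).
exfalso; case: (touched_all rowG s_min s0 Gv vs) => [R3|R]; last first.
  exact: (all_touched_false A5 rowG colG no3 s_min s0 Gv vs s9 R).
case: (touched_all colG s_min s0 Gv vs) => [C3|C].
  exact: (small_box A5 rowG colG no3 Gv nt R3 C3).
by apply: (all_touched_false (g := transpose g) A5 colG (row_swap_transpose2 rowG) no3 s_min s0 Gv vs s9 C).
Qed.

Lemma row_swap_degree_min v : v \in G -> v != 1 -> 2 * #|A| <= #|supp v|.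
Proof.
move=> Gv nv; pose s := #|supp [arg min_(w < v | (w \in G) && (w != 1)) #|supp w|]|.
have [w /andP[Gw nw] ws] : exists2 w, (w \in G) && (w != 1) & #|supp w| = s.
  by rewrite /s; case: arg_minnP => [|w Pw _]; [rewrite Gv | exists w].
have s_min u : u \in G -> u != 1 -> s <= #|supp u|.
  move=> Gu nu; rewrite /s; case: arg_minnP => [|z _ h]; first by rewrite Gv.
  by apply: h; rewrite Gu.
have [s2m|/ltnW s2m] := leqP s (2 * #|A|); last exact: leq_trans s2m (s_min v Gv nv).
by have [<- _] := min_degree_preserves s_min s2m Gw nw ws; apply: s_min.
Qed.

(** The conjugates of the transpositions of rows have minimal degree as well. *)
Lemma row_swapJ_lines h a b : h \in G -> a != b ->
  (forall x, col g (h (row_swap g a b x)) = col g (h x)) \/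
  (forall x, row g (h (row_swap g a b x)) = row g (h x)).
Proof.
move=> Gh ab; have deg := card_supp_row_swap g ab.
have nt : row_swap g a b ^ h != 1.
  rewrite -supp_eq1 suppJ -cards_eq0 (card_imset _ perm_inj) deg.
  by rewrite muln_eq0 /= -lt0n (leq_trans _ A5).
have Gt : row_swap g a b ^ h \in G by rewrite groupJ.
have dt : #|supp (row_swap g a b ^ h)| = (2 * #|A|)%N by rewrite card_suppJ.
have [_ [P|P]] := min_degree_preserves row_swap_degree_min (leqnn _) Gt nt dt; [left | right] => x;
  by rewrite -(P (h x)) permJ.
Qed.

(** By [row_swapJ_lines], [h] maps the points of a column in two given rows to points of
    one column, or for all columns to points of one row. The alternative is the same
    for all pairs of rows, since two sides of a triangle determine the third. *)
Lemma cols_to_lines h : h \in G ->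
  (forall x y, col g x = col g y -> col g (h x) = col g (h y)) \/
  (forall x y, col g x = col g y -> row g (h x) = row g (h y)).
Proof.
move=> Gh; pose t := row_swap g.
pose T a b := [forall x, col g (h (t a b x)) == col g (h x)].
have alt a b : a != b -> ~~ T a b -> forall x, row g (h (t a b x)) = row g (h x).
  move=> ab nT; case: (row_swapJ_lines Gh ab) => // e.
  by case/negP: nT; apply/forallP => x; apply/eqP.
have step a b c : a != b -> b != c -> a != c -> T a b -> T a c.
  move=> ab bc ac Tab; apply: contraT => /(alt a c ac) Rac.
  pose x := cell g a a; pose y := t a b x; pose z := t a c x.
  have rx : row g x = a by apply: row_cell.
  have ry : row g y = b by rewrite row_row_swap rx tpermL.
  have rz : row g z = c by rewrite row_row_swap rx tpermL.
  have yz : t b c y = z.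
    by apply: (grid_inj (g := g)); rewrite ?row_row_swap ?col_row_swap ?row_row_swap ?rx ?tpermL.
  have cyx : col g (h y) = col g (h x) by apply/eqP; move/forallP: Tab; apply.
  have rzx : row g (h z) = row g (h x) by apply: Rac.
  case: (row_swapJ_lines Gh bc) => /(_ y); rewrite -/t yz => e.
    have /perm_inj e' : h z = h x by apply: (grid_inj (g := g)); rewrite // e.
    by rewrite -rx -rz e' eqxx in ac.
  have /perm_inj e' : h y = h x by apply: (grid_inj (g := g)); rewrite // -rzx e.
  by rewrite -rx -ry e' eqxx in ab.
have symT a b : T a b = T b a by rewrite /T /t row_swapC.
have tcol x y : col g x = col g y -> t (row g x) (row g y) x = y.
  by move=> e; apply: (grid_inj (g := g)); rewrite ?row_row_swap ?col_row_swap ?tpermL.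
have [/existsP[a /existsP[b /andP[ab Tab]]]|none] := boolP [exists a, exists b, (a != b) && T a b].
  have Ta c : a != c -> T a c.
    by move=> ac; have [<-//|bc] := eqVneq b c; apply: step Tab.
  have Tall c d : c != d -> T c d.
    have [<-|ac] := eqVneq a c; first exact: Ta.
    have [<-|ad] := eqVneq a d; first by rewrite symT => ca; apply: Ta; rewrite eq_sym.
    by move=> cd; apply: (step c a d); rewrite // 1?eq_sym // symT Ta.
  left=> x y e; have [rxy|rxy] := eqVneq (row g x) (row g y); first by rewrite (grid_inj rxy e).
  by rewrite -[y](tcol x y e); have /forallP/(_ x)/eqP := Tall _ _ rxy.
right=> x y e; have [rxy|rxy] := eqVneq (row g x) (row g y); first by rewrite (grid_inj rxy e).
rewrite -[y in RHS](tcol x y e) (alt _ _ rxy) //; apply: contraNN none => Txy.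
by apply/existsP; exists (row g x); apply/existsP; exists (row g y); rewrite rxy.
Qed.

End Conclusion.

(** By [cols_to_lines], columns go to columns or to rows, and likewise rows. If both
    went to lines in the same direction, the whole grid would go to a single line. *)
Lemma grid_lines (Om A : finType) (g : grid Om A) (G : {group {perm Om}}) (h : {perm Om}) :
  4 < #|A| -> (forall a b, row_swap g a b \in G) -> (forall a b, row_swap (transpose g) a b \in G) ->
  ~~ has_c3 G -> h \in G ->
  ((forall x y, row g x = row g y -> row g (h x) = row g (h y)) /\
   (forall x y, col g x = col g y -> col g (h x) = col g (h y))) \/
  ((forall x y, row g x = row g y -> col g (h x) = col g (h y)) /\
   (forall x y, col g x = col g y -> row g (h x) = row g (h y))).
Proof.
move=> A5 rowG colG no3 Gh.
have /card_gt1P[a [b [_ _ ab]]] : 1 < #|A| by apply: leq_trans A5.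
have hV x : h (h^-1 x) = x by rewrite permKV.
have [C|C] := cols_to_lines A5 rowG colG no3 Gh;
  have [R|R] := cols_to_lines (g := transpose g) A5 colG (row_swap_transpose2 rowG) no3 Gh.
- by left.
- case/eqP: ab; rewrite -(col_cell g a a) -(col_cell g a b) -(hV (cell g a a)) -(hV (cell g a b)).
  set x := h^-1 _; set y := h^-1 _.
  by rewrite (C x (cell g (row g y) (col g x))) ?col_cell //; apply: R; rewrite /= row_cell.
- case/eqP: ab; rewrite -(row_cell g a a) -(row_cell g b a) -(hV (cell g a a)) -(hV (cell g b a)).
  set x := h^-1 _; set y := h^-1 _.
  by rewrite (C x (cell g (row g y) (col g x))) ?col_cell //; apply: R; rewrite /= row_cell.
by right.
Qed.

(** * Permutations as lists of values *)

(** A permutation of the numbers below [n] is given by the list of its values, so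
    that statements on all involutions of a small degree are decided by computation. *)
Definition lcomp (l l' : seq nat) := [seq nth 0 l' i | i <- l].
Definition lpow k (l : seq nat) := iter k (lcomp l) (iota 0 (size l)).
Definition lfix (l : seq nat) := [seq i <- iota 0 (size l) | nth 0 l i == i].
Definition lmoved3 (l : seq nat) := (size (lfix l)).+3 == size l.
Definition linvol (l : seq nat) := lcomp l l == iota 0 (size l).

Definition conj_close (gens ls : seq (seq nat)) :=
  undup (ls ++ [seq lcomp (lcomp s l) s | s <- gens, l <- ls]).

(** The condition for extending the initial part [p] of the list of an involution
    by the value [v]. *)
Definition inv_next (p : seq nat) (v : nat) :=
  if size p \in p then (v < size p) && (nth 0 p v == size p)
  else (size p <= v) && (v \notin p).

Fixpoint inv_prefixes (n k : nat) : seq (seq nat) :=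
  if k is k'.+1 then
    flatten [seq [seq rcons p v | v <- iota 0 n & inv_next p v] | p <- inv_prefixes n k']
  else [:: [::]].

Lemma inv_prefixesP n l : size l = n -> (forall i, i < n -> nth 0 l i < n) ->
  (forall i, i < n -> nth 0 l (nth 0 l i) = i) -> l \in inv_prefixes n n.
Proof.
move=> sl ln ll; have inj i j : i < n -> j < n -> nth 0 l i = nth 0 l j -> i = j.
  by move=> /ll {2}<- /ll {2}<- ->.
suff H k : k <= n -> take k l \in inv_prefixes n k by rewrite -{1}(take_size l) sl H.
elim: k => [|k IHk] kn; first by rewrite take0.
apply/flatten_mapP; exists (take k l); first exact: IHk (ltnW kn).
rewrite (take_nth 0) ?sl //; apply: map_f.
rewrite mem_filter mem_iota /= add0n ln // andbT /inv_next.
have -> : size (take k l) = k by rewrite size_takel // sl ltnW.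
have inP v : reflect (exists2 i, i < k & nth 0 l i = v) (v \in take k l).
  have sk : size (take k l) = k by rewrite size_takel // sl ltnW.
  apply: (iffP (nthP 0)) => -[i]; rewrite ?sk => ik e; exists i; rewrite ?sk // ?nth_take //.
  by rewrite nth_take in e.
case: (inP k) => [[i ik e]|nk].
  have -> : nth 0 l k = i by rewrite -e ll // (ltn_trans ik).
  by rewrite ik nth_take // e eqxx.
have kv : k <= nth 0 l k.
  by rewrite leqNgt; apply/negP => lk; apply: nk; exists (nth 0 l k); rewrite ?ll.
rewrite kv; apply/inP => -[i ik /inj e].
by move: (ik); rewrite e ?ltnn // (ltn_trans ik).
Qed.

Lemma supp3_has_c3 (X : finType) (G : {group {perm X}}) (g : {perm X}) :
  g \in G -> #|supp g| = 3 -> has_c3 G.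
Proof.
move=> Gg s3; have /card_gt0P[x xg] : 0 < #|supp g| by rewrite s3.
set y := g x; set z := g y; have yg : y \in supp g by rewrite supp_perm.
have zg : z \in supp g by rewrite supp_perm.
have xy : x != y by apply/eqP => e; have /suppP[] := xg; rewrite -[RHS]/(id x) [in RHS]e.
have yz : y != z by apply/eqP => e; have /suppP[] := yg; rewrite -[RHS]/(id y) [in RHS]e.
have suppE t : t \in supp g -> x != t -> y != t -> supp g = [set x; y; t].
  move=> tg xt yt; apply/esym/eqP.
  rewrite eqEcard s3 -setUA !cardsU1 cards1 !in_setU !in_set1 negb_or xy xt yt.
  apply/andP; split=> //; apply/subsetP => t'.
  by rewrite !in_setU !in_set1 => /or3P[]/eqP ->.
have xz : x != z.
  apply/eqP => e; have /card_gt0P[w] : 0 < #|supp g :\: [set x; y]|.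
    by rewrite cardsD s3 (setIidPr _) ?cards2 ?xy //; apply/subsetP => w /set2P[] ->.
  rewrite in_setD in_set2 negb_or => /andP[/andP[wx wy] wg].
  have : g w \in supp g by rewrite supp_perm.
  rewrite (suppE w wg) 1?eq_sym // !in_setU !in_set1 => /orP[/orP[]|] /eqP e'.
  - by move: wy; rewrite -(inj_eq (@perm_inj _ g)) e' -/z -e eqxx.
  - by move: wx; rewrite -(inj_eq (@perm_inj _ g)) e' eqxx.
  by have /suppP[] := wg.
have sE := suppE z zg xz yz.
have gz : g z = x.
  have : g z \in supp g by rewrite supp_perm.
  rewrite sE !in_setU !in_set1 => /orP[/orP[]|] /eqP // e.
  - by case/eqP: xz; apply: (@perm_inj _ g); rewrite e.
  by have /suppP[] := zg.
apply/has_c3P; exists x, y, z; rewrite /has3 xy xz yz -(c3_eq (g := g)) // => t tx ty tz.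
by apply/supp0P; rewrite sE !in_setU !in_set1 !negb_or tx ty tz.
Qed.

Section Realized.

Variables (X : finType) (n : nat) (enc : X -> nat) (dec : nat -> X).
Hypotheses (enc_lt : forall x, enc x < n) (encK : cancel enc dec).
Hypothesis decK : forall i, i < n -> enc (dec i) = i.
Variable G : {group {perm X}}.

Definition values (g : {perm X}) := [seq enc (g (dec i)) | i <- iota 0 n].

Lemma size_values g : size (values g) = n. Proof. by rewrite size_map size_iota. Qed.

Lemma nth_values g i : i < n -> nth 0 (values g) i = enc (g (dec i)).
Proof. by move=> lt; rewrite (nth_map 0) ?size_iota // nth_iota. Qed.

Lemma card_enc : #|X| = n.
Proof.
rewrite cardE -(size_map enc) -[RHS](size_iota 0); apply/perm_size/uniq_perm.
- by rewrite map_inj_uniq ?enum_uniq //; apply: can_inj encK.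
- exact: iota_uniq.
move=> i; rewrite mem_iota /= add0n; apply/mapP/idP => [[x _ ->]//|lt].
by exists (dec i); rewrite ?mem_enum ?decK.
Qed.

Lemma values1 : values 1 = iota 0 n.
Proof.
apply: (@eq_from_nth _ 0); rewrite ?size_values ?size_iota // => i lt.
by rewrite nth_values // nth_iota // perm1 decK.
Qed.

Lemma valuesM g h : values (g * h) = lcomp (values g) (values h).
Proof.
rewrite /lcomp -map_comp; apply: eq_map => i /=.
by rewrite nth_values // permM encK.
Qed.

Lemma valuesX g k : values (g ^+ k) = lpow k (values g).
Proof.
rewrite /lpow size_values; elim: k => [|k IHk]; first by rewrite values1.
by rewrite expgS valuesM IHk.
Qed.

Lemma mem_lfix g x : (enc x \in lfix (values g)) = (g x == x).
Proof.
rewrite mem_filter mem_iota size_values /= add0n enc_lt andbT nth_values // encK.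
by rewrite (can_eq encK).
Qed.

Lemma size_lfix g : size (lfix (values g)) = #|~: supp g|.
Proof.
rewrite cardE -(size_map enc); apply/perm_size/uniq_perm.
- by rewrite filter_uniq // iota_uniq.
- by rewrite map_inj_uniq ?enum_uniq //; apply: can_inj encK.
move=> i; apply/idP/mapP => [il|[x]].
  have lt : i < n by move: il; rewrite mem_filter mem_iota size_values => /andP[_ /andP[]].
  exists (dec i); rewrite ?decK // mem_enum in_setC; apply/supp0P/eqP.
  by rewrite -mem_lfix decK.
by rewrite mem_enum in_setC => /supp0P e ->; rewrite mem_lfix e.
Qed.

Lemma values_involution g : linvol (values g) -> g * g = 1.
Proof.
rewrite /linvol size_values -valuesM -values1 => /eqP e; apply/permP => x.
have := congr1 (fun l => nth 0 l (enc x)) e; rewrite !nth_values // encK.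
exact: (can_inj encK).
Qed.

Definition realized (l : seq nat) := exists2 g, g \in G & values g = l.

Lemma realized_conj_close gens ls :
  {in gens, forall l, realized l} -> {in ls, forall l, realized l} ->
  {in conj_close gens ls, forall l, realized l}.
Proof.
move=> rg rl l; rewrite mem_undup mem_cat => /orP[/rl //|/allpairsP[[s t] /= [sg tl ->]]].
have [gs Gs <-] := rg s sg; have [gt Gt <-] := rl t tl.
by exists (gs * gt * gs); rewrite ?groupM // !valuesM.
Qed.

(** A group without 3-cycles that contains the involutions [ws], all with [q] fixed
    points, permutes their fixed point sets under this condition: each candidate
    [u] for a conjugate has one of these fixed point sets or yields a 3-cycle
    [(u w) ^+ k]. *)
Definition fixsets_closed (q k : nat) (ws : seq (seq nat)) :=
  all (fun w => linvol w && (size (lfix w) == q)) ws &&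
  all (fun u => (size (lfix u) != q) || (lfix u \in [seq lfix w | w <- ws])
                || has (fun w => lmoved3 (lpow k (lcomp u w))) ws)
      (inv_prefixes n n).

Lemma permutes_fixsets q k ws g F : ~~ has_c3 G -> fixsets_closed q k ws ->
  {in ws, forall l, realized l} -> g \in G -> F \in [seq lfix w | w <- ws] ->
  exists2 F', F' \in [seq lfix w | w <- ws] &
    forall x, (enc x \in F) = (enc (g x) \in F').
Proof.
move=> no3 /andP[/allP wsP /allP check] rws Gg /mapP[w wws ->].
have [h Gh hw] := rws w wws; have /andP[hinv /eqP hq] := wsP w wws.
rewrite -{}hw in hinv hq *; set u := h ^ g; have Gu : u \in G by rewrite groupJ.
have uu : u * u = 1 by rewrite -conjMg values_involution // conj1g.
have uuE x : u (u x) = x by rewrite -permM uu perm1.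
have uin : values u \in inv_prefixes n n.
  apply: inv_prefixesP => [|i lt|i lt]; first exact: size_values.
    by rewrite nth_values.
  by rewrite !nth_values // encK uuE decK.
have uq : size (lfix (values u)) = q.
  by rewrite -hq !size_lfix [in LHS]cardsCs [in RHS]cardsCs !setCK card_suppJ.
have := check _ uin; rewrite uq eqxx /= => /orP[uF|/hasP[w' w'ws m3]].
  by exists (lfix (values u)) => // x; rewrite !mem_lfix permJ (inj_eq perm_inj).
case/negP: no3; have [h' Gh' hw'] := rws w' w'ws.
apply: (supp3_has_c3 (g := (u * h') ^+ k)); first by rewrite groupX // groupM.
move: m3; rewrite -hw' -valuesM -valuesX /lmoved3 size_lfix size_values => /eqP.
move=> e; apply/eqP; rewrite -(eqn_add2r #|~: supp ((u * h') ^+ k)|) cardsC card_enc.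
by rewrite addnC addn3 e.
Qed.

End Realized.

(** * Parity *)

(** Multiplication by the transposition of a moved point and its image removes these
    two points from the support. *)
Lemma odd_involution (X : finType) (g : {perm X}) :
  g * g = 1 -> odd_perm g = odd (#|supp g| ./2).
Proof.
move: {2}_.+1 (ltnSn #|supp g|) => n; elim: n => // n IHn in g *; rewrite ltnS => sn gg.
have gK x : g (g x) = x by rewrite -permM gg perm1.
have [/eqP|/set0Pn[x xg]] := eqVneq (supp g) set0.
  by rewrite supp_eq1 => /eqP ->; rewrite odd_perm1 (eqP (_ : supp 1 == set0)) ?supp_eq1 ?cards0.
pose t := tperm x (g x).
have xgx : x != g x by rewrite eq_sym; apply/eqP/suppP.
have gt : g ^ t = g.
  apply/permP => y; rewrite conjgE !permM tpermV /t.
  have [->|yx] := eqVneq y x; first by rewrite tpermL gK tpermL.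
  have [->|ygx] := eqVneq y (g x); first by rewrite tpermR tpermR gK.
  rewrite ![tperm _ _ y]tpermD 1?eq_sym // tpermD //.
    by apply: contra ygx => /eqP e; rewrite -(gK y) -e.
  by apply: contra yx => /eqP /perm_inj ->.
have tg : t * g = g * t by rewrite -{1}gt conjgE mulgA tpermV mulgA tperm2 mul1g.
have gtgt : g * t * (g * t) = 1.
  by rewrite -mulgA [t * _]mulgA tg mulgA [g * (g * t)]mulgA gg mul1g tperm2.
have sE : supp g = x |: (g x |: supp (g * t)).
  apply/setP => y; rewrite !in_setU !in_set1 [in RHS]inE permM.
  have [->|yx] := eqVneq y x; first by rewrite xg.
  have [->|ygx] := eqVneq y (g x); first by rewrite supp_perm xg.
  rewrite /= tpermD 1?inE //; first by apply: contra ygx => /eqP e; rewrite -(gK y) -e.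
  by apply: contra yx => /eqP /perm_inj ->.
have nx : x \notin supp (g * t) by apply/supp0P; rewrite permM tpermR.
have ngx : g x \notin supp (g * t) by apply/supp0P; rewrite permM gK tpermL.
have cs : #|supp g| = #|supp (g * t)|.+2.
  by rewrite sE !cardsU1 in_setU1 negb_or xgx nx ngx.
have := IHn (g * t); rewrite cs in sn *; rewrite (leq_trans _ sn) // => /(_ isT gtgt).
by rewrite odd_permM odd_tperm xgx addbT /= => <-; rewrite negbK.
Qed.

(** ** Affine permutations over the field of two elements *)

Section AffineEven.

Variable k : nat.
Hypothesis k3 : 2 < k.
Implicit Types (x a v : 'rV['F_2]_k) (c : 'cV['F_2]_k).

Let V := 'rV['F_2]_k.

Lemma addvv2 m n (x : 'M['F_2]_(m, n)) : (x + x = 0)%R.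
Proof.
apply/matrixP => i j; rewrite !mxE -mulr2n -mulr_natr.
by rewrite (_ : 2%:R = 0 :> 'F_2)%R ?mulr0 //; apply/val_inj.
Qed.

Lemma card_V : #|V| = (2 ^ k)%N.
Proof. by rewrite card_mx mul1n card_Fp. Qed.

Lemma even_half n : (4 %| n)%N -> odd n./2 = false.
Proof. by case/dvdnP => d ->; rewrite (_ : d * 4 = (d * 2).*2)%N ?doubleK ?oddM ?andbF // -muln2 -mulnA. Qed.

Definition translate a : {perm V} := perm (addIr a).

Lemma translateE a x : translate a x = (x + a)%R. Proof. by rewrite permE. Qed.

Lemma even_translate a : odd_perm (translate a) = false.
Proof.
have [->|a0] := eqVneq a 0%R.
  rewrite (_ : translate 0%R = 1) ?odd_perm1 //; apply/permP => x.
  by rewrite translateE addr0 perm1.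
rewrite odd_involution.
  rewrite (_ : supp _ = setT) ?cardsT ?card_V ?even_half //.
    by rewrite -[4%N]/(2 ^ 2)%N dvdn_exp2l // ltnW.
  apply/setP => x; rewrite in_setT; apply/suppP => /eqP; rewrite translateE.
  by rewrite -[X in _ == X]addr0 (inj_eq (addrI x)) (negPf a0).
by apply/permP => x; rewrite permM !translateE -addrA addvv2 addr0 perm1.
Qed.

Definition transvect_fun c a x : V := (x + x *m c *m a)%R.

Lemma transvect_funK c a : (a *m c = 0)%R -> involutive (transvect_fun c a).
Proof.
move=> ac x; rewrite /transvect_fun mulmxDl mulmxDl -(mulmxA (x *m c)%R a c) ac.
by rewrite !mulmx0 mul0mx addr0 -addrA addvv2 addr0.
Qed.

Definition transvect c a (ac : (a *m c = 0)%R) : {perm V} :=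
  perm (inv_inj (transvect_funK ac)).

(** A transvection moves the points outside a hyperplane, [2 ^ k.-1] in number. *)
Lemma even_transvect c a (ac : (a *m c = 0)%R) : odd_perm (transvect ac) = false.
Proof.
have tt : transvect ac * transvect ac = 1.
  by apply/permP => x; rewrite permM !permE transvect_funK.
rewrite odd_involution //.
have sc x : (x *m c = 0)%R \/ (x *m c = 1%:M)%R.
  have F2 (u : 'F_2) : u = 0%R \/ u = 1%R.
    by case: u => [[|[|n]]] // lt; [left | right]; apply: val_inj.
  by rewrite [(x *m c)%R]mx11_scalar; case: (F2 ((x *m c)%R 0%R 0%R)) => ->;
    [left; rewrite raddf0 | right].
have n10 : (1%:M : 'M['F_2]_1)%R != 0%R.
  by apply/eqP => /matrixP/(_ 0%R 0%R); rewrite !mxE.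
have sE : a != 0%R -> supp (transvect ac) = [set x | (x *m c != 0)%R].
  move=> a0; apply/setP => x; apply/suppP/idP; rewrite in_set permE /transvect_fun.
    by apply: contra_notN => /eqP ->; rewrite mul0mx addr0.
  case: (sc x) => -> /=; rewrite ?eqxx // => _ /eqP.
  by rewrite mul1mx -[X in _ == X]addr0 (inj_eq (addrI x)) (negPf a0).
have [a0|a0] := eqVneq a 0%R.
  rewrite (_ : supp _ = set0) ?cards0 //; apply/setP => x; rewrite in_set0.
  by apply/negP/negP/supp0P; rewrite permE /transvect_fun a0 mulmx0 addr0.
rewrite (sE a0); have [->|c0] := eqVneq c 0%R.
  by rewrite (_ : [set x | _] = set0) ?cards0 //; apply/setP => x; rewrite !inE mulmx0 eqxx.
have [b bc] : exists b : V, (b *m c = 1%:M)%R.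
  have [i ci] : exists i, c i 0%R != 0%R.
    apply/existsP; apply: contraR c0 => /existsPn h; apply/eqP/matrixP => i j.
    by rewrite ord1 mxE; apply/eqP; rewrite -[_ == _]negbK h.
  exists (delta_mx 0 i)%R; case: (sc (delta_mx 0 i)%R) => // /matrixP/(_ 0 0)%R.
  by rewrite -rowE !mxE => e; rewrite e eqxx in ci.
set S := [set x | _]; have cS : #|S| = #|~: S|.
  rewrite -(card_imset S (addIr b)); apply: eq_card => x; rewrite inE; apply/imsetP/idP.
    case=> y; rewrite !inE => yc ->; rewrite mulmxDl bc.
    by case: (sc y) yc => -> //; rewrite ?eqxx // addvv2 eqxx.
  rewrite inE negbK => /eqP xc; exists (x + b)%R; last by rewrite -addrA addvv2 addr0.
  by rewrite inE mulmxDl xc bc add0r.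
have : (#|S| * 2 = 2 ^ k.-1 * 2)%N.
  by rewrite -expnSr prednK ?(ltn_trans _ k3) // muln2 -addnn {2}cS cardsC card_V.
move/eqP; rewrite eqn_pmul2r // => /eqP ->; apply: even_half.
rewrite -[4%N]/(2 ^ 2)%N dvdn_exp2l //; move: k3; clear; lia.
Qed.

(** An invertible matrix becomes the identity by one transvection per basis
    vector: if [e_0, .., e_(i-1)] are fixed and [e_i] goes to [w], then some
    transvection fixes the former and maps [w] to [e_i]. *)
Lemma even_linear (f : {perm V}) (L : 'M['F_2]_k) : (forall x, f x = x *m L)%R -> odd_perm f = false.
Proof.
pose e (i : 'I_k) : V := delta_mx 0%R i.
have step i : i <= k -> forall (f : {perm V}) (L : 'M['F_2]_k), (forall x, f x = x *m L)%R ->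
    (forall j : 'I_k, j < k - i -> f (e j) = e j) -> odd_perm f = false.
  elim: i => [|i IHi] ik {}f {}L fL fe.
    rewrite (_ : f = 1) ?odd_perm1 //; apply/permP => x; rewrite perm1 fL.
    rewrite -[RHS]mulmx1; congr (_ *m _)%R; apply/row_matrixP => j.
    by rewrite !rowE mulmx1 -fL fe // subn0.
  have lt : k - i.+1 < k by move: ik; clear; lia.
  pose i0 := Ordinal lt; pose w := f (e i0).
  have f0 : f 0%R = 0%R by rewrite fL mul0mx.
  have [j ij wj] : exists2 j : 'I_k, i0 <= j & w 0%R j = 1%R.
    have [/existsP[j /andP[ij wj]]|/existsPn none] :=
      boolP [exists j : 'I_k, (i0 <= j) && (w 0%R j == 1%R)].
      by exists j => //; apply/eqP.
    have wE : w = f w.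
      rewrite {2}[w]row_sum_delta fL mulmx_suml {1}[w]row_sum_delta.
      apply: eq_bigr => j _; rewrite -scalemxAl -fL.
      have [lj|jl] := ltnP j i0; first by rewrite fe.
      have := none j; rewrite jl /=; case: (w 0%R j) => [[|[|n]]] // ln h.
      by rewrite (_ : Ordinal ln = 0%R) ?scale0r //; apply: val_inj.
    have /perm_inj e0 := esym wE; have := none i0.
    by rewrite leqnn /= e0 mxE !eqxx.
  pose c : 'cV['F_2]_k := (delta_mx i0 0 + (if w 0 i0 == 1 then 0 else delta_mx j 0))%R.
  pose a := (w + e i0)%R.
  have dot (x : V) l : (x *m (delta_mx l 0 : 'cV_k) = (x 0 l)%:M)%R.
    by rewrite -colE [LHS]mx11_scalar mxE.
  have wc : (w *m c = 1%:M)%R.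
    rewrite /c mulmxDr dot; case: eqP => [->|wi]; first by rewrite mulmx0 addr0.
    have -> : w 0%R i0 = 0%R.
      by move: wi; case: (w 0%R i0) => [[|[|n]]] // ln wi; [apply: val_inj | case: wi; apply: val_inj].
    by rewrite dot wj raddf0 add0r.
  have ec : (e i0 *m c = 1%:M)%R.
    rewrite /c mulmxDr dot mxE !eqxx; case: eqP => [_|wi]; first by rewrite mulmx0 addr0.
    rewrite dot mxE eqxx /=; case: eqP => [ji|_]; last by rewrite raddf0 addr0.
    by case: wi; rewrite -ji wj.
  have ac : (a *m c = 0)%R by rewrite mulmxDl wc ec addvv2.
  have tE x : transvect ac x = (x *m (1%:M + c *m a))%R.
    by rewrite permE /transvect_fun mulmxDr mulmx1 mulmxA.
  have := IHi (ltnW ik) (f * transvect ac) (L *m (1%:M + c *m a))%R.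
  rewrite odd_permM even_transvect addbF; apply=> [x|l lt_l].
    by rewrite permM tE fL mulmxA.
  rewrite permM permE /transvect_fun.
  have [->|li] := eqVneq l i0.
    by rewrite -/w wc mul1mx /a addrA addvv2 add0r.
  have ll : l < i0.
    by rewrite ltn_neqAle (inj_eq val_inj) li -ltnS; move: lt_l; rewrite -subSn // subSS.
  have fl : f (e l) = e l by apply: fe.
  rewrite fl (_ : e l *m c = 0)%R ?mul0mx ?addr0 //.
  rewrite /c mulmxDr dot mxE eqxx [i0 == l]eq_sym (negPf li) raddf0 add0r.
  case: eqP => _; first by rewrite mulmx0.
  rewrite dot mxE eqxx /=; case: eqP => [jl|_]; last by rewrite raddf0.
  by move: ij; rewrite jl leqNgt ll.
move=> fL; apply: (step k (leqnn k) f L fL) => j; by rewrite subnn.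
Qed.

Lemma AGL2_even : AGL 'F_2 k \subset 'Alt_V.
Proof.
apply/subsetP => f /AGLP[L [v [_ fE]]]; rewrite Alt_even.
have -> : f = f * translate v * translate v.
  by apply/permP => x; rewrite !permM !translateE -addrA addvv2 addr0.
rewrite odd_permM even_translate addbF (even_linear (L := L)) // => x.
by rewrite permM translateE fE -addrA addvv2 addr0.
Qed.

End AffineEven.

(** Over a prime field an additive bijection is linear. *)
Lemma additive_AGL p k (f : {perm 'rV['F_p]_k}) :
  (forall x y, f (x + y) + f 0 = f x + f y)%R -> f \in AGL 'F_p k.
Proof.
pose h x := (f x - f 0)%R => fD.
have hD x y : h (x + y)%R = (h x + h y)%R.
  by rewrite /h addrACA -fD addrA addrK.
have h0 : h 0%R = 0%R by rewrite /h subrr.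
have hn x n : h (x *+ n)%R = (h x *+ n)%R.
  by elim: n => [|n IHn]; rewrite ?mulr0n // !mulrS hD IHn.
pose L := (\matrix_i h (delta_mx 0 i))%R : 'M['F_p]_k.
have hL x : h x = (x *m L)%R.
  rewrite {1}[x]row_sum_delta mulmx_sum_row.
  rewrite (big_morph h hD h0); apply: eq_bigr => i _.
  rewrite rowK -[x 0%R i]natr_Zp !scaler_nat.
  by rewrite hn.
have fE x : f x = (x *m L + f 0)%R by rewrite -hL subrK.
apply: (AGL_mem _ fE); rewrite -row_free_unit; apply: inj_row_free => x xL.
by apply: (@perm_inj _ f); rewrite fE xL add0r.
Qed.

(** * Gates of arity two *)

Lemma ord2_cases (i : 'I_2) : i = ord0 \/ i = ord_max.
Proof. by case: i => [[|[|n]]] // lt; [left | right]; apply: val_inj. Qed.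

Lemma perm_pair (T : finType) (a c a' c' : T) : a != c -> a' != c' ->
  exists2 p : {perm T}, p a = a' & p c = c'.
Proof.
move=> ac ac'; exists (tperm a a' * tperm (tperm a a' c) c').
  rewrite permM tpermL tpermD //; last by rewrite eq_sym.
  by rewrite -[X in _ != X](tpermL a a') (inj_eq perm_inj) eq_sym.
by rewrite permM tpermL.
Qed.

Section WordGrid.

Variable A : finType.
Implicit Types (x y : word A 2) (a b : A) (G : {group gate A 2}).

Definition word2 a b : word A 2 := [ffun i => if i == ord0 then a else b].

Lemma word2_0 a b : word2 a b ord0 = a. Proof. by rewrite ffunE. Qed.
Lemma word2_1 a b : word2 a b ord_max = b. Proof. by rewrite ffunE. Qed.
Lemma word2K x : word2 (x ord0) (x ord_max) = x.
Proof. by apply/ffunP => i; case: (ord2_cases i) => ->; rewrite ?word2_0 ?word2_1. Qed.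

Definition word_grid : grid (word A 2) A :=
  @Grid (word A 2) A (fun x => x ord0) (fun x => x ord_max) word2 word2_0 word2_1 word2K.

Lemma product_wreathP (f : gate A 2) (g0 g1 : {perm A}) (alpha : 'S_2) :
  (forall x, f x ord0 = g0 (x (alpha^-1 ord0))) ->
  (forall x, f x ord_max = g1 (x (alpha^-1 ord_max))) -> f \in product_wreath A 2.
Proof.
move=> f0 f1; rewrite inE; apply/existsP.
exists [ffun i => if i == ord0 then g0 else g1]; apply/existsP; exists alpha.
by apply/forallP => x; apply/forallP => i; rewrite ffunE; case: (ord2_cases i) => -> /=; apply/eqP.
Qed.

Lemma row_move_wreath (p : {perm A}) : row_move word_grid p \in product_wreath A 2.
Proof.
apply: (product_wreathP (g0 := p) (g1 := 1) (alpha := 1)) => x; rewrite invg1 !perm1.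
  exact: (row_row_move word_grid).
exact: (col_row_move word_grid).
Qed.

Lemma col_move_wreath (p : {perm A}) : row_move (transpose word_grid) p \in product_wreath A 2.
Proof.
apply: (product_wreathP (g0 := 1) (g1 := p) (alpha := 1)) => x; rewrite invg1 !perm1.
  exact: (col_row_move (transpose word_grid)).
exact: (row_row_move (transpose word_grid)).
Qed.

Definition wire_swap : gate A 2 := wire A (tperm ord0 ord_max).

Lemma wire_swap0 x : wire_swap x ord0 = x ord_max.
Proof. by rewrite permE ffunE tpermV tpermL. Qed.

Lemma wire_swap1 x : wire_swap x ord_max = x ord0.
Proof. by rewrite permE ffunE tpermV tpermR. Qed.

Lemma wire_swapK : involutive wire_swap.
Proof. by move=> x; rewrite -[LHS]word2K !(wire_swap0, wire_swap1) word2K. Qed.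

Lemma wire_swap_wreath : wire_swap \in product_wreath A 2.
Proof.
apply: (product_wreathP (g0 := 1) (g1 := 1) (alpha := tperm ord0 ord_max)) => x;
by rewrite perm1 tpermV ?tpermL ?tpermR ?wire_swap0 ?wire_swap1.
Qed.

Lemma injective_perm (u : A -> A) : injective u -> exists p : {perm A}, forall a, p a = u a.
Proof. by move=> inj; exists (perm inj) => a; rewrite permE. Qed.

(** A letter of [h x] depends on the corresponding letter of [x] only. *)
Lemma lines_wreath (h : gate A 2) : 0 < #|A| ->
  ((forall x y, row word_grid x = row word_grid y -> row word_grid (h x) = row word_grid (h y)) /\
   (forall x y, col word_grid x = col word_grid y -> col word_grid (h x) = col word_grid (h y))) ->
  h \in product_wreath A 2.
Proof.
case/card_gt0P => a0 _ [/= R C].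
have [p pE] : exists p : {perm A}, forall a, p a = h (word2 a a0) ord0.
  apply: injective_perm => a b e; have : h (word2 a a0) = h (word2 b a0).
    by rewrite -[LHS]word2K -[RHS]word2K e; congr word2; apply: C; rewrite !word2_1.
  by move/perm_inj => /(congr1 (fun x : word A 2 => x ord0)); rewrite !word2_0.
have [q qE] : exists q : {perm A}, forall a, q a = h (word2 a0 a) ord_max.
  apply: injective_perm => a b e; have : h (word2 a0 a) = h (word2 a0 b).
    by rewrite -[LHS]word2K -[RHS]word2K e; congr word2; apply: R; rewrite !word2_0.
  by move/perm_inj => /(congr1 (fun x : word A 2 => x ord_max)); rewrite !word2_1.
apply: (product_wreathP (g0 := p) (g1 := q) (alpha := 1)) => x; rewrite invg1 perm1.
  by rewrite pE; apply: R; rewrite word2_0.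
by rewrite qE; apply: C; rewrite word2_1.
Qed.

Lemma lines_swap_wreath (h : gate A 2) : 0 < #|A| ->
  ((forall x y, row word_grid x = row word_grid y -> row word_grid (h x) = row word_grid (h y)) /\
   (forall x y, col word_grid x = col word_grid y -> col word_grid (h x) = col word_grid (h y))) \/
  ((forall x y, row word_grid x = row word_grid y -> col word_grid (h x) = col word_grid (h y)) /\
   (forall x y, col word_grid x = col word_grid y -> row word_grid (h x) = row word_grid (h y))) ->
  h \in product_wreath A 2.
Proof.
move=> A0 [|[R C]]; first exact: lines_wreath.
pose W := group (product_wreath_group A 2).
have -> : h = wire_swap * (wire_swap^-1 * h) by rewrite mulKVg.
rewrite -[product_wreath A 2]/(gval W) groupM //; first exact: wire_swap_wreath.
have sV x : wire_swap^-1 x = wire_swap x.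
  by apply: (@perm_inj _ wire_swap); rewrite permKV wire_swapK.
apply: lines_wreath => //; split=> x y /= e; rewrite !permM !sV.
  by apply: C; rewrite /= !wire_swap1.
by apply: R; rewrite /= !wire_swap0.
Qed.

Section Containing.

Variable G : {group gate A 2}.
Hypothesis sWG : product_wreath A 2 \subset G.

Lemma mem_row_move p : row_move word_grid p \in G.
Proof. exact: subsetP sWG _ (row_move_wreath p). Qed.

Lemma mem_col_move p : row_move (transpose word_grid) p \in G.
Proof. exact: subsetP sWG _ (col_move_wreath p). Qed.

Lemma mem_wire_swap : wire_swap \in G.
Proof. exact: subsetP sWG _ wire_swap_wreath. Qed.

Lemma move_word2 p q a b :
  (row_move word_grid p * row_move (transpose word_grid) q) (word2 a b) = word2 (p a) (q b).
Proof.
rewrite permM; apply: (grid_inj (g := word_grid)).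
  rewrite -[row word_grid _]/(col (transpose word_grid) _) col_row_move.
  by rewrite -[col _ _]/(row word_grid _) row_row_move /= !word2_0.
rewrite -[col word_grid _]/(row (transpose word_grid) _) row_row_move.
by rewrite -[row (transpose _) _]/(col word_grid _) col_row_move /= !word2_1.
Qed.

(** In each coordinate two letters can be mapped to any two others. A related pair
    that differs in both coordinates yields one that differs in one coordinate, by
    moving one of its points and keeping the other. *)
Lemma wreath_primitive : 2 < #|A| -> [primitive G, on [set: word A 2] | 'P].
Proof.
move=> A3; have trans2 (a b : A) : exists p : {perm A}, p a = b.
  by exists (tperm a b); rewrite tpermL.
apply: rel_primitive.
  have /card_gt0P[a _] : 0 < #|A| by apply: leq_trans A3.
  apply/imsetP; exists (word2 a a); rewrite ?inE //; apply/esym/setP => x; rewrite in_setT.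
  have [p pa] := trans2 a (x ord0); have [q qa] := trans2 a (x ord_max).
  apply/orbitP; exists (row_move word_grid p * row_move (transpose word_grid) q).
    by rewrite groupM ?mem_row_move ?mem_col_move.
  by rewrite /= apermE move_word2 pa qa word2K.
move=> e eqv inv.
have er x : e x x by case: (eqv x x x).
have es x y : e x y -> e y x by move=> xy; case: (eqv x y x) => _ /(_ xy) <-.
have et y x z : e x y -> e y z -> e x z by move=> xy; case: (eqv x y z) => _ /(_ xy) ->.
have mv (p q : {perm A}) a b c d : e (word2 a b) (word2 c d) ->
    e (word2 (p a) (q b)) (word2 (p c) (q d)).
  move=> h; rewrite -!move_word2; apply: inv h.
  by rewrite groupM ?mem_row_move ?mem_col_move.
have sw a b c d : e (word2 a b) (word2 c d) -> e (word2 b a) (word2 d c).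
  have swE u v : wire_swap (word2 u v) = word2 v u.
    by rewrite -[LHS]word2K wire_swap0 wire_swap1 word2_0 word2_1.
  by move=> h; rewrite -(swE a b) -(swE c d); apply: inv h; apply: mem_wire_swap.
have third (a c : A) : exists d, d != a /\ d != c.
  have [d] : exists d, d \notin [set a; c].
    by apply: exists_outside; apply: leq_ltn_trans A3; rewrite cards2; case: (_ != _).
  by rewrite in_set2 negb_or => /andP[]; exists d.
(* A related pair differing in one letter relates all points, by moving it around. *)
have line a c b : a != c -> e (word2 a b) (word2 c b) -> forall x' y', e x' y'.
  move=> ac h; have all2 u v w : e (word2 u w) (word2 v w).
    have [->//|uv] := eqVneq u v; have [p pa pc] := perm_pair ac uv.
    by have [q qb] := trans2 b w; rewrite -pa -pc -qb; apply: mv.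
  move=> x y; rewrite -[x]word2K -[y]word2K; apply: (et (word2 (y ord0) (x ord_max))).
    exact: all2.
  by apply: sw; apply: all2.
move=> x y xy; rewrite -[x]word2K -[y]word2K => h.
set a := x ord0 in h; set b := x ord_max in h; set c := y ord0 in h; set d := y ord_max in h.
have [bd|bd] := eqVneq b d.
  apply: (line a c b); last by rewrite {2}bd.
  by apply: contra xy => /eqP ac; rewrite -[x]word2K -[y]word2K -/a -/b ac bd.
have [ac|ac] := eqVneq a c.
  by apply: (line b d a) bd _; apply: sw; rewrite {2}ac.
have [f [fa fc]] := third a c; apply: (line a f b); first by rewrite eq_sym.
rewrite eq_sym in fc.
have ca : c != a by rewrite eq_sym.
have [p pa pc] := perm_pair ca fc.
apply: (et (word2 c d) _ _ h); apply: es.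
by have := mv p 1 a b c d h; rewrite !perm1 pa pc.
Qed.

Lemma row_move_odd : odd #|A| -> 1 < #|A| -> ~~ (G \subset 'Alt_(word A 2)).
Proof.
move=> oA /card_gt1P[a [b [_ _ ab]]]; apply/subsetPn; exists (row_swap word_grid a b).
  exact: mem_row_move.
by rewrite Alt_even negbK odd_involution ?row_swap2 // card_supp_row_swap // mul2n doubleK.
Qed.

End Containing.

Lemma odd_row_swap a b : odd_perm (row_swap word_grid a b) = (a != b) && odd #|A|.
Proof.
have [->|ab] := eqVneq a b; last by rewrite odd_involution ?row_swap2 // card_supp_row_swap // mul2n doubleK.
rewrite (_ : row_swap _ b b = 1) ?odd_perm1 // /row_swap tperm1.
exact: row_move1.
Qed.

Lemma odd_col_row_swap a b : odd_perm (row_swap (transpose word_grid) a b) = (a != b) && odd #|A|.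
Proof.
have [->|ab] := eqVneq a b; last by rewrite odd_involution ?row_swap2 // card_supp_row_swap // mul2n doubleK.
rewrite (_ : row_swap _ b b = 1) ?odd_perm1 // /row_swap tperm1.
exact: row_move1.
Qed.

Lemma odd_wire_swap : odd_perm wire_swap = odd 'C(#|A|, 2).
Proof.
have ss : wire_swap * wire_swap = 1.
  by apply/permP => x; rewrite permM perm1 wire_swapK.
rewrite odd_involution // bin2; congr (odd _./2).
pose D := [set word2 a a | a : A]; have cD : #|D| = #|A|.
  by rewrite card_imset // => a b /(congr1 (fun x : word A 2 => x ord0)); rewrite !word2_0.
have -> : supp wire_swap = ~: D.
  apply/setP => x; rewrite in_setC; apply/suppP/idP => [n|/negP n e].
    apply/negP => /imsetP[a _ xa]; case: n; rewrite -[LHS]word2K wire_swap0 wire_swap1.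
    by rewrite xa word2_0 word2_1.
  apply: n; apply/imsetP; exists (x ord0) => //; rewrite -[LHS]word2K.
  by congr word2; rewrite -{1}e wire_swap1.
apply/eqP; rewrite -(eqn_add2l #|D|) cardsC cD card_ffun card_ord expnS expn1.
by case: #|A| => // n; rewrite -mulnS.
Qed.

Lemma even_row_moves (g : grid (word A 2) A) (p : {perm A}) :
  (forall a b, odd_perm (row_swap g a b) = false) -> odd_perm (row_move g p) = false.
Proof.
move=> ev; have [ts -> _] := prod_tpermP p; elim: ts => [|t ts IHts].
  by rewrite big_nil row_move1 odd_perm1.
by rewrite big_cons row_moveM odd_permM IHts addbF; apply: ev.
Qed.

(** A coordinate-wise gate is a row move followed by a column move, after an
    exchange of the coordinates if necessary. *)
Lemma product_wreath_even : (4 %| #|A|)%N -> product_wreath A 2 \subset 'Alt_(word A 2).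
Proof.
move=> A4; have evA : odd #|A| = false.
  by case/dvdnP: A4 => d ->; rewrite oddM andbF.
apply/subsetP => f; rewrite inE => /existsP[g /existsP[alpha /forallP fE]].
have {}fE x i : f x i = g i (x (alpha^-1 i)) by apply/eqP; move/forallP: (fE x); apply.
pose s : gate A 2 := if alpha == 1 then 1 else wire_swap.
have -> : f = s * (row_move word_grid (g ord0) * row_move (transpose word_grid) (g ord_max)).
  apply/permP => x; rewrite permM -[s x]word2K move_word2 -[LHS]word2K !fE /s.
  have [->|a1] := eqVneq alpha 1; first by rewrite invg1 !perm1.
  have -> : alpha = tperm ord0 ord_max.
    have aP i j : i != j -> alpha i != alpha j by rewrite (inj_eq perm_inj).
    apply/permP => i; case: (ord2_cases i) => ->; rewrite ?tpermL ?tpermR.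
      case: (ord2_cases (alpha ord0)) => // e0; case/eqP: a1.
      apply/permP => j; rewrite perm1; case: (ord2_cases j) => -> //.
      by case: (ord2_cases (alpha ord_max)) => // e1; have := aP ord0 ord_max isT; rewrite e0 e1.
    case: (ord2_cases (alpha ord_max)) => // e0; case/eqP: a1.
    apply/permP => j; rewrite perm1; case: (ord2_cases j) => -> //.
    by case: (ord2_cases (alpha ord0)) => // e1; have := aP ord0 ord_max isT; rewrite e0 e1.
  by rewrite tpermV tpermL tpermR wire_swap0 wire_swap1.
rewrite Alt_even !odd_permM !even_row_moves => [|a b|a b]; first last.
- by rewrite odd_row_swap evA andbF.
- by rewrite odd_col_row_swap evA andbF.
rewrite !addbF /s; case: eqP => _; first by rewrite odd_perm1.
rewrite odd_wire_swap bin2; case/dvdnP: A4 => [[|d] ->] //.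
rewrite (_ : d.+1 * 4 * (d.+1 * 4).-1 = (d.+1 * 2 * (d.+1 * 4).-1).*2)%N ?doubleK ?oddM ?andbF //.
by rewrite -mul2n !mulnA; congr (_ * _)%N; rewrite -[4]/(2 * 2)%N; clear; lia.
Qed.

Lemma wire_swap_odd : #|A| = 2 %[mod 4] -> odd_perm wire_swap.
Proof.
move=> A2; rewrite odd_wire_swap bin2 (divn_eq #|A| 4) A2; set d := (_ %/ _)%N.
rewrite (_ : (d * 4 + 2 %% 4) * (d * 4 + 2 %% 4).-1 = ((d * 2 + 1) * (d * 4 + 1)).*2)%N.
  by rewrite doubleK oddM !oddD !oddM !andbF.
by rewrite -[2 %% 4]/2 addn2 /= -addn1 -muln2; clear; lia.
Qed.

End WordGrid.

(** * Maximal groups of gates of arity two *)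

Section Coordinates.

Variables (A : finType) (a0 : A).

(** Letters are numbered by their position in the enumeration of [A], in order to
    describe gates by lists. *)
Definition dig (a : A) : nat := index a (enum A).
Definition el (c : nat) : A := nth a0 (enum A) c.

Lemma dig_lt a : dig a < #|A|. Proof. by rewrite cardE index_mem mem_enum. Qed.
Lemma digK : cancel dig el. Proof. by move=> a; rewrite /el nth_index ?mem_enum. Qed.
Lemma elK c : c < #|A| -> dig (el c) = c.
Proof. by move=> lt; rewrite /dig index_uniq ?enum_uniq // -cardE. Qed.

Definition exch (i j c : nat) := if c == i then j else if c == j then i else c.

Lemma dig_tperm i j a : i < #|A| -> j < #|A| ->
  dig (tperm (el i) (el j) a) = exch i j (dig a).
Proof.
move=> li lj; rewrite /exch; case: tpermP => [->|->|ai aj].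
- by rewrite !elK ?eqxx.
- by rewrite !elK ?eqxx //; case: eqVneq.
case: eqP => [e|_]; first by case: ai; rewrite -e digK.
by case: eqP => // e; case: aj; rewrite -e digK.
Qed.

Variable p : nat.
Hypothesis Ap : #|A| = p.

Definition enc2 (x : word A 2) := (p * dig (x ord0) + dig (x ord_max))%N.
Definition dec2 (i : nat) : word A 2 := word2 (el (i %/ p)) (el (i %% p)).

Lemma enc2_lt x : enc2 x < p * p.
Proof.
have := dig_lt (x ord0); have := dig_lt (x ord_max); rewrite Ap /enc2 => l1 l0.
apply: leq_trans (_ : p * dig (x ord0) + p <= _); first by rewrite ltn_add2l.
by rewrite -mulnSr leq_mul2l l0 orbT.
Qed.

Lemma p_gt0 : 0 < p. Proof. by rewrite -Ap; apply/card_gt0P; exists a0. Qed.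

Lemma enc2K : cancel enc2 dec2.
Proof.
move=> x; have l1 := dig_lt (x ord_max); rewrite Ap in l1.
rewrite /dec2 /enc2 mulnC divnMDl ?p_gt0 // divn_small // addn0 modnMDl modn_small //.
by rewrite !digK word2K.
Qed.

Lemma dec2K i : i < p * p -> enc2 (dec2 i) = i.
Proof.
move=> lt; rewrite /enc2 word2_0 word2_1 !elK ?Ap ?ltn_mod ?ltn_divLR ?p_gt0 //.
by rewrite mulnC -divn_eq.
Qed.

Definition list2 (f : nat -> nat -> nat * nat) :=
  [seq (let r := f (i %/ p) (i %% p) in p * r.1 + r.2)%N | i <- iota 0 (p * p)].

Lemma values_list2 (g : gate A 2) f :
  (forall x : word A 2, f (dig (x ord0)) (dig (x ord_max)) = (dig (g x ord0), dig (g x ord_max))) ->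
  values (p * p) enc2 dec2 g = list2 f.
Proof.
move=> fE; apply/eq_in_map => i; rewrite mem_iota /= add0n => lt.
have := fE (dec2 i); rewrite word2_0 word2_1 !elK ?Ap ?ltn_mod ?ltn_divLR ?p_gt0 //.
by move=> ->.
Qed.

Definition gens2 := [:: list2 (fun c d => (exch 0 1 c, d));
  list2 (fun c d => (exch 1 2 c, d)); list2 (fun c d => (d, c))].

End Coordinates.

Lemma max_perm_alt_or_no3 (X : finType) (G : {group {perm X}}) :
  max_perm_group G -> [primitive G, on [set: X] | 'P] -> ~~ has_c3 G \/ G :=: 'Alt_X.
Proof.
move=> Gmax prG; have [h3|] := boolP (has_c3 G); [right | by left].
exact: max_perm_Alt_sub Gmax (primitive_has_c3 prG h3).
Qed.

Section LevelTwo.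

Variables (A : finType) (G : {group gate A 2}).
Hypothesis Gmax : max_perm_group G.
Hypothesis sWG : product_wreath A 2 \subset G.

Definition level2_class : Prop :=
  [/\ #|A| = 3 & perm_isomorphic G (AGL 'F_3 2)]
  \/ [/\ 5 <= #|A|, odd #|A| & G = product_wreath A 2 :> {set _}]
  \/ [/\ #|A| = 2 %[mod 4] & G = product_wreath A 2 :> {set _}]
  \/ [/\ #|A| = 0 %[mod 4] & G = 'Alt_(word A 2) :> {set _}]
  \/ [/\ #|A| = 0 %[mod 4] & almost_simple_type G].

Lemma card_word_gt1 : 1 < #|A|.
Proof.
have := max_perm_gt1 Gmax; rewrite card_ffun card_ord.
by case: #|A| => [|[|n]].
Qed.

(** Otherwise the wreath product contains an odd permutation: a transposition of two
    rows if [#|A|] is odd, and the exchange of the coordinates if it is 2 modulo 4. *)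
Lemma Alt_mod4 : G = 'Alt_(word A 2) :> {set _} -> #|A| = 0 %[mod 4].
Proof.
move=> GA; have sWA : product_wreath A 2 \subset 'Alt_(word A 2) by rewrite -GA.
have evA : ~~ odd #|A|.
  by apply/negP => oA; have := row_move_odd sWG oA card_word_gt1; rewrite GA subxx.
have n2 : #|A| %% 4 != 2.
  apply/eqP => A2; have := subsetP sWA _ (wire_swap_wreath A); rewrite Alt_even.
  by rewrite wire_swap_odd // A2.
rewrite mod0n; move: evA n2; rewrite {1}(divn_eq #|A| 4) oddD oddM andbF /=.
by have := ltn_pmod #|A| (isT : 0 < 4); case: (_ %% 4) => [|[|[|[|n]]]].
Qed.

Lemma Alt_class : G = 'Alt_(word A 2) :> {set _} -> level2_class.
Proof. by move=> GA; right; right; right; left; split=> //; apply: Alt_mod4. Qed.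

Lemma even_class : #|A| = 0 %[mod 4] -> G \subset 'Alt_(word A 2) -> level2_class.
Proof. by move=> _ /(max_perm_Alt Gmax); apply: Alt_class. Qed.

Lemma wreath_class : 4 < #|A| \/ #|A| = 2 -> G \subset product_wreath A 2 -> level2_class.
Proof.
move=> hA sGW; have GW : G = product_wreath A 2 :> {set _} by apply/eqP; rewrite eqEsubset sGW.
have lt4 := ltn_pmod #|A| (isT : 0 < 4).
have [A0|A0] := eqVneq (#|A| %% 4) 0.
  apply: even_class; rewrite ?mod0n // GW.
  by apply: product_wreath_even; rewrite /dvdn A0.
have [A2|A2] := eqVneq (#|A| %% 4) 2; first by right; right; left; rewrite A2.
right; left; case: hA => [A5|A2']; last by rewrite A2' in A2.
split=> //; rewrite (divn_eq #|A| 4) oddD oddM andbF /=.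
by move: lt4 A0 A2; case: (_ %% 4) => [|[|[|[|n]]]].
Qed.

Lemma level2_large : 4 < #|A| -> level2_class.
Proof.
move=> A5; have A3 : 2 < #|A| by apply: ltn_trans A5.
have [no3|] := max_perm_alt_or_no3 Gmax (wreath_primitive sWG A3); last exact: Alt_class.
apply: wreath_class; first by left.
apply/subsetP => h Gh; apply: lines_swap_wreath; first exact: ltn_trans A5.
apply: grid_lines A5 _ _ no3 Gh => a b; first exact: mem_row_move.
exact: mem_col_move.
Qed.

(** Of the primitive maximal groups of degree 16, the affine one is even, and
    the diagonal and wreath types require larger degrees. *)
Lemma level2_four : #|A| = 4 -> level2_class.
Proof.
move=> A4; have A0 : #|A| = 0 %[mod 4] by rewrite A4.
have c16 : #|{: word A 2}| = 16 by rewrite card_ffun card_ord A4.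
have prG : [primitive G, on [set: word A 2] | 'P] by apply: wreath_primitive; rewrite ?A4.
case: (max_primitive_types Gmax prG) => [|[|[|[|]]]].
- exact: Alt_class.
- case=> p [k [p_pr k0 ck iso]]; rewrite c16 in ck.
  have p2 : p = 2.
    have : p %| 16 by rewrite ck -(prednK k0) expnS dvdn_mulr.
    by rewrite -[16]/(2 ^ 4)%N Euclid_dvdX // => /andP[/prime_nt_dvdP -> //]; case: p p_pr {ck iso} => [|[]].
  have k4 : k = 4 by apply/eqP; rewrite -(eqn_exp2l (m := 2)) // -{1}p2 -ck.
  apply: even_class => //; rewrite {p}p2 {k}k4 in ck iso p_pr k0.
  case: iso => u [v uK vK] iso; apply/subsetP => g Gg.
  have := iso g (transport uK vK g) (transportE uK vK g); rewrite Gg => /esym h.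
  have := subsetP (AGL2_even (isT : 2 < 4)) _ h.
  by rewrite !Alt_even odd_transport.
- case=> T [k [[sT nT] k1 ck _]]; have T29 := nonabelian_simple_card sT nT.
  rewrite cardsT in T29.
  have : #|T| <= 16.
    rewrite -c16 ck -{1}(expn1 #|T|) leq_pexp2l //; first exact: ltn_trans T29.
    by case: k k1 {ck} => [|[|k]].
  by rewrite leqNgt (leq_trans _ T29).
- case=> m [k [m5 k1 ck _]]; have : 5 ^ 2 <= 16.
    rewrite -c16 ck; apply: leq_trans (_ : m ^ 2 <= _); first by rewrite leq_exp2r.
    by rewrite leq_pexp2l // (leq_trans _ m5).
  by [].
by right; right; right; right.
Qed.

End LevelTwo.

(** ** Two and three letters *)

Definition prod_close (gens ls : seq (seq nat)) :=
  undup (ls ++ [seq lcomp l s | l <- ls, s <- gens]).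

Lemma realized_prod_close (X : finType) n (enc : X -> nat) dec (G : {group {perm X}}) gens ls :
  (forall x, enc x < n) -> cancel enc dec ->
  {in gens, forall l, realized n enc dec G l} -> {in ls, forall l, realized n enc dec G l} ->
  {in prod_close gens ls, forall l, realized n enc dec G l}.
Proof.
move=> enc_lt encK rg rl l; rewrite mem_undup mem_cat => /orP[/rl //|/allpairsP[[s t] /= [sl tg ->]]].
have [gs Gs <-] := rl s sl; have [gt Gt <-] := rg t tg.
by exists (gs * gt); rewrite ?groupM // (valuesM enc_lt encK).
Qed.

Lemma realized_iter (X : finType) n (enc : X -> nat) dec (G : {group {perm X}})
    (f : seq (seq nat) -> seq (seq nat)) ls k :
  (forall l0 : seq (seq nat), {in l0, forall l, realized n enc dec G l} -> {in f l0, forall l, realized n enc dec G l}) ->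
  {in ls, forall l, realized n enc dec G l} -> {in iter k f ls, forall l, realized n enc dec G l}.
Proof. by move=> fP rl; elim: k => //= k; apply: fP. Qed.

Lemma values_perm (X : finType) n (enc : X -> nat) dec (g : {perm X}) :
  (forall x, enc x < n) -> cancel enc dec -> (forall i, i < n -> enc (dec i) = i) ->
  values n enc dec g \in permutations (iota 0 n).
Proof.
move=> enc_lt encK decK; rewrite mem_permutations; apply: uniq_perm; rewrite ?iota_uniq //.
  rewrite map_inj_in_uniq ?iota_uniq // => i j; rewrite !mem_iota /= !add0n => li lj.
  by move/(can_inj encK)/perm_inj => e; rewrite -(decK i li) e decK.
move=> i; rewrite mem_iota /= add0n; apply/mapP/idP => [[j _ ->]//|lt].
exists (enc (g^-1 (dec i))); first by rewrite mem_iota /= add0n.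
by rewrite encK permKV decK.
Qed.

Lemma values_inj (X : finType) n (enc : X -> nat) dec (g h : {perm X}) :
  (forall x, enc x < n) -> cancel enc dec ->
  values n enc dec g = values n enc dec h -> g = h.
Proof.
move=> enc_lt encK e; apply/permP => x.
have := congr1 (fun l => nth 0 l (enc x)) e; rewrite !nth_values // encK.
exact: (can_inj encK).
Qed.

Section LevelTwoSmall.

Variables (A : finType) (G : {group gate A 2}).
Hypothesis Gmax : max_perm_group G.
Hypothesis sWG : product_wreath A 2 \subset G.

Lemma realized_row_swap (a0 : A) p (H : {group gate A 2}) i j :
  #|A| = p -> product_wreath A 2 \subset H -> i < p -> j < p ->
  realized (p * p) (enc2 p) (dec2 a0 p) H (list2 p (fun c d => (exch i j c, d))).
Proof.
move=> Ap sWH li lj; exists (row_swap (word_grid A) (el a0 i) (el a0 j)).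
  exact: mem_row_move.
apply: values_list2 => // x.
have -> : row_swap (word_grid A) (el a0 i) (el a0 j) x ord0 = tperm (el a0 i) (el a0 j) (x ord0).
  exact: (row_row_swap (word_grid A)).
have -> : row_swap (word_grid A) (el a0 i) (el a0 j) x ord_max = x ord_max.
  exact: (col_row_swap (word_grid A)).
by rewrite dig_tperm // Ap.
Qed.

Lemma realized_swap (a0 : A) p (H : {group gate A 2}) :
  #|A| = p -> product_wreath A 2 \subset H ->
  realized (p * p) (enc2 p) (dec2 a0 p) H (list2 p (fun c d => (d, c))).
Proof.
move=> Ap sWH; exists (wire_swap A); first exact: mem_wire_swap.
by apply: values_list2 => // x; rewrite wire_swap0 wire_swap1.
Qed.

Definition gens4 := [:: list2 2 (fun c d => (exch 0 1 c, d)); list2 2 (fun c d => (d, c))].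
Definition group4 gens := iter 8 (prod_close gens) [:: iota 0 4].

(** The wreath product [S_2 wr S_2], of order 8, and any other permutation of the
    four points generate the symmetric group. *)
Lemma group4_maximal : all (fun l => (l \in group4 gens4) ||
    all (fun l' => l' \in group4 (l :: gens4)) (permutations (iota 0 4)))
  (permutations (iota 0 4)).
Proof. by vm_compute. Qed.

Lemma level2_two : #|A| = 2 -> level2_class G.
Proof.
move=> A2; have /card_gt0P[a0 _] : 0 < #|A| by rewrite A2.
have lt := enc2_lt A2; have encK := enc2K a0 A2; have decK := dec2K a0 A2.
have real (H : {group gate A 2}) gens : product_wreath A 2 \subset H ->
    {in gens, forall l, realized (2 * 2) (enc2 2) (dec2 a0 2) H l} ->
    {in group4 gens, forall l, realized (2 * 2) (enc2 2) (dec2 a0 2) H l}.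
  move=> sWH rg; apply: realized_iter => [l0|l].
    exact: realized_prod_close.
  by rewrite inE => /eqP ->; exists 1; rewrite ?group1 // values1.
have rgens (H : {group gate A 2}) : product_wreath A 2 \subset H ->
    {in gens4, forall l, realized (2 * 2) (enc2 2) (dec2 a0 2) H l}.
  move=> sWH l; rewrite !inE => /orP[]/eqP ->; first exact: realized_row_swap.
  exact: realized_swap.
apply: wreath_class => //; first by right.
apply/subsetP => g Gg; pose W : {group gate A 2} := group (product_wreath_group A 2).
have sWW : product_wreath A 2 \subset W by apply: subxx.
have := allP group4_maximal _ (values_perm g lt encK decK) => /orP[lW|/allP full].
  have [h Wh e] := real W _ sWW (rgens W sWW) _ lW.
  by rewrite -(values_inj lt encK e).
case: Gmax => /eqP[]; apply/setP => h; rewrite in_setT.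
have hl := full _ (values_perm h lt encK decK).
have [|h' Gh' e] := real G _ sWG _ _ hl.
  move=> l; rewrite inE => /orP[/eqP ->|]; first by exists g.
  exact: rgens.
by rewrite -(values_inj lt encK e).
Qed.

Definition vect (p k : nat) (x : word A k) : 'rV['F_p]_k := (\row_j (dig (x j))%:R)%R.

Lemma vect_bij p k (a0 : A) : prime p -> #|A| = p -> bijective (@vect p k).
Proof.
move=> p_pr Ap; exists (fun v : 'rV['F_p]_k => [ffun j => el a0 (v 0%R j : 'F_p)]).
  move=> x; apply/ffunP => j; rewrite ffunE mxE val_Fp_nat // modn_small ?digK //.
  by rewrite -Ap dig_lt.
move=> v; apply/rowP => j; rewrite mxE ffunE elK ?natr_Zp // Ap.
by apply: leq_trans (ltn_ord _) _; rewrite Fp_cast.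
Qed.

(** The twelve involutions of [S_3 wr S_2] with three fixed points: transpositions of
    two rows or of two columns, and conjugates of the exchange of the coordinates. *)
Definition ws9 := iter 4 (conj_close (gens2 3)) (gens2 3).
Definition lines9 := [seq lfix w | w <- ws9].

(** The number [3 * x + y] stands for the point [(x, y)] of the affine plane of order
    3, where three distinct points form a line if their sum is zero. *)
Definition zsum9 i j l :=
  (3 %| i %/ 3 + j %/ 3 + l %/ 3)%N && (3 %| i %% 3 + j %% 3 + l %% 3)%N.

Lemma ws9_closed : fixsets_closed 9 3 4 ws9. Proof. by vm_compute. Qed.

Lemma lines9P : all (fun i => all (fun j => all (fun l => [|| i == j, j == l, i == l |
    zsum9 i j l == has (fun F => [&& i \in F, j \in F & l \in F]) lines9])
  (iota 0 9)) (iota 0 9)) (iota 0 9).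
Proof. by vm_compute. Qed.

Lemma lines9_zsum i j l : i < 9 -> j < 9 -> l < 9 -> i != j -> j != l -> i != l ->
  zsum9 i j l = has (fun F => [&& i \in F, j \in F & l \in F]) lines9.
Proof.
move=> li lj ll ij jl il; have mem n : n < 9 -> n \in iota 0 9 by rewrite mem_iota.
have := allP (allP (allP lines9P i (mem i li)) j (mem j lj)) l (mem l ll).
by rewrite (negPf ij) (negPf jl) (negPf il) => /eqP.
Qed.

Lemma zsum_vect (x y z : word A 2) : #|A| = 3 ->
  zsum9 (enc2 3 x) (enc2 3 y) (enc2 3 z) = (vect 3 x + vect 3 y + vect 3 z == 0)%R.
Proof.
move=> A3; have dE (w : word A 2) : (enc2 3 w %/ 3 = dig (w ord0)) /\ (enc2 3 w %% 3 = dig (w ord_max)).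
  have l1 := dig_lt (w ord_max); rewrite A3 in l1.
  by rewrite /enc2 mulnC divnMDl // divn_small // addn0 modnMDl modn_small.
have [[x0 x1] [y0 y1] [z0 z1]] := And3 (dE x) (dE y) (dE z).
rewrite /zsum9 x0 x1 y0 y1 z0 z1.
have pr3 : prime 3 by [].
rewrite !(dvdn_pcharf (pchar_Fp pr3)) !natrD; apply/andP/eqP => [[/eqP e0 /eqP e1]|e].
  by apply/rowP => j; rewrite !mxE; case: (ord2_cases j) => ->.
by split; apply/eqP; [move/rowP/(_ ord0): e | move/rowP/(_ ord_max): e]; rewrite !mxE.
Qed.

(** The fixed point sets of these involutions are the lines of the affine plane of
    order 3. By [permutes_fixsets] a group without 3-cycles permutes them, so it
    preserves the relation [x + y + z = 0] and is affine. *)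
Lemma level2_three : #|A| = 3 -> level2_class G.
Proof.
move=> A3; have /card_gt0P[a0 _] : 0 < #|A| by rewrite A3.
have prG := wreath_primitive sWG (eq_leq (esym A3)).
have [no3|GA] := max_perm_alt_or_no3 Gmax prG; last exact: Alt_class.
left; split=> //; have lt := enc2_lt A3; have encK := enc2K a0 A3; have decK := dec2K a0 A3.
have rg : {in gens2 3, forall l, realized (3 * 3) (enc2 3) (dec2 a0 3) G l}.
  move=> l; rewrite !inE => /or3P[]/eqP ->; try exact: realized_row_swap.
  exact: realized_swap.
have rws : {in ws9, forall l, realized (3 * 3) (enc2 3) (dec2 a0 3) G l}.
  by apply: (realized_iter _ rg) => l0; apply: realized_conj_close.
have bij_u := @vect_bij 3 2 a0 isT A3; have [v uK vK] := bij_u.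
have [|h0 nh0] := @AGL_proper 'F_3 2; first by rewrite card_mx card_Fp.
apply: (max_perm_isomorphic Gmax bij_u (AGL_group _ _) nh0) => g Gg.
exists (transport uK vK g); last exact: transportE.
have zero3 (x : 'rV['F_3]_2) : (x + x + x = 0)%R.
  apply/rowP => j; rewrite !mxE -mulr2n -mulrSr -mulr_natr.
  by rewrite (_ : 3%:R = 0 :> 'F_3)%R ?mulr0 //; apply/val_inj.
have lin x y z : (x + y + z = 0)%R ->
    (transport uK vK g x + transport uK vK g y + transport uK vK g z = 0)%R.
  have [<- <- <-] := And3 (vK x) (vK y) (vK z); rewrite !transportE.
  move: (v x) (v y) (v z) => {}x {}y {}z e; apply/eqP; move/eqP: e.
  have [<-|xy] := eqVneq x y.
    by rewrite addrC -[X in _ == X](zero3 (vect 3 x)) [(_ + _ + vect 3 x)%R]addrC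
      (inj_eq (addIr _)) => /eqP/(can_inj uK) ->; rewrite zero3.
  have [<-|yz] := eqVneq y z.
    rewrite -addrA -[X in _ == X](zero3 (vect 3 y)) -[X in _ == X]addrA.
    by rewrite (inj_eq (addIr _)) => /eqP/(can_inj uK) ->; rewrite zero3.
  have [<-|xz] := eqVneq x z.
    rewrite addrAC -[X in _ == X](zero3 (vect 3 x)).
    by rewrite (inj_eq (addrI _)) => /eqP/(can_inj uK) ->; rewrite zero3.
  have ne (s t : word A 2) : s != t -> enc2 3 s != enc2 3 t by rewrite (can_eq encK).
  have neg (s t : word A 2) : s != t -> enc2 3 (g s) != enc2 3 (g t).
    by move=> st; apply: ne; rewrite (inj_eq perm_inj).
  rewrite -(zsum_vect x y z A3) -(zsum_vect (g x) (g y) (g z) A3).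
  rewrite (lines9_zsum (lt x) (lt y) (lt z) (ne _ _ xy) (ne _ _ yz) (ne _ _ xz)).
  rewrite (lines9_zsum (lt _) (lt _) (lt _) (neg _ _ xy) (neg _ _ yz) (neg _ _ xz)).
  case/hasP => F Fl /and3P[xF yF zF]; apply/hasP.
  have [F' F'l FF'] := permutes_fixsets lt encK decK no3 ws9_closed rws Gg Fl.
  by exists F'; last by rewrite -!FF' xF yF.
apply: additive_AGL => x y; have e1 : (x + y + (- (x + y)) = 0)%R by rewrite subrr.
have e2 : ((x + y) + 0 + (- (x + y)) = 0)%R by rewrite addr0 subrr.
by have := lin _ _ _ e2; rewrite -(lin _ _ _ e1) => /addIr.
Qed.

Lemma level2 : level2_class G.
Proof.
have := card_word_gt1 Gmax; have := @level2_large _ _ Gmax sWG.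
case: (ltngtP #|A| 4) => [||A4]; last by move=> _ _; apply: level2_four.
  case E : #|A| => [|[|[|[|n]]]] // _ _ _; [exact: level2_two | exact: level2_three].
by move=> _ h _; apply: h.
Qed.

End LevelTwoSmall.

(** * Maximal groups of gates of arity at least three *)

Section WordCons.

Variable A : finType.
Implicit Types (a b : A).

Definition wcons n a (w : word A n) : word A n.+1 := @catword A 1 n [ffun=> a] w.
Definition wtail n (x : word A n.+1) : word A n := @rword A 1 n x.

Lemma wcons0 n a (w : word A n) : wcons a w ord0 = a.
Proof.
rewrite ffunE; case: splitP => [j|k] /=; first by rewrite ffunE.
by rewrite add1n.
Qed.

Lemma wtailK n a (w : word A n) : wtail (wcons a w) = w.
Proof. exact: rwordK. Qed.

Lemma wconsK n (x : word A n.+1) : wcons (x ord0) (wtail x) = x.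
Proof.
rewrite /wcons (_ : [ffun=> x ord0] = @lword A 1 n x); first exact: (@catwordK A 1 n x).
apply/ffunP => i; rewrite !ffunE.
by congr (x _); apply: val_inj; rewrite /= [i]ord1.
Qed.

Lemma wcons_inj n a b (w w' : word A n) : wcons a w = wcons b w' -> a = b /\ w = w'.
Proof.
move=> e; split; first by rewrite -(wcons0 a w) e wcons0.
by rewrite -(wtailK a w) e wtailK.
Qed.

Definition lift_gate n (g : gate A n) : gate A n.+1 := @par A 1 n 1 g.

Lemma lift_gateE n (g : gate A n) a w : lift_gate g (wcons a w) = wcons a (g w).
Proof. by rewrite permE /par_fun perm1 lwordK rwordK. Qed.

Definition swap01 n : gate A n.+2 := wire A (tperm ord0 (lift ord0 ord0)).

Lemma swap01E n a b (w : word A n) : swap01 n (wcons a (wcons b w)) = wcons b (wcons a w).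
Proof.
set x := wcons a _; have x1 : x (lift ord0 ord0) = b.
  have := congr1 (fun w : word A n.+1 => w ord0) (wtailK a (wcons b w)); rewrite wcons0 ffunE => <-.
  by congr (x _); apply: val_inj.
have xr (j : 'I_n) : x (rshift 1 (rshift 1 j)) = w j.
  have := congr1 (fun w : word A n => w j) (wtailK b w); rewrite ffunE => <-.
  by have := congr1 (fun w : word A n.+1 => w (rshift 1 j)) (wtailK a (wcons b w)); rewrite ffunE => <-.
rewrite -[LHS]wconsK; congr wcons; first by rewrite permE ffunE tpermV tpermL.
rewrite -[LHS]wconsK; congr wcons.
  rewrite ffunE permE ffunE tpermV (_ : rshift 1 ord0 = lift ord0 ord0); last exact: val_inj.
  by rewrite tpermR wcons0.
apply/ffunP => j; rewrite !ffunE permE ffunE tpermV tpermD ?xr //.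
Qed.

Lemma card_word n : #|{: word A n}| = (#|A| ^ n)%N.
Proof. by rewrite card_ffun card_ord. Qed.

Lemma card_supp_lift n (g : gate A n) : #|supp (lift_gate g)| = (#|A| * #|supp g|)%N.
Proof.
have -> : supp (lift_gate g) = [set wcons u.1 u.2 | u in setX [set: A] (supp g)].
  apply/setP => x; rewrite -[x]wconsK; apply/suppP/imsetP => [|[[a w]]].
    rewrite lift_gateE => n1; exists (x ord0, wtail x) => //=.
    by rewrite in_setX inE; apply/suppP => e; apply: n1; rewrite e.
  by rewrite in_setX /= => /andP[_ /suppP wg] ->; rewrite lift_gateE => /wcons_inj[].
rewrite card_imset ?cardsX ?cardsT // => -[a w] [b w'] /wcons_inj[/= -> ->] //.
Qed.

Lemma lift_tperm_odd n (u v : word A n) : u != v ->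
  odd_perm (lift_gate (tperm u v)) = odd #|A|.
Proof.
move=> uv; have ll : lift_gate (tperm u v) * lift_gate (tperm u v) = 1.
  by apply/permP => x; rewrite permM perm1 -[x]wconsK !lift_gateE tpermK.
rewrite odd_involution // card_supp_lift.
have -> : supp (tperm u v) = [set u; v].
  apply/setP => x; rewrite in_set2; apply/suppP/idP => [|/orP[]/eqP ->].
  - by case: tpermP => [->|->|]; rewrite ?eqxx ?orbT.
  - by rewrite tpermL; apply/eqP; rewrite eq_sym.
  by rewrite tpermR; apply/eqP.
by rewrite cards2 uv muln2 doubleK.
Qed.

End WordCons.

Section LevelThree.

Variables (A : finType) (n : nat) (G : {group gate A n.+3}).
Hypothesis A2 : 1 < #|A|.
Hypothesis liftG : forall g : gate A n.+2, lift_gate g \in G.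
Hypothesis wireG : forall alpha, wire A alpha \in G.

Let sw := swap01 A n.+1.

Lemma card_tails : 2 < #|{: word A n.+2}|.
Proof.
rewrite card_word; apply: leq_trans (_ : 2 ^ n.+2 <= _); last by rewrite leq_exp2r.
by rewrite !expnS; have := expn_gt0 2 n; case: (2 ^ n)%N => // k _; rewrite !mul2n !doubleS.
Qed.

Lemma lift_trans a (w w' : word A n.+2) : exists2 g, g \in G & g (wcons a w) = wcons a w'.
Proof. by exists (lift_gate (tperm w w')); [exact: liftG | rewrite lift_gateE tpermL]. Qed.

Lemma level3_primitive : [primitive G, on [set: word A n.+3] | 'P].
Proof.
have swG : sw \in G by apply: wireG.
have [a0 _] : exists a0, a0 \in A by apply/card_gt0P/ltnW.
apply: rel_primitive.
  pose x0 : word A n.+3 := wcons a0 (wcons a0 [ffun=> a0]).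
  apply/imsetP; exists x0; rewrite ?in_setT //; apply/esym/setP => x; rewrite in_setT.
  have [g1 G1 e1] := lift_trans a0 (wcons a0 [ffun=> a0]) (wcons (x ord0) [ffun=> a0]).
  have [g2 G2 e2] := lift_trans (x ord0) (wcons a0 [ffun=> a0]) (wtail x).
  apply/orbitP; exists (g1 * sw * g2); first by rewrite !groupM.
  by rewrite /= apermE !permM e1 swap01E e2 wconsK.
move=> e eqv inv.
have es x y : e x y -> e y x by move=> xy; case: (eqv x y x) => _ /(_ xy) <-; case: (eqv x x x).
have et y x z : e x y -> e y z -> e x z by move=> xy; case: (eqv x y z) => _ /(_ xy) ->.
have er x : e x x by case: (eqv x x x).
have lmv (g : gate A n.+2) a b w w' : e (wcons a w) (wcons b w') -> e (wcons a (g w)) (wcons b (g w')).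
  by move=> h; have := inv _ _ _ (liftG g) h; rewrite !lift_gateE.
have third (w w' : word A n.+2) : exists d, d != w /\ d != w'.
  have [d] : exists d, d \notin [set w; w'].
    by apply: exists_outside; apply: leq_ltn_trans card_tails; rewrite cards2; case: (_ != _).
  by rewrite in_set2 negb_or => /andP[]; exists d.
(* If two words with the same first letter are related, then so are all words
   that share their first or their second letter. *)
have head a w w' : w != w' -> e (wcons a w) (wcons a w') -> forall x y, e x y.
  move=> ww' h; have ha u v : e (wcons a u) (wcons a v).
    have [->//|uv] := eqVneq u v; have [p pu pv] := perm_pair ww' uv.
    by rewrite -pu -pv; apply: lmv.
  have mvh b c (u v : word A n.+1) : e (wcons c (wcons b u)) (wcons c (wcons b v)) ->
      e (wcons b (wcons c u)) (wcons b (wcons c v)).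
    by move=> h'; have := inv _ _ _ swG h'; rewrite !swap01E.
  have hb b u v : e (wcons b u) (wcons b v).
    have h2 : e (wcons b (wcons a [ffun=> a])) (wcons b (wcons a [ffun=> b])).
      by apply: mvh; apply: ha.
    have [->//|uv] := eqVneq u v; have [ab|ab] := eqVneq a b; first by rewrite -ab; apply: ha.
    have ne : wcons a ([ffun=> a] : word A n.+1) != wcons a [ffun=> b].
      apply: contra ab => /eqP /wcons_inj[_ /ffunP/(_ ord0)]; rewrite !ffunE => ->.
      exact: eqxx.
    have [p pu pv] := perm_pair ne uv.
    by rewrite -pu -pv; apply: lmv.
  move=> x y; rewrite -[x]wconsK -[y]wconsK; set b := x ord0; set c := y ord0.
  apply: (et (wcons b (wcons c [ffun=> a]))); first exact: hb.
  apply: (et (wcons c (wcons b [ffun=> a]))); last exact: hb.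
  have h3 : e (wcons b (wcons c [ffun=> a])) (wcons b (wcons b [ffun=> a])) by apply: hb.
  apply: (et _ _ _ h3).
  have h4 : e (wcons b (wcons c [ffun=> a])) (wcons b (wcons b [ffun=> a])) by apply: hb.
  have := inv _ _ _ swG h4; rewrite !swap01E; exact: es.
move=> x y xy h; rewrite -[x]wconsK -[y]wconsK in xy h.
have [ww'|ww'] := eqVneq (wtail x) (wtail y).
  move: xy h; rewrite -ww' -[wtail x]wconsK; set b := _ ord0; set w := wtail (wtail x).
  set a := x ord0; set c := y ord0 => ac /(inv _ _ _ swG); rewrite !swap01E.
  apply: head; apply: contra ac => /eqP/wcons_inj[-> _].
  exact: eqxx.
have [d [dw dw']] := third (wtail x) (wtail y).
rewrite eq_sym in dw; have [p pw pw'] := perm_pair ww' dw.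
apply: (head (y ord0) (wtail y) d); first by rewrite eq_sym.
apply: (et (wcons (x ord0) (wtail x))); first exact: es.
by rewrite -{1}pw -pw'; apply: lmv.
Qed.

(** The transpositions of two words in the coordinates other than the first,
    and in those other than the second, can be chosen with a single common
    moved word as soon as there are three words of length [n + 1]. *)
Lemma level3_c3 : 2 < #|{: word A n.+1}| -> has_c3 G.
Proof.
case/card_gt2P => w1 [w2 [w3 [_ [w12 w23 w31]]]].
have [a0 _] : exists a0, a0 \in A by apply/card_gt0P/ltnW.
pose t w := lift_gate (tperm (wcons a0 w1) (wcons a0 w)).
have tS w a b u : w1 != w -> (wcons b (wcons a u) \in supp (t w)) = (a == a0) && ((u == w1) || (u == w)).
  move=> w1w; apply/suppP/andP; rewrite lift_gateE.
    case: tpermP => [/wcons_inj[-> ->]|/wcons_inj[-> ->]|//]; by rewrite !eqxx ?orbT.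
  have ne : wcons a0 w1 != wcons a0 w by apply: contra w1w => /eqP/wcons_inj[_ ->].
  case=> /eqP -> /orP[]/eqP -> /wcons_inj[_]; rewrite ?tpermL ?tpermR => /eqP; last by rewrite (negPf ne).
  by rewrite eq_sym (negPf ne).
rewrite eq_sym in w31.
apply: (overlap1_has_c3 (v := t w2) (w := t w3 ^ sw) (x := wcons a0 (wcons a0 w1))).
- exact: liftG.
- by rewrite groupJ ?wireG ?liftG.
have swK x : sw (sw x) = x.
  by rewrite -[x]wconsK -[wtail x]wconsK !swap01E.
apply/setP => x; rewrite in_setI in_set1 suppJ.
have -> : (x \in sw @: supp (t w3)) = (sw x \in supp (t w3)).
  by rewrite -{1}[x]swK mem_imset //; apply: perm_inj.
rewrite -[x]wconsK -[wtail x]wconsK swap01E !tS //.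
set b := x ord0; set a := _ ord0; set u := wtail _.
apply/andP/eqP => [[/andP[/eqP -> u12] /andP[/eqP -> u13]]|/wcons_inj[-> /wcons_inj[-> ->]]].
  case/orP: u12 => /eqP eu; rewrite eu //; rewrite eu in u13.
  by move: u13; rewrite (negPf w23) eq_sym (negPf w12).
by rewrite !eqxx.
Qed.

End LevelThree.

(** ** Two letters and arity three *)

Section EightWords.

Definition lift8 (l : seq nat) := [seq (4 * (i %/ 4) + nth 0 l (i %% 4))%N | i <- iota 0 8].
Definition list_tperm n i j := [seq exch i j c | c <- iota 0 n].
Definition swap8 := [seq (4 * ((i %/ 2) %% 2) + (2 * (i %/ 4) + i %% 2))%N | i <- iota 0 8].
Definition gens8 := [:: lift8 (list_tperm 4 0 1); lift8 (list_tperm 4 1 2);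
  lift8 (list_tperm 4 2 3); swap8].
(** The 42 conjugates of a lifted transposition; their fixed point sets are the
    planes of the affine space of dimension 3 over the field of two elements. *)
Definition ws8 := iter 8 (conj_close gens8) [:: lift8 (list_tperm 4 0 1)].
Definition planes8 := [seq lfix w | w <- ws8].

(** A number stands for the point given by its three binary digits. Four distinct
    points form a plane if their sum is zero. *)
Definition zsum8 (i j l m : nat) :=
  [&& ~~ odd (i %/ 4 + j %/ 4 + l %/ 4 + m %/ 4),
      ~~ odd ((i %/ 2) %% 2 + (j %/ 2) %% 2 + (l %/ 2) %% 2 + (m %/ 2) %% 2) &
      ~~ odd (i %% 2 + j %% 2 + l %% 2 + m %% 2)].

Lemma ws8_closed : fixsets_closed 8 4 2 ws8. Proof. by vm_compute. Qed.

Lemma planes8P : all (fun i => all (fun j => all (fun l => all (fun m =>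
    ~~ uniq [:: i; j; l; m] ||
    (zsum8 i j l m == has (fun F => [&& i \in F, j \in F, l \in F & m \in F]) planes8))
  (iota 0 8)) (iota 0 8)) (iota 0 8)) (iota 0 8).
Proof. by vm_compute. Qed.

Lemma planes8_zsum i j l m : i < 8 -> j < 8 -> l < 8 -> m < 8 -> uniq [:: i; j; l; m] ->
  zsum8 i j l m = has (fun F => [&& i \in F, j \in F, l \in F & m \in F]) planes8.
Proof.
move=> li lj ll lm u; have mem n : n < 8 -> n \in iota 0 8 by rewrite mem_iota.
have := allP (allP (allP (allP planes8P i (mem i li)) j (mem j lj)) l (mem l ll)) m (mem m lm).
by rewrite u => /eqP.
Qed.

Variables (A : finType) (a0 : A).
Hypothesis A2 : #|A| = 2.

Definition enc3 (x : word A 3) := (4 * dig (x ord0) + enc2 2 (wtail x))%N.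
Definition dec3 (i : nat) : word A 3 := wcons (el a0 (i %/ 4)) (dec2 a0 2 (i %% 4)).

Lemma enc3_digits x : [/\ enc3 x < 8, enc3 x %/ 4 = dig (x ord0) & enc3 x %% 4 = enc2 2 (wtail x)].
Proof.
have l0 := dig_lt (x ord0); rewrite A2 in l0; have l1 : enc2 2 (wtail x) < 4 := enc2_lt A2 _.
rewrite /enc3 mulnC divnMDl // divn_small // addn0 modnMDl modn_small //; split=> //.
by move: (dig _) (enc2 _ _) l0 l1 => c d; clear; lia.
Qed.

Lemma enc3_lt x : enc3 x < 8. Proof. by case: (enc3_digits x). Qed.

Lemma enc3K : cancel enc3 dec3.
Proof.
by move=> x; rewrite /dec3; case: (enc3_digits x) => _ -> ->; rewrite digK enc2K // wconsK.
Qed.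

Lemma dec3K i : i < 8 -> enc3 (dec3 i) = i.
Proof.
move=> lt; rewrite /enc3 wcons0 wtailK dec2K ?ltn_mod // elK ?A2 ?ltn_divLR //.
by rewrite mulnC -divn_eq.
Qed.

Lemma values_lift (g : gate A 2) :
  values 8 enc3 dec3 (lift_gate g) = lift8 (values 4 (enc2 2) (dec2 a0 2) g).
Proof.
apply/eq_in_map => i; rewrite mem_iota /= add0n => lt.
rewrite lift_gateE (nth_values (n := 4)) ?ltn_mod // /enc3 wcons0 wtailK.
by rewrite elK // A2 ltn_divLR.
Qed.

Lemma values_tperm i j : i < 4 -> j < 4 ->
  values 4 (enc2 2) (dec2 a0 2) (tperm (dec2 a0 2 i) (dec2 a0 2 j)) = list_tperm 4 i j.
Proof.
move=> li lj; have encK := enc2K a0 A2.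
have decK : forall k, k < 4 -> enc2 2 (dec2 a0 2 k) = k := dec2K a0 A2.
apply/eq_in_map => k; rewrite mem_iota /= add0n => lt; rewrite /exch.
have e m : m < 4 -> (k == m) = (dec2 a0 2 k == dec2 a0 2 m).
  by move=> lm; apply/eqP/eqP => [-> //|em]; rewrite -(decK k lt) em decK.
rewrite (e i li) (e j lj); case: tpermP => [->|->|/eqP ni /eqP nj].
- by rewrite eqxx decK.
- rewrite eqxx decK //; case: eqP => // /(congr1 (enc2 2)).
  by rewrite !decK // => ->.
by rewrite (negPf ni) (negPf nj) decK.
Qed.

Lemma word1_1 (a b : A) : (wcons a [ffun=> b] : word A 2) ord_max = b.
Proof.
set x : word A 2 := wcons a _; have : wtail x ord0 = b by rewrite wtailK ffunE.
by rewrite ffunE => <-; congr (x _); apply: val_inj.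
Qed.

Lemma values_swap01 : values 8 enc3 dec3 (swap01 A 1) = swap8.
Proof.
apply/eq_in_map => i; rewrite mem_iota /= add0n => lt.
have -> : dec3 i = wcons (el a0 (i %/ 4)) (wcons (el a0 ((i %/ 2) %% 2)) [ffun=> el a0 (i %% 2)]).
  congr wcons; apply/ffunP => j; rewrite ffunE.
  have -> : (i %% 4) %/ 2 = (i %/ 2) %% 2 by move: lt; clear; lia.
  have -> : (i %% 4) %% 2 = i %% 2 by move: lt; clear; lia.
  by case: (ord2_cases j) => -> /=; rewrite ?wcons0 ?word1_1.
rewrite swap01E /enc3 wcons0 wtailK /enc2 wcons0 word1_1.
by rewrite !elK ?A2 ?ltn_mod ?ltn_divLR.
Qed.

Lemma zsum_vect3 (x y z w : word A 3) :
  zsum8 (enc3 x) (enc3 y) (enc3 z) (enc3 w) =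
  (vect 2 x + vect 2 y + vect 2 z + vect 2 w == 0)%R.
Proof.
have dE (u : word A 3) : [/\ enc3 u %/ 4 = dig (u ord0),
    (enc3 u %/ 2) %% 2 = dig (wtail u ord0) & enc3 u %% 2 = dig (wtail u ord_max)].
  have l0 := dig_lt (wtail u ord0); have l1 := dig_lt (wtail u ord_max); rewrite A2 in l0 l1.
  have [_ -> _] := enc3_digits u; split=> //; rewrite /enc3 /enc2.
    by move: (dig _) (dig _) (dig _) l0 l1 => a b c; clear; lia.
  by move: (dig _) (dig _) (dig _) l0 l1 => a b c; clear; lia.
have [[x0 x1 x2] [y0 y1 y2] [z0 z1 z2]] := And3 (dE x) (dE y) (dE z).
have [w0 w1 w2] := dE w; rewrite /zsum8 x0 x1 x2 y0 y1 y2 z0 z1 z2 w0 w1 w2 -!dvdn2.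
have pr2 : prime 2 by [].
rewrite !(dvdn_pcharf (pchar_Fp pr2)) !natrD; apply/and3P/eqP => [[/eqP e0 /eqP e1 /eqP e2]|e].
  apply/rowP => j; rewrite !mxE; case: (unliftP ord0 j) => [k|] ->; last exact: e0.
  have tE (u : word A 3) : u (lift ord0 k) = wtail u k by rewrite ffunE; congr (u _); apply: val_inj.
  by rewrite !tE; case: (ord2_cases k) => ->.
split; apply/eqP.
- by move/rowP/(_ ord0): e; rewrite !mxE.
- by move/rowP/(_ (rshift 1 (ord0 : 'I_2))): e; rewrite !mxE !ffunE.
- by move/rowP/(_ (rshift 1 (ord_max : 'I_2))): e; rewrite !mxE !ffunE.
Qed.

End EightWords.

(** By [permutes_fixsets] the planes are permuted, so that the group is affine, and
    affine permutations are even. *)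
Lemma level3_eight (A : finType) (G : {group gate A 3}) : #|A| = 2 ->
  (forall g : gate A 2, lift_gate g \in G) -> (forall alpha, wire A alpha \in G) ->
  ~~ has_c3 G -> G \subset 'Alt_(word A 3).
Proof.
move=> A2 liftG wireG no3; have /card_gt0P[a0 _] : 0 < #|A| by rewrite A2.
have lt := enc3_lt A2; have encK := enc3K a0 A2; have decK := dec3K a0 A2.
have rl i j : i < 4 -> j < 4 -> realized 8 (@enc3 A) (dec3 a0) G (lift8 (list_tperm 4 i j)).
  move=> li lj; exists (lift_gate (tperm (dec2 a0 2 i) (dec2 a0 2 j))); first exact: liftG.
  by rewrite values_lift // values_tperm.
have rg : {in gens8, forall l, realized 8 (@enc3 A) (dec3 a0) G l}.
  move=> l; rewrite !inE => /or4P[]/eqP ->; try exact: rl.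
  by exists (swap01 A 1); [apply: wireG | apply: values_swap01].
have rws : {in ws8, forall l, realized 8 (@enc3 A) (dec3 a0) G l}.
  apply: realized_iter => [l0|l]; first exact: realized_conj_close.
  by rewrite inE => /eqP ->; apply: rl.
have bij_u := @vect_bij A 2 3 a0 isT A2; have [v uK vK] := bij_u.
apply/subsetP => g Gg; rewrite Alt_even -(odd_transport uK vK) -Alt_even.
apply: (subsetP (AGL2_even (isT : 2 < 3))); set f := transport uK vK g.
have lin (x y z w : 'rV['F_2]_3) : uniq [:: x; y; z; w] ->
    (x + y + z + w = 0)%R -> (f x + f y + f z + f w = 0)%R.
  rewrite -{2}(vK x) -{2}(vK y) -{2}(vK z) -{2}(vK w) => u /eqP.
  rewrite -(vK x) -(vK y) -(vK z) -(vK w) !transportE -!zsum_vect3 // => e.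
  apply/eqP; rewrite -zsum_vect3 //; move: e.
  have enc_uniq (h : gate A 3) :
      uniq [:: enc3 (h (v x)); enc3 (h (v y)); enc3 (h (v z)); enc3 (h (v w))].
    rewrite -(map_inj_uniq (can_inj vK)) in u.
    rewrite -(map_inj_uniq (@perm_inj _ h)) -(map_inj_uniq (can_inj encK)) in u.
    exact: u.
  have u1 := enc_uniq 1; rewrite !perm1 in u1.
  rewrite !uK (planes8_zsum (lt _) (lt _) (lt _) (lt _) u1).
  rewrite (planes8_zsum (lt _) (lt _) (lt _) (lt _) (enc_uniq g)).
  case/hasP => F Fl /and4P[xF yF zF wF]; apply/hasP.
  have [F' F'l FF'] := permutes_fixsets lt encK decK no3 ws8_closed rws Gg Fl.
  by exists F'; last by rewrite -!FF' xF yF zF.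
apply: additive_AGL => x y.
have [->|x0] := eqVneq x 0%R; first by rewrite add0r addrC.
have [->|y0] := eqVneq y 0%R; first by rewrite addr0.
have [->|xy] := eqVneq x y; first by rewrite !addvv2.
have u : uniq [:: x + y; 0; x; y]%R.
  have xy0 : (x + y != 0)%R.
    by apply: contra xy => /eqP e; rewrite -[x]addr0 -(addvv2 y) addrA e add0r.
  rewrite /= !inE !negb_or xy0 xy andbT ![(0%R == _)]eq_sym x0 y0 !andbT /=.
  rewrite -[X in _ != X]addr0 (inj_eq (addrI x)) y0.
  by rewrite -[X in _ != X]add0r (inj_eq (addIr y)).
have e : (x + y + 0 + x + y = 0)%R by rewrite addr0 -addrA addvv2.
have := lin _ _ _ _ u e => h.
by apply: (addIr (f x + f y)%R); rewrite addvv2 addrA.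
Qed.

Section LevelThreeEnd.

Variables (A : finType) (n : nat) (G : {group gate A n.+3}).
Hypothesis A2 : 1 < #|A|.
Hypothesis liftG : forall g : gate A n.+2, lift_gate g \in G.
Hypothesis wireG : forall alpha, wire A alpha \in G.
Hypothesis Gmax : max_perm_group G.

(** Only the case of two letters and arity 3 escapes [level3_c3]. *)
Lemma level3_Alt : G :=: 'Alt_(word A n.+3).
Proof.
have [no3|//] := max_perm_alt_or_no3 Gmax (level3_primitive A2 liftG wireG).
have [/(level3_c3 A2 liftG wireG)|] := ltnP 2 #|{: word A n.+1}|; first by rewrite (negPf no3).
rewrite card_word expnS => small; have A_2 : #|A| = 2.
  apply/eqP; rewrite eqn_leq A2 andbT; apply: leq_trans small.
  by rewrite leq_pmulr // expn_gt0 ltnW.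
have n0 : n = 0.
  by move: small; rewrite A_2; case: (n) => // k; rewrite expnS mulnA leqNgt (leq_trans (_ : 2 < 4)) // leq_pmulr // expn_gt0.
by subst n; apply: max_perm_Alt Gmax _; apply: level3_eight.
Qed.

Lemma level3_even : ~~ odd #|A|.
Proof.
have [u [v [_ _ uv]]] := card_gt1P (ltnW (card_tails n A2)).
have : lift_gate (tperm u v) \in 'Alt_(word A n.+3) by rewrite -level3_Alt; apply: liftG.
by rewrite Alt_even lift_tperm_odd.
Qed.

End LevelThreeEnd.

(** * Maximal reversible Toffoli algebras *)

Section Levels.

Variables (A : finType) (M : gateset A).
Hypothesis hM : maximal_RTA M.

Let rtaM : is_RTA M. Proof. by case: hM. Qed.

Lemma wire1 n : wire A (1 : 'S_n) = 1.
Proof.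
by apply/permP => x; rewrite perm1 permE; apply/ffunP => i; rewrite ffunE invg1 perm1.
Qed.

Lemma RTA_pos n f : f \in M n -> 0 < n.
Proof. by move/(subsetP (RTA_sub rtaM n)); rewrite inE. Qed.

Lemma RTA_one n : 0 < n -> 1 \in M n.
Proof. by move=> n0; rewrite -wire1; apply: RTA_wire. Qed.

Lemma RTA_group n : 0 < n -> group_set (M n).
Proof.
move=> n0; apply/group_setP; split; first exact: RTA_one.
by move=> f g; apply: RTA_serial.
Qed.

Lemma RTA_maximal (N : gateset A) i : is_RTA N -> gateset_sub M N ->
  0 < i -> N i != [set: gate A i] -> forall j, N j \subset M j.
Proof.
move=> rtaN sMN i0 Ni j; apply: contraT => nNM.
case: hM => _ _ []; exists N; split=> //.
  by split=> // /(_ j); apply/negP.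
split; first exact: RTA_sub.
move/(_ i); rewrite (_ : allgates A i = [set: gate A i]).
  by rewrite subTset; apply/negP.
by apply/setP => f; rewrite !inE i0.
Qed.

(** Gates of arity above [i] can be added freely, since no composition decreases the
    arity. *)
Definition upper i : gateset A := fun j => if j <= i then M j else [set: gate A j].

Lemma upper_RTA i : is_RTA (upper i).
Proof.
split.
- move=> n; rewrite /upper; case: leqP => ni; first exact: RTA_sub.
  by apply/subsetP => f _; rewrite inE (leq_ltn_trans _ ni).
- by move=> n alpha n0; rewrite /upper; case: leqP; rewrite ?in_setT // => _; apply: RTA_wire.
- move=> n m f g; rewrite /upper; case: (leqP (n + m) i) => [nm|]; last by move=> *; rewrite in_setT.
  by rewrite (leq_trans (leq_addr _ _) nm) (leq_trans (leq_addl _ _) nm); apply: RTA_par.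
- by move=> n f g; rewrite /upper; case: leqP; rewrite ?in_setT // => _; apply: RTA_serial.
- move=> n k f g k0; rewrite /upper; case: (leqP (n + k) i) => [nk|]; last by move=> *; rewrite in_setT.
  by rewrite (leq_trans (leq_addr _ _) nk); apply: RTA_serial_padl.
move=> n k f g k0; rewrite /upper; case: (leqP (n + k) i) => [nk|]; last by move=> *; rewrite in_setT.
by rewrite (leq_trans (leq_addr _ _) nk); apply: RTA_serial_padr.
Qed.

Lemma one_proper_level : exists2 i, 0 < i & M i != [set: gate A i] /\
  forall j, 0 < j -> j != i -> M j = [set: gate A j].
Proof.
have [i /andP[i0 Mi] min_i] : exists2 i, (0 < i) && (M i != [set: gate A i]) &
    forall j, (0 < j) && (M j != [set: gate A j]) -> i <= j.
  have ex : exists i, (0 < i) && (M i != [set: gate A i]).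
    have [_ [_ nM] _] := hM; apply: Classical_Prop.NNPP => none; apply: nM => n.
    apply/subsetP => f; rewrite inE => n0; apply: Classical_Prop.NNPP => nMf; apply: none.
    exists n; rewrite n0; apply/eqP => Mn; apply: nMf.
    by rewrite Mn in_setT.
  by case: (ex_minnP ex) => i; exists i.
exists i => //; split=> // j j0 ji; have [lt|le] := ltnP j i.
  by apply/eqP; apply: contraTT lt => nMj; rewrite -leqNgt min_i ?j0.
have lt : i < j by rewrite ltn_neqAle eq_sym ji.
apply/eqP; rewrite -subTset.
have -> : [set: gate A j] = upper i j by rewrite /upper leqNgt lt.
apply: (RTA_maximal (i := i)) => //; first exact: upper_RTA.
  by move=> n; rewrite /upper; case: leqP => // _; apply: subsetT.
by rewrite /upper leqnn.
Qed.

Section AtLevel.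

Variable i : nat.
Hypothesis i_gt0 : 0 < i.
Hypothesis Mi : M i != [set: gate A i].
Hypothesis Mj : forall j, 0 < j -> j != i -> M j = [set: gate A j].

Definition level_group : {group gate A i} := group (RTA_group i_gt0).

Definition replace_level (H : {set gate A i}) : gateset A := fun j =>
  match eq_comparable i j with
  | left e => ecast j {set gate A j} e H
  | right _ => M j
  end.

Lemma replace_level_eq H : replace_level H i = H.
Proof. by rewrite /replace_level; case: eq_comparable => // e; rewrite eq_axiomK. Qed.

Lemma replace_level_neq H j : i != j -> replace_level H j = M j.
Proof.
by move=> ij; rewrite /replace_level; case: eq_comparable => // e; rewrite e eqxx in ij.
Qed.

(** The levels other than [i] are full, except for the empty level 0, and a gate of
    arity [i] composed from gates of smaller arity is already in [M]. *)
Lemma replace_level_RTA (H : {group gate A i}) : M i \subset H -> is_RTA (replace_level H).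
Proof.
move=> sMH; have sub n : M n \subset replace_level H n.
  have [<-|ni] := eqVneq i n; first by rewrite replace_level_eq.
  by rewrite replace_level_neq.
have pos n f : f \in replace_level H n -> 0 < n.
  have [e _|ni] := eqVneq i n; first by rewrite -e.
  by rewrite replace_level_neq //; apply: RTA_pos.
have low n f m : f \in replace_level H n -> 0 < m -> n + m = i -> f \in M n.
  move=> fN m0 nm; rewrite -(replace_level_neq H) // -nm -[X in _ != X]addn0.
  by rewrite eqn_add2l -lt0n.
have high n f : 0 < n -> n != i -> f \in replace_level H n.
  by move=> n0 ni; apply: (subsetP (sub n)); rewrite Mj ?in_setT.
have serial n : forall f g, f \in replace_level H n -> g \in replace_level H n ->
    f * g \in replace_level H n.
  have [<-|ni] := eqVneq i n; first by rewrite replace_level_eq => f g; apply: groupM.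
  by rewrite replace_level_neq // => f g; apply: RTA_serial.
have padded n k f : 0 < k -> f \in replace_level H n -> par f (1 : gate A k) \in replace_level H (n + k)%N.
  move=> k0 fN; have [nk|nk] := eqVneq (n + k)%N i; last first.
    by apply: high; rewrite // addn_gt0 k0 orbT.
  by apply: (subsetP (sub _)); apply: RTA_par => //; [apply: (low n f k) | apply: RTA_one].
split.
- by move=> n; apply/subsetP => f /pos n0; rewrite inE.
- by move=> n alpha n0; apply: (subsetP (sub n)); apply: RTA_wire.
- move=> n m f g fN gN; have n0 := pos n f fN; have m0 := pos m g gN.
  have [nm|nm] := eqVneq (n + m)%N i; last by apply: high; rewrite // addn_gt0 n0.
  apply: (subsetP (sub _)); apply: RTA_par => //; first exact: (low n f m).
  by apply: (low m g n) => //; rewrite addnC.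
- exact: serial.
- move=> n k f g k0 fN gN; apply: serial gN; exact: padded.
by move=> n k f g k0 fN gN; apply: serial gN _; apply: padded.
Qed.

Lemma level_max : max_perm_group level_group.
Proof.
split=> [//|H sMH HT]; apply/eqP; rewrite eqEsubset; apply/andP; split; first exact: sMH.
suff : replace_level H i \subset M i by rewrite replace_level_eq.
apply: (RTA_maximal (i := i)) => //; first exact: replace_level_RTA.
  move=> n; have [<-|ni] := eqVneq i n; first by rewrite replace_level_eq.
  by rewrite replace_level_neq.
by rewrite replace_level_eq.
Qed.

Lemma card_letters : 1 < #|A|.
Proof.
have := max_perm_gt1 level_max; rewrite card_ffun card_ord.
case: #|A| => [|[|k]] //; first by rewrite exp0n.
by rewrite exp1n.
Qed.

End AtLevel.

End Levels.

Lemma max_perm_transport (X Y : finType) (u : X -> Y) (v : Y -> X) (uK : cancel u v)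
    (vK : cancel v u) (G : {group {perm X}}) :
  max_perm_group G -> exists H : {group {perm Y}}, max_perm_group H /\ perm_isomorphic G H.
Proof.
move=> [GT Gmax]; pose H := transport uK vK @: G.
have tinj := @transport_injective _ _ u v uK vK.
have gH : group_set H.
  apply/group_setP; split.
    apply/imsetP; exists 1 => //; apply/permP => y; rewrite -[y]vK transportE.
    by rewrite !perm1.
  by move=> _ _ /imsetP[g Gg ->] /imsetP[h Gh ->]; rewrite -transportM imset_f ?groupM.
have ontoT h : transport uK vK (transport vK uK h) = h.
  by symmetry; apply: transport_uniq => x; rewrite -{2}[x]uK transportE vK.
exists (group gH); split; last first.
  exists u; first by exists v.
  by move=> g h gh; rewrite (transport_uniq uK vK gh) mem_imset.
split=> [|K sHK KT].
  apply: contra GT => /eqP/setP eH; rewrite -subTset; apply/subsetP => g _.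
  by have := eH (transport uK vK g); rewrite in_setT mem_imset.
pose P := [set g | transport uK vK g \in K].
have gP : group_set P.
  apply/group_setP; split.
    rewrite inE (_ : transport uK vK 1 = 1) //; apply/permP => y.
    by rewrite -[y]vK transportE !perm1.
  by move=> g h; rewrite !inE transportM; apply: groupM.
have GP : G :=: group gP.
  apply: Gmax.
    by apply/subsetP => g Gg; rewrite inE; apply: (subsetP sHK); apply: imset_f.
  apply: contra KT => /eqP/setP eP; rewrite -subTset; apply/subsetP => h _.
  by have := eP (transport vK uK h); rewrite in_setT inE ontoT.
apply/eqP; rewrite eqEsubset sHK; apply/subsetP => h Kh.
by rewrite -(ontoT h); apply: imset_f; rewrite GP inE ontoT.
Qed.

Section LetterGates.

Variable A : finType.

Lemma letterwise_inj n (p : {perm A}) : injective (fun x : word A n => [ffun i => p (x i)]).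
Proof.
move=> x y /ffunP e; apply/ffunP => i; have := e i; rewrite !ffunE.
exact: perm_inj.
Qed.

Definition letterwise n (p : {perm A}) : gate A n := perm (@letterwise_inj n p).

Lemma letterwiseE n p (x : word A n) i : letterwise n p x i = p (x i).
Proof. by rewrite permE ffunE. Qed.

(** A product action gate is a wire permutation followed by two parallel gates of
    arity one. *)
Lemma wreath_wire_par (M : gateset A) : is_RTA M -> M 1%N = [set: gate A 1] ->
  product_wreath A 2 \subset M 2.
Proof.
move=> rtaM M1; apply/subsetP => f; rewrite inE => /existsP[g /existsP[alpha /forallP fE]].
have -> : f = wire A alpha * @par A 1 1 (letterwise 1 (g ord0)) (letterwise 1 (g ord_max)).
  apply/permP => x; apply/ffunP => i; rewrite permM [in RHS]permE /par_fun ffunE.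
  have /forallP/(_ i)/eqP -> := fE x; have wE k : x (alpha^-1 k) = wire A alpha x k.
    by rewrite [in RHS]permE ffunE.
  case: (ord2_cases i) => ->; case: splitP => j /= ij; rewrite letterwiseE ffunE wE.
  - by congr (g _ (wire A alpha x _)); apply: val_inj; rewrite /= -ij.
  - by rewrite add1n in ij.
  - by have := ltn_ord j; rewrite -ij.
  by congr (g _ (wire A alpha x _)); apply: val_inj; rewrite /= -ij.
by apply: (RTA_serial rtaM); [apply: RTA_wire | apply: (RTA_par rtaM (n := 1) (m := 1)); rewrite M1 in_setT].
Qed.

End LetterGates.

Theorem theorem4 (A : finType) (M : gateset A) (hM : maximal_RTA M) :
  exists i : nat,
    unique (fun j => 0 < j /\ M j <> [set: gate A j]) i /\
    ((i = 1%N /\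
        (exists G : {group 'S_#|A|}, list_L G /\ perm_isomorphic (M 1%N) G))
     \/ [/\ i = 2, #|A| = 3 & perm_isomorphic (M 2) (AGL 'F_3 2)]
     \/ [/\ i = 2, 5 <= #|A|, odd #|A| & M 2 = product_wreath A 2]
     \/ [/\ i = 2, #|A| = 2 %[mod 4] & M 2 = product_wreath A 2]
     \/ [/\ i = 2, #|A| = 0 %[mod 4] & M 2 = 'Alt_(word A 2)]
     \/ [/\ i = 2, #|A| = 0 %[mod 4] &
          exists T : finGroupType,
            [/\ nonabelian_simple T, #|A| = #|T| &
                perm_isomorphic (M 2) (diagonal_group T 3)]]
     \/ [/\ i = 2, #|A| = 0 %[mod 4] & almost_simple_type (M 2)]
     \/ [/\ 3 <= i, ~~ odd #|A| & M i = 'Alt_(word A i)]).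
Proof.
have [i i0 [Mi Mj]] := one_proper_level hM; exists i; split.
  split; first by split=> //; apply/eqP.
  move=> j [j0 Mjn]; apply/eqP; apply: contraT => ij; case: Mjn.
  by apply: Mj; rewrite // eq_sym.
have [G GM Gmax] : exists2 G : {group gate A i}, M i = G & max_perm_group G.
  by exists (level_group hM i0) => //; apply: level_max.
have A2 := card_letters hM i0 Mi Mj.
have rtaM : is_RTA M by case: hM.
move: i i0 Mi Mj G GM Gmax => [|[|[|n]]] // i0 Mi Mj G GM Gmax.
- left; split=> //.
  have uK : cancel (fun x : word A 1 => enum_rank (x ord0)) (fun k => [ffun=> enum_val k]).
    by move=> x; apply/ffunP => j; rewrite ffunE enum_rankK [j]ord1.
  have vK : cancel (fun k => [ffun=> enum_val k] : word A 1) (fun x : word A 1 => enum_rank (x ord0)).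
    by move=> k; rewrite ffunE enum_valK.
  have [H [Hmax iso]] := max_perm_transport uK vK Gmax.
  by exists H; rewrite GM; split=> //; apply: max_perm_list_L.
- have sWG : product_wreath A 2 \subset G.
    rewrite -GM; apply: wreath_wire_par => //; exact: Mj.
  right; rewrite GM; case: (level2 Gmax sWG) => [[A3 iso]|[[A5 oA GW]|[[A4 GW]|[[A0 GA]|[A0 aS]]]]].
  - by left.
  - by right; left.
  - by right; right; left.
  - by right; right; right; left.
  by right; right; right; right; right; left.
right; right; right; right; right; right; right.
have liftG (g : gate A n.+2) : lift_gate g \in G.
  rewrite -GM; apply: (RTA_par rtaM (n := 1) (m := n.+2)); first exact: (RTA_one hM).
  by rewrite Mj ?in_setT // neq_ltn ltnSn.
have wireG alpha : wire A alpha \in G by rewrite -GM; apply: RTA_wire.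
by split; rewrite ?GM //; [apply: (level3_even A2 liftG wireG Gmax) | apply: (level3_Alt A2 liftG wireG Gmax)].
Qed.
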